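(* Let $p$ be a prime, let $A=\mathbb{F}_p[T]$, let $a\in\mathbb{F}_p^\times$, and let $P_a=T^{p}-T-a\in A$. Then $P_a$ is irreducible of degree $p$. For every integer $n$ with $0\le n\le p-1$, setting $i=p^{n}-1$ and $S_m(i)=\sum_{a'\in A_m}(a')^{i}\in A$, where $A_m$ is the set of monic polynomials of degree $m$ in $A$, one has $$D(X):=\sum_{m=0}^{p-1}S_m(i)\,X^{m}\equiv(1-X)^{n}\pmod{P_a}$$ (congruence of polynomials in $X$, coefficientwise modulo $P_a$, i.e. equality in $(A/P_a)[X]$). Equivalently, $S_m(p^{n}-1)\equiv(-1)^{m}\binom{n}{m}\pmod{P_a}$ for all $0\le m\le p-1$. Consequently, for every $n$ with $1\le n\le p-1$, $$\deg_X g\big(X,\omega_{P_a}^{\,p^{n}-1}\big)=n-1,$$ where $\omega_{P_a}$ is the Teichmüller character at $P_a$ and $g(X,\chi)$ is the congruent-to-one part of the Artin $L$-function $L(X,\chi)$.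
   Context: Convention: $x^0=1$ for all $x$. Let $q$ be a power of a prime $p$ (here $q=p$), $A=\mathbb{F}_q[T]$, $k=\mathbb{F}_q(T)$, and let $\infty$ be the place of $k$ at infinity (valuation $-\deg$), which has degree 1. Let $P\in A$ be a monic irreducible polynomial of degree $d$. Cyclotomic function field: let $C$ be the Carlitz module over $A$, $C_T(x)=Tx+x^q$, and let $\Lambda_P=\{\lambda\in\overline{k}: C_P(\lambda)=0\}$. Then $K_P=k(\Lambda_P)$, and $\mathrm{Gal}(K_P/k)\cong(A/P)^\times$, where the class of $b\in A$ prime to $P$ corresponds to the automorphism $\sigma_b$ with $\sigma_b(\lambda)=C_b(\lambda)$ for $\lambda\in\Lambda_P$. Teichmüller character: fix an embedding $\overline{\mathbb{Q}}\hookrightarrow\overline{\mathbb{Q}}_p$ and an embedding of $A/P$ into the residue field of $\overline{\mathbb{Q}}_p$. The character $\omega_P:\mathrm{Gal}(K_P/k)\cong(A/P)^\times\to\mu_{q^d-1}\subset\overline{\mathbb{Q}}$ sends $x$ to the unique $(q^d-1)$-th root of unity whose reduction in the residue field of $\overline{\mathbb{Q}}_p$ is the image of $x$. Artin $L$-function: for a nontrivial character $\chi$ of $\mathrm{Gal}(K_P/k)$ with values in $\overline{\mathbb{Q}}^\times$, $L(X,\chi)=\prod_{v}(1-\chi(v)X^{\deg v})^{-1}$, the product over all places $v$ of $k$ (including $\infty$), where $\chi(v)$ is the value of $\chi$ at the Frobenius of $v$ if $v$ is unramified in the fixed field $K_P^{\ker\chi}$, and $\chi(v)=0$ if $v$ is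 ramified there. It is a polynomial in $X$ with algebraic-integer coefficients and constant term $1$. Congruent-to-one part: write $L(X,\chi)=\prod_j(1-\alpha_jX)$ with $\alpha_j\in\overline{\mathbb{Q}}_p$ (with multiplicity). Then $g(X,\chi)=\prod_{j:\,v_p(\alpha_j-1)>0}(1-\alpha_jX)$, where $v_p$ is the valuation on $\overline{\mathbb{Q}}_p$ with $v_p(p)=1$. *)

(* Defs.v *)
From HB Require Import structures.
From mathcomp Require Import all_boot all_order all_fingroup all_algebra.
From mathcomp Require Import all_solvable all_field.
From mathcomp Require Import mathcomp_extra boolp classical_sets functions.
From mathcomp Require Import cardinality fsbigop constructive_ereal.

Set Implicit Arguments.
Unset Strict Implicit.
Unset Printing Implicit Defensive.

Import Order.TTheory GRing.Theory Num.Theory.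
Local Open Scope ring_scope.
Local Open Scope classical_set_scope.

Section ValuationRings.
Variable E : fieldType.
Implicit Types (O : set E) (x y : E).

Definition valuation_ring O :=
  [/\ O 1, (forall x y, O x -> O y -> O (x - y)),
      (forall x y, O x -> O y -> O (x * y)) & (forall x, O x \/ O x^-1)].

Definition max_ideal O : set E := [set x | O x /\ (x = 0 \/ ~ O x^-1)].

(* A place of a function field over 'F_p is given by its valuation ring, a
   nontrivial one (it contains the constants, since 'F_p is generated by 1).
   Every such ring is discrete, so this is the usual notion. *)
Definition is_place O := valuation_ring O /\ exists x, ~ O x.

(* red restricted to O is the quotient map of O onto its residue field, up to
   an isomorphism with kappa; the values of red outside O are irrelevant. *)
Definition is_residue_map O (kappa : fieldType) (red : E -> kappa) :=
  [/\ red 1 = 1,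
      (forall x y, O x -> O y -> red (x - y) = red x - red y),
      (forall x y, O x -> O y -> red (x * y) = red x * red y),
      (forall x, O x -> red x = 0 <-> max_ideal O x) &
      (forall z, exists2 x, O x & red x = z)].

End ValuationRings.

Notation ratfun p := {fraction {poly 'F_p}}.

Section PlaceDegree.
Variable p : nat.

(* The residue field of v has dimension d over 'F_p, with basis the reductions
   of the e i. *)
Definition is_place_degree (v : set (ratfun p)) (d : nat) :=
  exists e : 'I_d -> ratfun p, (forall i, v (e i)) /\
    forall x, v x -> exists! c : {ffun 'I_d -> 'F_p},
      max_ideal v (x - \sum_i tofrac (c i)%:P * e i).

Definition place_degree (v : set (ratfun p)) : nat := xget 0%N (is_place_degree v).

Definition lies_above (E : fieldExtType (ratfun p)) (w : set E)
    (v : set (ratfun p)) :=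
  forall x, v x <-> w x%:A.

(* m_v O_w = m_w for all w above v; the residue fields are finite, hence their
   extensions are automatically separable. *)
Definition unramified_in (E : fieldExtType (ratfun p)) (v : set (ratfun p)) :=
  forall w : set E, is_place w -> lies_above w v ->
    forall y, max_ideal w y ->
      exists t z, [/\ max_ideal v t, w z & y = t *: z].

End PlaceDegree.

Section Carlitz.
Variable p : nat.

(* C_T(x) = T x + x^p, a polynomial in x over A = {poly 'F_p}. *)
Definition carlitzT : {poly {poly 'F_p}} := 'X *: 'X + 'X^p.

(* C_b = \sum_i b_i C_{T^i}, where C_{T^i} is the i-th iterate of C_T. *)
Definition carlitz (b : {poly 'F_p}) : {poly {poly 'F_p}} :=
  \sum_(i < size b) (b`_i)%:P *: iter i (fun f => carlitzT \Po f) 'X.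

Variable K : splittingFieldType (ratfun p).

Definition carlitzK (b : {poly 'F_p}) : {poly K} :=
  map_poly (fun c : {poly 'F_p} => (tofrac c)%:A) (carlitz b).

(* K = k(Lambda_P), with C_P split in K. *)
Definition cyclotomic_function_field (P : {poly 'F_p}) :=
  splittingFieldFor 1%VS (carlitzK P) {:K}.

Definition acts_as (P : {poly 'F_p}) (s : gal_of {:K}) (b : {poly 'F_p}) :=
  forall l : K, root (carlitzK P) l -> s l = (carlitzK b).[l].

End Carlitz.

Section Padic.
Variables (p : nat) (Qpbar : closedFieldType) (v : Qpbar -> \bar rat).
Local Open Scope ereal_scope.

Definition is_valuation_over_p :=
  [/\ (forall x, v x = +oo <-> x = 0%R), (forall x, v x != -oo),
      (forall x y, v (x * y)%R = v x + v y),
      (forall x y, Order.min (v x) (v y) <= v (x + y)%R) &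
      v p%:R%R = 1].

Definition vcauchy (u : nat -> rat) :=
  forall e : rat, exists N, forall m n, (N <= m)%N -> (N <= n)%N ->
    e%:E < v (ratr (u m) - ratr (u n))%R.

Definition vlimit (u : nat -> rat) (x : Qpbar) :=
  forall e : rat, exists N, forall n, (N <= n)%N -> e%:E < v (ratr (u n) - x)%R.

(* The closure of Q; it is Q_p by the completeness clause below. *)
Definition Qp : set Qpbar := [set x | exists u, vlimit u x].

(* Characterizes (Qpbar, v) up to isomorphism as an algebraic closure of Q_p
   with the valuation normalized by v p = 1. *)
Definition is_padic_closure :=
  [/\ is_valuation_over_p,
      (forall u, vcauchy u -> exists x, vlimit u x) &
      (forall x, exists f : {poly Qpbar},
         [/\ f \is monic, root f x & forall i, Qp f`_i])].

Definition vring : set Qpbar := [set x | 0 <= v x].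

End Padic.

Section Teichmuller.
Variables (p : nat) (K : splittingFieldType (ratfun p)) (P : {poly 'F_p}).
Variables (Qpbar : closedFieldType) (iota : {rmorphism algC -> Qpbar}).
Variables (kappa : fieldType) (red : Qpbar -> kappa).
Variable j : {rmorphism {poly %/ P} -> kappa}.

(* omega_P (s_b), for b prime to P, is the root of unity of order dividing
   q^d - 1 whose reduction is the image of b. *)
Definition teichmuller (s : gal_of {:K}) : algC :=
  xget 0 [set z : algC | z ^+ (p ^ (size P).-1 - 1) = 1 /\
    exists b, [/\ coprimep b P, acts_as P s b &
                  red (iota z) = j (in_qpoly P b)]].

End Teichmuller.

(* k denotes ratfun p; the place at infinity is among the v with is_place v. *)
Section ArtinL.
Variables (p : nat) (K : splittingFieldType (ratfun p)).
Variable chi : gal_of {:K} -> algC.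

Definition char_field : {subfield K} :=
  fixedField_aspace [set s in 'Gal({:K} / 1)%g | chi s == 1%R]%SET.

(* s in Gal(K / k) restricts to a Frobenius of v in the (abelian) extension
   char_field of k; vsproj inverts the inclusion vsval of char_field in K. *)
Definition lifts_frobenius (v : set (ratfun p)) (s : gal_of {:K}) :=
  exists w : set (subvs_of char_field), [/\ is_place w, lies_above w v &
    forall x, w x ->
      max_ideal w (vsproj char_field (s (vsval x)) - x ^+ (p ^ place_degree v))].

(* chi(v): the Frobenius of v is unique because char_field is abelian over k,
   and chi does not depend on its lift to K. *)
Definition char_place (v : set (ratfun p)) : algC :=
  if `[< unramified_in (subvs_of char_field) v >]
  then chi (xget 1%g [set s | s \in 'Gal({:K} / 1)%g /\ lifts_frobenius v s])
  else 0.

(* The Euler factors of degree at most N; this big operator over a set is 1 by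
   convention on an infinite support, which does not occur since there are
   finitely many places of each degree. *)
Definition euler_den (N : nat) : {poly algC} :=
  \big[*%R/1]_(v \in [set v | is_place v /\ (place_degree v <= N)%N])
    (1 - char_place v *: 'X^(place_degree v)).

(* L = \prod_v (1 - chi(v) X^(deg v))^-1 as formal power series: modulo
   X^(N + 1), only the places of degree at most N contribute. *)
Definition is_artin_L (L : {poly algC}) :=
  forall N, 'X^(N.+1) %| L * euler_den N - 1.

End ArtinL.

Definition is_cong1_part (Qpbar : closedFieldType) (v : Qpbar -> \bar rat)
    (L g : {poly Qpbar}) :=
  exists alphas : seq Qpbar,
    L = \prod_(x <- alphas) (1 - x *: 'X) /\
    g = \prod_(x <- alphas | (0 < v (x - 1)%R)%E) (1 - x *: 'X).

Definition Pa (p : nat) (a : 'F_p) : {poly 'F_p} := 'X^p - 'X - a%:P.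

Definition power_sum (p m i : nat) : {poly 'F_p} :=
  \sum_(b : {poly_m.+1 'F_p} | (size b == m.+1) && ((b : {poly _}) \is monic))
    (b : {poly 'F_p}) ^+ i.

(* Main.v *)
Require Import Defs.
From HB Require Import structures.
From mathcomp Require Import all_boot all_order all_fingroup all_algebra.
From mathcomp Require Import all_solvable all_field.
From mathcomp Require Import mathcomp_extra boolp classical_sets functions.
From mathcomp Require Import cardinality fsbigop constructive_ereal.
From mathcomp Require Import ring zify.

Set Implicit Arguments.
Unset Strict Implicit.
Unset Printing Implicit Defensive.

Import Order.TTheory GRing.Theory Num.Theory.
Local Open Scope ring_scope.
Local Open Scope classical_set_scope.

(* Let F be the p-power map of A/P_a, so that F T = T + a and, on
   polynomials f of degree < p, F f = f(T + a).  Writing C = F - 1,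
     y^(p^n - 1) = F^n y / y = \sum_k binom(n, k) (C^k y) / y.
   Sum over the monic y of degree m.  For k > m the terms vanish since C lowers
   degrees; for k < m they are combinations of the power sums S_m(p^i - 1) with
   i < m, which vanish.  For k = m, C^m is the additive polynomial whose roots
   are the f of degree < m and C^m y does not depend on y, so that the sum is
   the derivative of this polynomial, (-1)^m.
   For the character omega^i with i = p^n - 1, trivial on constants, the place
   at infinity is unramified with trivial Frobenius, P_a is ramified, and the
   Frobenius at Q <> P_a sends a generator lambda of Lambda_P to C_Q(lambda).
   Hence L(X, omega^i) (1 - X) is the generating polynomial of the sums of
   omega^i over the monic polynomials of degree m; it reduces to
   D(X) = (1 - X)^n, so n - 1 reciprocal roots of L reduce to 1. *)

(** * Valuation rings *)

Section Subrings.
Variable E : nzRingType.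

(** The places are treated through one elementary criterion. Let [R] be a subring of a valuation
    ring in which t is not a unit, with field R[1/t], and sigma an automorphism of finite order M
    with sigma(y) = y^N modulo tR. Then y = y^(N^M) modulo tR, which makes t generate the maximal
    ideal and sigma the only Frobenius. It remains to find good rings. At Q <> P_a the local ring
    with lambda adjoined works, because C_Q(x) = x^(p^deg Q) modulo Q. At infinity K itself may
    ramify, so lambda cannot serve; but p - 1 divides i, so omega^i is trivial on constants, its
    field lies in k(l^(p-1)) for each nonzero torsion point l, and a suitable multiple u of l^(p-1)
    by a power of T is -1 modulo 1/T. The obstacle is that u is integral at a given place only for
    the torsion points closest to 0, whose existence has to be proved. At P_a, and for the lower
    bound on the Galois group, the key is that P_a is a unit times a power of lambda. *)

Definition subring (S : set E) :=
  [/\ S 1, (forall x y, S x -> S y -> S (x - y)) &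
      (forall x y, S x -> S y -> S (x * y))].

(* A boolean copy of S, so that the rpred lemmas apply. *)
Definition mem_subring S (hS : subring S) : {pred E} := fun x => `[< S x >].

Lemma mem_subringP S (hS : subring S) x : reflect (S x) (x \in mem_subring hS).
Proof. exact: asboolP. Qed.

Lemma mem_subring_closed S (hS : subring S) :
  GRing.subring_closed (mem_subring hS).
Proof.
case: (hS) => S1 SB SM; split; first exact/mem_subringP.
- by move=> x y /mem_subringP Sx /mem_subringP Sy; apply/mem_subringP/SB.
- by move=> x y /mem_subringP Sx /mem_subringP Sy; apply/mem_subringP/SM.
Qed.

HB.instance Definition _ S (hS : subring S) :=
  GRing.isSubringClosed.Build E (mem_subring hS) (mem_subring_closed hS).

Inductive gen_ring (B : set E) : set E :=
| gen_base x of B x : gen_ring B x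
| gen_one : gen_ring B 1
| gen_sub x y of gen_ring B x & gen_ring B y : gen_ring B (x - y)
| gen_mul x y of gen_ring B x & gen_ring B y : gen_ring B (x * y).

Lemma gen_ring_subring B : subring (gen_ring B).
Proof. by split; [exact: gen_one | exact: gen_sub | exact: gen_mul]. Qed.

Lemma gen_ring_min B S : subring S -> B `<=` S -> gen_ring B `<=` S.
Proof. by case=> S1 SB SM BS x; elim=> {x}; auto. Qed.

End Subrings.

Arguments gen_ring {E} B.

Section Valuation.
Variable E : fieldType.
Implicit Types (O W S : set E) (x y z : E).

Lemma valuation_subring O : valuation_ring O -> subring O.
Proof. by case. Qed.

(** Dividing [g.[z] = 0] by z^(deg g - 1) writes z as a combination over [S] of non-negative powers
    of z^-1. Integral closedness of valuation rings and the determinant trick below both end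
    here. *)
Lemma monic_root_inv S (hS : subring S) (g : {poly E}) z :
  g \is monic -> g \is a polyOver (mem_subring hS) -> root g z -> S z^-1 -> S z.
Proof.
move=> gm gS gz Sz; have [->|z0] := eqVneq z 0.
  by apply/(mem_subringP hS); rewrite rpred0.
have sg : (1 < size g)%N.
  case: ltnP => // /size1_polyC gc; move: gz gm.
  by rewrite gc rootC => /eqP ->; rewrite monicE lead_coef0 eq_sym oner_eq0.
have [n sn] : exists n, size g = n.+2 by exists (size g).-2; rewrite -subn2 -addn2 subnK.
have : g.[z] * z^-1 ^+ n = 0 by rewrite (rootP gz) mul0r.
have gn : g`_n.+1 = 1 by move/monicP: gm; rewrite lead_coefE sn.
rewrite horner_coef sn big_ord_recr /= gn mul1r mulrDl exprSr -mulrA (mulrC z) mulrA exprVn.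
rewrite mulfV ?expf_neq0 // mul1r addrC => /eqP; rewrite addr_eq0 => /eqP ->.
apply/(mem_subringP hS); rewrite rpredN mulr_suml rpred_sum // => i _.
rewrite -mulrA rpredM ?(polyOverP gS) //.
have -> : z ^+ i * z ^- n = z^-1 ^+ (n - i).
  have -> : z ^- n = z^-1 ^+ (i + (n - i)) by rewrite subnKC ?exprVn // -ltnS.
  by rewrite exprD !exprVn mulrA mulfV ?expf_neq0 // mul1r.
by apply: rpredX; apply/mem_subringP.
Qed.

Lemma valuation_integral O (hO : valuation_ring O) (g : {poly E}) z :
  g \is monic -> (forall i, O g`_i) -> root g z -> O z.
Proof.
move=> gm gO gz; have hS := valuation_subring hO.
case: (hO) => _ _ _ /(_ z) [//|Oz]; apply: (monic_root_inv (hS := hS) gm _ gz Oz).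
by apply/polyOverP => i; apply/mem_subringP.
Qed.

Section One.
Variables (O : set E) (hO : valuation_ring O).
Let m := max_ideal O.

Lemma vring1 : O 1. Proof. by case: hO. Qed.
Lemma vringB x y : O x -> O y -> O (x - y). Proof. by case: hO => _ H _ _; apply: H. Qed.
Lemma vringM x y : O x -> O y -> O (x * y). Proof. by case: hO => _ _ H _; apply: H. Qed.
Lemma vring0 : O 0. Proof. by rewrite -(subrr 1); apply: vringB; apply: vring1. Qed.
Lemma vringN x : O x -> O (- x).
Proof. by rewrite -sub0r; apply: vringB; apply: vring0. Qed.
Lemma vringD x y : O x -> O y -> O (x + y).
Proof. by move=> Ox Oy; rewrite -[y]opprK; apply: vringB => //; apply: vringN. Qed.
Lemma vringX x n : O x -> O (x ^+ n).
Proof.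
by move=> Ox; elim: n => [|n IH]; [apply: vring1 | rewrite exprS; apply: vringM].
Qed.
Lemma vring_bool (b : bool) : O b%:R.
Proof. by case: b; [apply: vring1 | apply: vring0]. Qed.
Lemma vring_sum (I : Type) (r : seq I) (Q : pred I) (F : I -> E) :
  (forall i, Q i -> O (F i)) -> O (\sum_(i <- r | Q i) F i).
Proof. by move=> H; apply: big_ind => //; [apply: vring0 | apply: vringD]. Qed.

Lemma vringV x : O x -> ~ m x -> O x^-1.
Proof.
move=> Ox mx; have [//|nx] := EM (O x^-1).
by case: mx; split => //; right.
Qed.

Lemma max_idealE x : m x <-> x = 0 \/ ~ O x^-1.
Proof.
split=> [[_ //]|H]; split => //; case: H => [x0|nx]; first by rewrite x0; apply: vring0.
by case: hO => _ _ _ /(_ x) [].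
Qed.

Lemma max_ideal_sub x : m x -> O x. Proof. by case. Qed.

Lemma max_ideal0 : m 0. Proof. by split; [apply: vring0 | left]. Qed.

Lemma max_idealMl x y : O x -> m y -> m (x * y).
Proof.
move=> Ox [Oy my]; split; first exact: vringM.
have [->|x0] := eqVneq x 0; first by left; rewrite mul0r.
case: my => [->|ny]; first by left; rewrite mulr0.
right=> H; apply: ny; have -> : y^-1 = x * (x * y)^-1 by rewrite invfM mulrA mulfV // mul1r.
exact: vringM.
Qed.

Lemma max_idealMr x y : m x -> O y -> m (x * y).
Proof. by rewrite mulrC => mx Oy; apply: max_idealMl. Qed.

Lemma max_ideal1 : ~ m 1.
Proof. by case=> _ []; [apply/eqP; rewrite oner_eq0 | rewrite invr1; case; apply: vring1]. Qed.

Lemma notin_max_neq0 x : ~ m x -> x != 0.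
Proof. by move=> mx; apply/eqP => x0; apply: mx; rewrite x0; apply: max_ideal0. Qed.

Lemma max_idealN x : m x -> m (- x).
Proof. by rewrite -mulN1r; apply: max_idealMl; apply/vringN/vring1. Qed.

Lemma max_idealD x y : m x -> m y -> m (x + y).
Proof.
move=> mx my; have [x0|x0] := eqVneq x 0; first by rewrite x0 add0r.
have [y0|y0] := eqVneq y 0; first by rewrite y0 addr0.
case: (hO) => _ _ _ /(_ (x / y)) [H|].
  have -> : x + y = (x / y + 1) * y by rewrite mulrDl divfK // mul1r.
  by apply: max_idealMl => //; apply: vringD => //; apply: vring1.
rewrite invf_div => H; have -> : x + y = (y / x + 1) * x by rewrite mulrDl divfK // mul1r addrC.
by apply: max_idealMl => //; apply: vringD => //; apply: vring1.
Qed.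

Lemma max_idealB x y : m x -> m y -> m (x - y).
Proof. by move=> mx my; apply: max_idealD => //; apply: max_idealN. Qed.

Lemma max_ideal_sum (I : Type) (r : seq I) (Q : pred I) (F : I -> E) :
  (forall i, Q i -> m (F i)) -> m (\sum_(i <- r | Q i) F i).
Proof. by move=> H; apply: big_ind => //; [apply: max_ideal0 | apply: max_idealD]. Qed.

Lemma max_ideal_expn x n : (0 < n)%N -> m x -> m (x ^+ n).
Proof.
case: n => // n _ mx; rewrite exprS; apply: max_idealMr => //.
by apply: vringX; apply: max_ideal_sub.
Qed.

Lemma max_ideal_prime x y : O x -> O y -> m (x * y) -> m x \/ m y.
Proof.
move=> Ox Oy mxy; have [|nx] := EM (m x); [by left | right].
have [x0|x0] := eqVneq x 0; first by case: nx; rewrite x0; apply: max_ideal0.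
have -> : y = x^-1 * (x * y) by rewrite mulKf.
by apply: max_idealMl => //; apply: vringV.
Qed.

Lemma max_idealX x n : O x -> m (x ^+ n) -> m x.
Proof.
move=> Ox; elim: n => [/max_ideal1//|n IH]; rewrite exprS => /max_ideal_prime.
by case=> //; apply: vringX.
Qed.

Lemma unit_notin_max x : O x -> O x^-1 -> x != 0 -> ~ m x.
Proof. by move=> _ Ox x0 [_ []] // /eqP; rewrite (negPf x0). Qed.

Lemma max_ideal_expB x y n : O x -> O y -> m (x - y) -> m (x ^+ n - y ^+ n).
Proof.
move=> Ox Oy mxy; rewrite subrXX; apply: max_idealMr => //.
by apply: vring_sum => i _; apply: vringM; apply: vringX.
Qed.

End One.

(** An x in [W] outside [O] would have its inverse in the maximal ideal of [O], hence in that of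
    [W]. Valuation rings are thus maximal for domination, which is how the places of k get
    identified. *)
Lemma valuation_ring_max O W : valuation_ring O -> valuation_ring W ->
  O `<=` W -> max_ideal O `<=` max_ideal W -> W `<=` O.
Proof.
move=> hO hW OW mOW x Wx; have [//|nx] := EM (O x).
have x0 : x != 0 by apply/eqP => x0; apply: nx; rewrite x0; apply: vring0.
have : max_ideal W x^-1 by apply: mOW; apply/(max_idealE hO); right; rewrite invrK.
by move=> [_ []]; [move/eqP; rewrite invr_eq0 (negPf x0) | rewrite invrK].
Qed.

End Valuation.

(** * Chevalley's extension of valuation rings to a larger field *)

Section Extension.
Variables (k K : fieldType) (f : {rmorphism k -> K}).

Section DetTrick.
Variables (S : set K) (hS : subring S) (x t : K) (g h : {poly K}).
Hypotheses (gS : g \is a polyOver (mem_subring hS))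
  (hhS : h \is a polyOver (mem_subring hS)) (St : S t).
Hypotheses (x0 : x != 0) (gx : t * g.[x] = 1) (hx : t * h.[x^-1] = 1).

(* The powers x^(-size h), ..., x^(size g - 1) span an S-module M with M = t M,
   so t^-1 is an eigenvalue of a matrix over S. *)
Lemma det_trick : S t^-1.
Proof.
set n := size g; set m := size h.
have t0 : t != 0 by apply/eqP => t0; move/eqP: gx; rewrite t0 mul0r eq_sym oner_eq0.
have hn : (0 < n)%N.
  rewrite size_poly_gt0; apply/eqP => g0.
  by move/eqP: gx; rewrite g0 horner0 mulr0 eq_sym oner_eq0.
(* [q j] takes the value t^-1 x^j at x. It comes from g(x) x^j for small j and from h(x^-1) x^j for
   large j, so that no degree reaches n + m and no negative exponent occurs. *)
pose q j : {poly K} :=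
  if (j < m)%N then g * 'X^j else \sum_(i < m) h`_i *: 'X^(j - i).
have qS j : q j \is a polyOver (mem_subring hS).
  rewrite /q; case: ifP => _; first by rewrite rpredM // rpredX // polyOverX.
  by apply: rpred_sum => i _; rewrite polyOverZ ?(polyOverP hhS) // rpredX // polyOverX.
have qsz j : (j < n + m)%N -> (size (q j) <= n + m)%N.
  move=> jnm; rewrite /q; case: ltnP => jm.
    by rewrite (leq_trans (size_polyMleq _ _)) // size_polyXn addnS /= leq_add2l ltnW.
  apply: (leq_trans (size_sum _ _ _)); apply/bigmax_leqP => i _.
  rewrite (leq_trans (size_scale_leq _ _)) // size_polyXn.
  by rewrite (leq_ltn_trans (leq_subr _ _)).
have qx j : (q j).[x] = t^-1 * x ^+ j.
  rewrite /q; case: ltnP => jm.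
    by rewrite hornerM hornerXn; congr (_ * _); apply: (mulfI t0); rewrite gx mulfV.
  have <- : h.[x^-1] = t^-1 by apply: (mulfI t0); rewrite hx mulfV.
  rewrite [h.[_]]horner_coef mulr_suml horner_sum.
  apply: eq_bigr => i _; rewrite hornerZ hornerXn -mulrA; congr (_ * _).
  by rewrite exprVn mulrC expfB_cond // (negPf x0) /= (leq_trans (ltnW (ltn_ord i))).
pose A := \matrix_(l < n + m, j < n + m) (q j)`_l.
pose v : 'rV[K]_(n + m) := \row_j x ^+ j.
have vA : v *m A = t^-1 *: v.
  apply/rowP => j; rewrite !mxE -qx (horner_coef_wide _ (qsz _ (ltn_ord j))).
  by apply: eq_bigr => l _; rewrite !mxE mulrC.
have : eigenvalue A t^-1.
  apply/eigenvalueP; exists v => //; apply/eqP => /rowP /(_ (lshift m (Ordinal hn))).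
  by rewrite !mxE expr0 => /eqP; rewrite oner_eq0.
rewrite eigenvalue_root_char => rt.
(* The eigenvalue t^-1 is integral over [S], and its inverse t lies in [S]. *)
apply: (@monic_root_inv _ S hS _ _ (char_poly_monic A) _ rt); last by rewrite invrK.
apply: rpred_sum => s _; apply: rpredM; first by rewrite rpredX // rpredN rpred1.
apply: rpred_prod => i _; rewrite !mxE; apply: rpredB.
  by rewrite rpredMn // polyOverX.
by rewrite polyOverC (polyOverP (qS _)).
Qed.

End DetTrick.

Section Adjoin.
Variables (S : set K) (hS : subring S) (x : K).

Definition adjoin_set : set K :=
  [set y | exists2 g : {poly K}, g \is a polyOver (mem_subring hS) & y = g.[x]].

Lemma adjoin_subring : subring adjoin_set.
Proof.
split; first by exists 1; rewrite ?rpred1 // hornerC.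
- by move=> y z [g gS ->] [h hhS ->]; exists (g - h); rewrite ?rpredB // hornerD hornerN.
- by move=> y z [g gS ->] [h hhS ->]; exists (g * h); rewrite ?rpredM // hornerM.
Qed.

Lemma adjoin_sub : S `<=` adjoin_set.
Proof.
move=> y Sy; exists y%:P; last by rewrite hornerC.
by rewrite polyOverC; apply/mem_subringP.
Qed.

Lemma adjoin_mem : adjoin_set x.
Proof. by exists 'X; rewrite ?polyOverX // hornerX. Qed.

End Adjoin.

(** Zorn's lemma is applied to the subrings whose trace on k is exactly [O]. If neither x nor x^-1
    belonged to a maximal one, adjoining either of them would bring in an element of k outside [O];
    [det_trick] shows that two such relations are incompatible. *)
Lemma place_extension (O : set k) : valuation_ring O ->
  exists2 W : set K, valuation_ring W & forall x, O x <-> W (f x).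
Proof.
move=> hO; pose good S := subring S /\ forall x, O x <-> S (f x).
pose B := f @` O.
(* The image [B] of [O] is joined to every member so that the empty chain also has an admissible
   union. *)
have [|A [gA maxA]] := @Zorn_bigcup K (fun X => good (X `|` B)).
  move=> F FP Ftot.
  have [[X0 FX0]|noF] := EM (exists X, F X); last first.
    have -> : \bigcup_(X in F) X = set0.
      by apply/seteqP; split => // x [X FX]; case: noF; exists X.
    rewrite set0U; split; first split.
    - by exists 1; rewrite ?rmorph1 //; apply: vring1.
    - by move=> _ _ [x Ox <-] [y Oy <-]; exists (x - y); rewrite ?rmorphB //; apply: vringB.
    - by move=> _ _ [x Ox <-] [y Oy <-]; exists (x * y); rewrite ?rmorphM //; apply: vringM.
    - by move=> x; split => [Ox|[y Oy /fmorph_inj <- //]]; exists x.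
  have common x y : (\bigcup_(X in F) X `|` B) x -> (\bigcup_(X in F) X `|` B) y ->
      exists2 X, F X & (X `|` B) x /\ (X `|` B) y.
    case=> [[X FX Xx]|Bx] [[Y FY Yy]|By].
    - have [XY|YX] := Ftot _ _ FX FY.
      + by exists Y => //; split; left => //; apply: XY.
      + by exists X => //; split; left => //; apply: YX.
    - by exists X => //; split; [left | right].
    - by exists Y => //; split; [right | left].
    - by exists X0 => //; split; right.
  have up X x : F X -> (X `|` B) x -> (\bigcup_(X in F) X `|` B) x.
    by move=> FX [Xx|Bx]; [left; exists X | right].
  split; first split.
  - by apply: (up X0) => //; case: (FP _ FX0) => [[]].
  - move=> x y Ux Uy; have [X FX [Xx Xy]] := common _ _ Ux Uy.
    by apply: (up X) => //; case: (FP _ FX) => [[_ H _] _]; apply: H.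
  - move=> x y Ux Uy; have [X FX [Xx Xy]] := common _ _ Ux Uy.
    by apply: (up X) => //; case: (FP _ FX) => [[_ _ H] _]; apply: H.
  - move=> x; split => [Ox|Ux]; first by right; exists x.
    have [X FX [Xx _]] := common _ _ Ux Ux.
    by case: (FP _ FX) => _ /(_ x) [_]; apply.
set S := A `|` B in gA; case: gA => hS SO.
(* [t] is the inverse of an element of k that lies in S[x] but not in [O]. *)
have max_adj x : ~ S x -> exists2 t, ~ O t^-1 /\ t != 0 &
    exists2 g : {poly K}, g \is a polyOver (mem_subring hS) & f t * g.[x] = 1.
  move=> Sx; apply: contrapT => H; apply: (maxA (adjoin_set hS x)).
    split; first by move=> y Ay; apply: adjoin_sub; left.
    by move=> /(_ _ (adjoin_mem _ _)) Ax; apply: Sx; left.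
  have -> : adjoin_set hS x `|` B = adjoin_set hS x.
    by apply/setUidPl => y By; apply: adjoin_sub; right.
  split; first exact: adjoin_subring.
  move=> y; split => [/SO Sy|[g gS fy]]; first exact: adjoin_sub.
  apply: contrapT => Oy; apply: H.
  have y0 : y != 0 by apply/eqP => y0; apply: Oy; rewrite y0; apply: vring0.
  exists y^-1; rewrite ?invr_eq0 ?invrK //; exists g => //.
  by rewrite -fy fmorphV mulVf // fmorph_eq0.
case: (hS) => S1 SB SM; exists S => //; split => //.
move=> x; have [Sx|Sx] := EM (S x); [by left | right].
apply: contrapT => Sx'.
have [t1 [Ot1 t10] [g gS gx]] := max_adj _ Sx.
have [t2 [Ot2 t20] [h hhS hx]] := max_adj _ Sx'.
have x0 : x != 0.
  by apply/eqP => x0; apply: Sx; rewrite x0; apply/(mem_subringP hS); rewrite rpred0.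
have OS y : O y -> (f y) \in mem_subring hS by move=> /SO Sy; apply/mem_subringP.
have Om t : ~ O t^-1 -> S (f t).
  by move=> Ot; apply/SO; case: hO => _ _ _ /(_ t) [].
(* [det_trick] asks for the same t in both relations: whichever of t1 / t2 and t2 / t1 is in [O] is
   absorbed into the coefficients of one polynomial. *)
case: (hO) => _ _ _ /(_ (t1 / t2)); rewrite invf_div => -[O12|O21].
- apply: (Ot2); apply/SO; rewrite fmorphV.
  apply: (@det_trick S hS x (f t2) ((f (t1 / t2))%:P * g) h) => //.
  + by rewrite rpredM // polyOverC OS.
  + exact: Om.
  + by rewrite hornerM hornerC mulrA -rmorphM mulrCA mulfV // mulr1.
- apply: (Ot1); apply/SO; rewrite fmorphV.
  apply: (@det_trick S hS x (f t1) g ((f (t2 / t1))%:P * h)) => //.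
  + by rewrite rpredM // polyOverC OS.
  + exact: Om.
  + by rewrite hornerM hornerC mulrA -rmorphM mulrCA mulfV // mulr1.
Qed.

End Extension.

(** * Frobenius endomorphisms *)

Section UnramifiedFrobenius.
Variables (E : fieldType) (p e M : nat) (w R : set E) (t : E).
Variable sigma : {rmorphism E -> E}.
Hypotheses (charE : p \in [pchar E]) (e_gt0 : (0 < e)%N) (M_gt0 : (0 < M)%N).
Let N := (p ^ e)%N.
Hypotheses (hw : valuation_ring w) (t_neq0 : t != 0) (t_w : ~ w t^-1).
Hypotheses (hR : subring R) (Rw : R `<=` w) (Rt : R t).
Hypothesis (ER : forall x, exists n, R (t ^+ n * x)).
Hypotheses (sigma_t : sigma t = t) (sigmaM : forall x, iter M sigma x = x).
Hypothesis (sigmaR : forall y, R y -> exists2 r, R r & sigma y - y ^+ N = t * r).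
Let m := max_ideal w.

Let p_pr : prime p. Proof. exact: pcharf_prime charE. Qed.
Let N_gt1 : (1 < N)%N.
Proof. by rewrite /N -(expn0 p) ltn_exp2l // prime_gt1. Qed.
Let N_gt0 : (0 < N)%N. Proof. exact: ltnW. Qed.
Let NM_gt1 : (1 < N ^ M)%N.
Proof.
case: M M_gt0 => // M' _; rewrite expnS (leq_trans N_gt1) // leq_pmulr //.
by rewrite expn_gt0 N_gt0.
Qed.
Let pnN : [pchar E].-nat N.
Proof. by rewrite (eq_pnat _ (pcharf_eq charE)) pnatX pnat_id. Qed.

Let RP x : reflect (R x) (x \in mem_subring hR). Proof. exact: mem_subringP. Qed.

Lemma uniformizer_max : m t.
Proof. by apply/(max_idealE hw); right. Qed.

Lemma sigma_stable y : R y -> R (sigma y).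
Proof.
move=> Ry; have [r Rr /eqP] := sigmaR Ry; rewrite subr_eq => /eqP ->.
by apply/RP; rewrite rpredD ?rpredX ?rpredM //; apply/RP.
Qed.

(** The N-th power is additive in characteristic p, so that of y^(N^j) + t r adds t^N r^N, still a
    multiple of t in [R]. *)
Lemma iter_sigma j y : R y ->
  R (iter j sigma y) /\ exists2 r, R r & iter j sigma y - y ^+ (N ^ j) = t * r.
Proof.
move=> Ry; elim: j => [|j [IR [r Rr /eqP rE]]] /=.
  by split=> //; exists 0; [apply/RP; rewrite rpred0 | rewrite subrr mulr0].
split; first exact: sigma_stable.
have [r1 Rr1 r1E] := sigmaR IR.
exists (r1 + t ^+ N.-1 * r ^+ N).
  by apply/RP; rewrite rpredD ?rpredM ?rpredX //; apply/RP.
move: rE; rewrite subr_eq => /eqP rE.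
rewrite mulrDr -r1E mulrA -exprS prednK // -exprMn expnSr exprM.
by rewrite rE exprDn_pchar //; ring.
Qed.

(** As the M-th iterate of sigma is the identity, y - y^(N^M) is in tR. It factors as u y with u = 1
    - y^(N^M - 1), which is outside the maximal ideal because y is inside. *)
Lemma annihilate y : R y -> m y ->
  exists u r, [/\ R u, ~ m u, R r & u * y = t * r].
Proof.
move=> Ry my; have [_ [r Rr]] := iter_sigma M Ry; rewrite sigmaM => rE.
have NM : (0 < (N ^ M).-1)%N by case: (N ^ M)%N NM_gt1 => [|[]].
exists (1 - y ^+ (N ^ M).-1), r; split=> //.
- by apply/RP; rewrite rpredB ?rpred1 ?rpredX //; apply/RP.
- move=> mu; apply: (max_ideal1 hw); rewrite -(subrK (y ^+ (N ^ M).-1) 1).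
  apply: (max_idealD hw) => //; rewrite -(prednK NM) exprS; apply: (max_idealMr hw) => //.
  by apply: (vringX hw); apply: Rw.
- by rewrite mulrBl mul1r -exprSr prednK // ltnW.
Qed.

(** This says that [w] is the localization of [R] at its trace of [m]. Write x with a power of t in
    the denominator; as long as the exponent is positive the numerator lies in [m], and [annihilate]
    lets one factor t cancel. *)
Lemma localization x : w x -> exists r s, [/\ R r, R s, ~ m s & x = r / s].
Proof.
move=> wx; have [n Rn] := ER x.
have : exists r s, [/\ R r, R s, ~ m s & x = r / (s * t ^+ n)].
  exists (t ^+ n * x), 1; split=> //; [by case: hR | exact: max_ideal1 |].
  by rewrite mul1r mulrC mulKf ?expf_neq0.
elim: n {Rn} => [|n IH] [r [s [Rr Rs ms xE]]].
  by exists r, s; split => //; rewrite xE expr0 mulr1.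
have s0 := notin_max_neq0 hw ms.
have mr : m r.
  have -> : r = t * (s * t ^+ n * x).
    by rewrite xE exprS mulrA [t * _]mulrCA mulrC divfK // !mulf_neq0 // expf_neq0.
  apply: (max_idealMr hw) => //; first exact: uniformizer_max.
  by do 2!apply: (vringM hw) => //; [apply: Rw | apply: (vringX hw); apply: Rw].
have [u [r' [Ru mu Rr' ur]]] := annihilate Rr mr.
have u0 := notin_max_neq0 hw mu.
apply: IH; exists r', (u * s); split => //.
- by apply/RP; rewrite rpredM //; apply/RP.
- by move=> /(max_ideal_prime hw (Rw Ru) (Rw Rs)) [].
- have tn0 : t ^+ n != 0 by rewrite expf_neq0.
  by rewrite xE -[r](mulKf u0) ur exprS; field; rewrite tn0 t_neq0 s0 u0.
Qed.

Lemma unramified_uniformizer y : m y -> exists2 z, w z & y = t * z.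
Proof.
move=> my; have [r [s [Rr Rs ms yE]]] := localization (max_ideal_sub my).
have s0 := notin_max_neq0 hw ms.
have mr : m r by rewrite -(divfK s0 r) -yE; apply: (max_idealMr hw) => //; apply: Rw.
have [u [r' [Ru mu Rr' ur]]] := annihilate Rr mr.
have u0 := notin_max_neq0 hw mu.
exists (r' / (u * s)).
  apply: (vringM hw) => //; first exact: Rw.
  apply: vringV; first by apply: (vringM hw) => //; apply: Rw.
  by move=> /(max_ideal_prime hw (Rw Ru) (Rw Rs)) [].
by rewrite yE mulrA -ur -mulf_div divff // mul1r.
Qed.

(** The congruence known on [R] passes to fractions r / s with s outside [m], because sigma(s),
    congruent to s^N, is outside [m] as well. *)
Lemma frobenius_congr x : w x -> m (sigma x - x ^+ N).
Proof.
move=> wx; have [r [s [Rr Rs ms xE]]] := localization wx.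
have cong y : R y -> m (sigma y - y ^+ N).
  by move=> /sigmaR [z Rz ->]; apply: (max_idealMr hw) => //; [apply: uniformizer_max | apply: Rw].
have s0 := notin_max_neq0 hw ms.
have mss : ~ m (sigma s * s ^+ N).
  move=> /(max_ideal_prime hw (Rw (sigma_stable Rs)) (vringX hw _ (Rw Rs))).
  case=> [H|/(max_idealX hw (Rw Rs)) //].
  apply/ms/(max_idealX hw (Rw Rs) (n := N)).
  by rewrite -[_ ^+ _](subKr (sigma s)); apply: (max_idealB hw) => //; apply: cong.
have -> : sigma x - x ^+ N =
    ((sigma r - r ^+ N) * s ^+ N - r ^+ N * (sigma s - s ^+ N)) / (sigma s * s ^+ N).
  have ss0 : sigma s != 0 by rewrite fmorph_eq0.
  have sN0 : s ^+ N != 0 by rewrite expf_neq0.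
  by rewrite xE fmorph_div expr_div_n; field; rewrite ss0 sN0.
apply: (max_idealMr hw) => //; last first.
  apply: vringV mss; apply: (vringM hw) => //; first by apply: Rw; apply: sigma_stable.
  by apply: (vringX hw); apply: Rw.
apply: (max_idealB hw) => //; first by apply: (max_idealMr hw);
  [apply: cong | apply: (vringX hw); apply: Rw].
by apply: (max_idealMl hw); [apply: (vringX hw); apply: Rw | apply: cong].
Qed.

(* If tau and sigma agree modulo t^i, they agree modulo t^(i+1): modulo t every
   x is an N^M-th power, on which tau - sigma is the N^M-th power of its value. *)
Lemma frobenius_unique (tau : {rmorphism E -> E}) : tau t = t ->
  (forall x, w x -> m (tau x - x ^+ N)) -> tau =1 sigma.
Proof.
move=> tau_t tau_frob.
have wF (g : E -> E) : (forall x, w x -> m (g x - x ^+ N)) -> forall x, w x -> w (g x).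
  move=> H x wx; rewrite -(subrK (x ^+ N) (g x)).
  by apply: (vringD hw) => //; [apply: max_ideal_sub; apply: H | apply: (vringX hw)].
have wtau := wF _ tau_frob; have wsig := wF _ frobenius_congr.
have res x : w x -> exists2 z, w z & x = x ^+ (N ^ M) - t * z.
  move=> wx; have H j : w (iter j sigma x) /\ m (iter j sigma x - x ^+ (N ^ j)).
    elim: j => [|j [IHw IHm]] /=; first by split => //; rewrite subrr; apply: (max_ideal0 hw).
    split; first exact: wsig.
    rewrite -(subrK (iter j sigma x ^+ N) (sigma _)) -addrA; apply: (max_idealD hw) => //.
      exact: frobenius_congr.
    by rewrite expnSr exprM; apply: max_ideal_expB => //; apply: (vringX hw).
  case: (H M); rewrite sigmaM => _ /unramified_uniformizer [z wz zE]; exists (- z).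
    exact: vringN.
  by rewrite mulrN opprK -zE addrC subrK.
have step i : (0 < i)%N -> forall x, w x -> exists2 z, w z & tau x - sigma x = t ^+ i * z.
  elim: i => // -[|i] IH _ x wx.
    apply: unramified_uniformizer.
    rewrite -(subrK (x ^+ N) (tau x)) -addrA; apply: (max_idealD hw) => //; first exact: tau_frob.
    by rewrite -opprB; apply: (max_idealN hw) => //; apply: frobenius_congr.
  have [z wz ->] := res _ wx; have {IH}IH := IH isT.
  have [a wa aE] := IH _ wz; have [b wb bE] := IH _ wx.
  exists ((t ^+ i.+1) ^+ (N ^ M).-2 * t ^+ i * b ^+ (N ^ M) - a).
    have wt : w t by apply: Rw.
    by apply: (vringB hw) => //; do 2?[apply: (vringM hw) => //]; do ?apply: (vringX hw).
  have pNM : [pchar E].-nat (N ^ M)%N by rewrite pnatX pnN.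
  have -> : tau (x ^+ (N ^ M) - t * z) - sigma (x ^+ (N ^ M) - t * z)
      = (tau x - sigma x) ^+ (N ^ M) - t * (tau z - sigma z).
    rewrite !rmorphB !rmorphM !rmorphXn tau_t sigma_t exprDn_pchar // exprNn_pchar //.
    by move: (tau x ^+ _) (sigma x ^+ _) => u v; ring.
  have tN : (t ^+ i.+1) ^+ (N ^ M) = (t ^+ i.+1) ^+ (N ^ M).-2 * t ^+ i.+1 * t ^+ i.+1.
    by rewrite -!exprSr; case: (N ^ M)%N NM_gt1 => [|[]].
  rewrite aE bE exprMn tN; move: (_ ^+ (N ^ M).-2) (b ^+ _) => c d.
  by rewrite !exprS; ring.
(* The inverse of a nonzero difference becomes integral after multiplication by some t^n, so the
   difference is not divisible by t^(n+1): the intersection of the t^n w is zero. *)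
have eqw x : w x -> tau x = sigma x.
  move=> wx; apply/eqP; rewrite -subr_eq0; apply/negPn/negP => d0.
  have [n Rn] := ER (tau x - sigma x)^-1.
  have [z wz zE] := step n.+1 isT _ wx.
  apply: t_w.
  have z0 : z != 0 by apply: contraNneq d0 => z0; rewrite zE z0 mulr0.
  have -> : t^-1 = z * (t ^+ n * (tau x - sigma x)^-1).
    have tn0 : t ^+ n != 0 by rewrite expf_neq0.
    by rewrite zE exprS; field; rewrite tn0 t_neq0 z0.
  by apply: (vringM hw) => //; apply: Rw.
move=> x; case: (hw) => _ _ _ /(_ x) [/eqw //|/eqw].
by rewrite !fmorphV => /invr_inj.
Qed.

End UnramifiedFrobenius.

Lemma fracP (R : idomainType) (x : {fraction R}) :
  exists a b, b != 0 /\ x = tofrac a / tofrac b.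
Proof.
elim/quotW: x => -[[a b] /= b0]; exists a, b; split => //.
unlock FracField.tofrac; rewrite -[_^-1]FracField.pi_inv -[RHS]FracField.pi_mul.
apply/eqmodP; rewrite /= FracField.equivfE /FracField.mulf /FracField.invf.
by rewrite !numden_Ratio ?(oner_neq0, mul1r, mulr1) //= mulrC.
Qed.

Lemma in_qpoly_eq0 (F : fieldType) (h f : {poly F}) :
  h \is monic -> (1 < size h)%N -> (in_qpoly h f == 0) = (h %| f).
Proof.
move=> hm hs; rewrite -val_eqE /= /mk_monic hm hs /= /dvdp.
by rewrite -Pdiv.IdomainMonic.modpE.
Qed.

(** * Polynomials over the prime field and their residue fields *)

Section FpPolynomials.
Variables (p : nat) (p_pr : prime p).
Local Notation A := {poly 'F_p}.

Lemma exp_prime_gt1 j : (1 < p ^ j.+1)%N.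
Proof. by rewrite expnS (leq_trans (prime_gt1 p_pr)) // leq_pmulr // expn_gt0 prime_gt0. Qed.

Lemma Fp_expp (c : 'F_p) : c ^+ p = c.
Proof. by have := expf_card c; rewrite card_Fp. Qed.

Lemma Fp_exppn (c : 'F_p) n : c ^+ (p ^ n) = c.
Proof. by elim: n => [|n IH]; rewrite ?expr1 // expnSr exprM IH Fp_expp. Qed.

Lemma pchar_polyFp : p \in [pchar A].
Proof. by rewrite pchar_poly pchar_Fp. Qed.

Lemma pnat_pchar (R : nzRingType) n : p \in [pchar R] -> [pchar R].-nat (p ^ n)%N.
Proof.
move=> pR; rewrite (eq_pnat _ (pcharf_eq pR)) pnatX.
by rewrite pnat_id ?(pcharf_prime pR).
Qed.

Lemma exprDpn (R : comNzRingType) (x y : R) n : p \in [pchar R] ->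
  (x + y) ^+ (p ^ n) = x ^+ (p ^ n) + y ^+ (p ^ n).
Proof. by move=> pR; rewrite exprDn_pchar ?pnat_pchar. Qed.

Lemma exprBpn (R : comNzRingType) (x y : R) n : p \in [pchar R] ->
  (x - y) ^+ (p ^ n) = x ^+ (p ^ n) - y ^+ (p ^ n).
Proof. by move=> pR; rewrite exprDpn // exprNn_pchar ?pnat_pchar. Qed.

Lemma sum_expp (R : comNzRingType) (I : Type) (r : seq I) (P : pred I) (F : I -> R) n :
  p \in [pchar R] ->
  (\sum_(i <- r | P i) F i) ^+ (p ^ n) = \sum_(i <- r | P i) F i ^+ (p ^ n).
Proof.
move=> pR; apply: (big_morph (fun x : R => x ^+ (p ^ n))).
  by move=> x y; rewrite exprDpn.
by rewrite expr0n expn_eq0 -leqn0 leqNgt prime_gt0.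
Qed.

Lemma poly_exppn (f : A) n : f ^+ (p ^ n) = f \Po 'X^(p ^ n).
Proof.
rewrite -{1}[f]coefK poly_def sum_expp ?pchar_polyFp // comp_polyE.
apply: eq_bigr => i _; rewrite exprZn Fp_exppn; congr (_ *: _).
by rewrite -!exprM mulnC.
Qed.

Lemma card_polyn n : #|{poly_n 'F_p}| = (p ^ n)%N.
Proof. by rewrite card_npoly card_Fp. Qed.

Lemma exists_monic_irreducible_factor (f : A) : (1 < size f)%N ->
  exists Q : A, [/\ irreducible_poly Q, Q \is monic & Q %| f].
Proof.
move: {2}(size f) (leqnn (size f)) => n; elim: n f => [|n IH] f; first by case: (size f).
move=> fn f1; have [firr|fred] := EM (irreducible_poly f).
  have lc0 : lead_coef f != 0 by rewrite lead_coef_eq0 -size_poly_gt0 ltnW.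
  have feq : (lead_coef f)^-1 *: f %= f by rewrite eqp_scale ?invr_eq0.
  exists ((lead_coef f)^-1 *: f); split; last by rewrite (eqp_dvdl _ feq).
    case: firr => s1 H; split; first by rewrite (eqp_size feq).
    by move=> q q1; rewrite (eqp_dvdr _ feq) => /(H _ q1)/eqp_trans; apply; rewrite eqp_sym.
  by rewrite monicE lead_coefZ mulVf.
have [q [q1 qf nqf]] : exists q : A, [/\ size q != 1%N, q %| f & ~~ (q %= f)].
  apply: contrapT => H; apply: fred; split => // q q1 qf.
  by apply: contrapT => nqf; apply: H; exists q; split => //; apply/negP.
have f0 : f != 0 by rewrite -size_poly_gt0 ltnW.
have q0 : q != 0 by apply: contraNneq f0 => q0; move: qf; rewrite q0 dvd0p.
have sq : (size q < size f)%N.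
  by rewrite ltn_neqAle dvdp_leq // andbT; apply: contra nqf; rewrite -dvdp_size_eqp.
have [|//|Q [Qi Qm Qq]] := IH q; first by rewrite -ltnS (leq_trans sq).
  by case: (size q) (size_poly_gt0 q) q1 q0 => [|[|//]] // <-.
by exists Q; split => //; apply: dvdp_trans qf.
Qed.

Section Irreducible.
Variable (Q : A).
Hypotheses (Qi : irreducible_poly Q) (Qm : Q \is monic).
Let s1 : (1 < size Q)%N. Proof. by case: Qi. Qed.
Let hQ : monic_irreducible_poly Q. Proof. by split. Qed.

Lemma card_residue : #|{poly %/ Q with hQ}| = (p ^ (size Q).-1)%N.
Proof. by rewrite card_qfpoly card_Fp. Qed.

Lemma irr_dvdM f g : (Q %| f * g) = (Q %| f) || (Q %| g).
Proof.
apply/idP/orP => [|[]]; [|exact: dvdp_mulr|exact: dvdp_mull].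
have [|nQf] := boolP (Q %| f); first by left.
by rewrite Gauss_dvdpr ?irreducible_poly_coprime //; right.
Qed.

Lemma irr_ndvd1 : ~~ (Q %| 1).
Proof.
rewrite dvdp1; by case: (size Q) s1 => [|[]].
Qed.

Lemma poly_fermat f : Q %| f ^+ (p ^ (size Q).-1) - f.
Proof.
rewrite -in_qpoly_eq0 // rmorphB rmorphXn subr_eq0 /= -card_residue.
by apply/eqP; apply: (@expf_card {poly %/ Q with hQ}).
Qed.

(** Since f^(p^j) = f(X^(p^j)), divisibility would make all p^(deg Q) elements of the residue field
    roots of a polynomial of degree p^j. *)
Lemma ndvd_Xq_sub_X j : (0 < j < (size Q).-1)%N -> ~~ (Q %| 'X^(p ^ j) - 'X).
Proof.
move=> /andP[j0 jd]; apply/negP => QX.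
pose FF := {poly %/ Q with hQ}.
have all_root (y : FF) : y ^+ (p ^ j) = y.
  have [f ->] : exists f, y = in_qpoly Q f.
    exists (val y); apply/val_inj/esym/in_qpoly_small.
    exact: size_mk_monic.
  apply/eqP; rewrite -subr_eq0 -[_ ^+ _](rmorphXn (in_qpoly Q)) -[_ - _](rmorphB (in_qpoly Q)).
  rewrite in_qpoly_eq0 // poly_exppn -{2}[f]comp_polyXr.
  apply: dvdp_trans QX _; rewrite !comp_polyE -sumrB.
  apply: (big_ind (fun x => _ %| x)); [exact: dvdp0 | exact: dvdp_add |].
  by move=> i _; rewrite -scalerBr -mul_polyC dvdp_mull // subrXX dvdp_mulr.
pose g : {poly FF} := 'X^(p ^ j) - 'X.
have pj : (1 < p ^ j)%N by rewrite -(expn0 p) ltn_exp2l ?prime_gt1.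
have sg : size g = (p ^ j).+1 by rewrite size_polyDl ?size_polyXn // size_polyN size_polyX ltnS.
have g0 : g != 0 by rewrite -size_poly_gt0 sg.
have := max_poly_roots g0 (_ : all (root g) (enum FF)) (enum_uniq _).
rewrite -cardE card_residue sg ltnS => H.
have : (p ^ (size Q).-1 <= p ^ j)%N.
  by apply: H; apply/allP => y _; rewrite rootE !hornerE all_root subrr.
by rewrite leq_exp2l ?prime_gt1 // leqNgt jd.
Qed.

End Irreducible.
End FpPolynomials.

(** * Places of the rational function field *)

Section FractionPlaces.
Variables (p : nat) (p_pr : prime p).
Local Notation A := {poly 'F_p}.
Variables (k : fieldType) (tf : {rmorphism A -> k}).
Hypothesis tf_inj : injective tf.
Hypothesis tf_frac : forall x, exists a b, b != 0 /\ x = tf a / tf b.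
Implicit Types (a b c d : A).

Definition vfin (Q : A) : set k :=
  [set x | exists a b : A, ~~ (Q %| b) /\ x = tf a / tf b].
Definition vinf : set k :=
  [set x | exists a b : A, [/\ b != 0, (size a <= size b)%N & x = tf a / tf b]].

Local Notation t := (tf 'X)^-1.

Lemma pchar_frac : p \in [pchar k].
Proof. exact: (rmorph_pchar tf (pchar_polyFp p_pr)). Qed.

Lemma tf_eq a b : (tf a == tf b) = (a == b).
Proof. exact: inj_eq. Qed.

Lemma tf_eq0 a : (tf a == 0) = (a == 0).
Proof. by rewrite -(rmorph0 tf) tf_eq. Qed.

Lemma frac_eq a b c d : b != 0 -> d != 0 ->
  (tf a / tf b == tf c / tf d) = (a * d == c * b).
Proof. by move=> b0 d0; rewrite eqr_div ?tf_eq0 // -!rmorphM tf_eq. Qed.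

Lemma frac_eqP a b c d : b != 0 -> d != 0 ->
  tf a / tf b = tf c / tf d -> a * d = c * b.
Proof. by move=> b0 d0 /eqP; rewrite (frac_eq _ _ b0 d0) => /eqP. Qed.

Lemma frac_sub a b c d : b != 0 -> d != 0 ->
  tf a / tf b - tf c / tf d = tf (a * d - c * b) / tf (b * d).
Proof.
by move=> b0 d0; rewrite -mulNr addf_div ?tf_eq0 // rmorphB !rmorphM mulNr.
Qed.

Lemma frac_mul a b c d : tf a / tf b * (tf c / tf d) = tf (a * c) / tf (b * d).
Proof. by rewrite !rmorphM mulf_div. Qed.

Lemma frac_coprimeP (x : k) :
  exists a b, [/\ b != 0, coprimep a b & x = tf a / tf b].
Proof.
have [a [b [b0 ->]]] := tf_frac x; set g := gcdp a b.
have g0 : g != 0 by rewrite gcdp_eq0 negb_and b0 orbT.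
have bg0 : b %/ g != 0 by rewrite dvdp_div_eq0 // dvdp_gcdr.
exists (a %/ g), (b %/ g); split => //; first by apply: coprimep_div_gcd; rewrite b0 orbT.
apply/eqP; rewrite (frac_eq _ _ b0 bg0).
by rewrite divp_mulA ?dvdp_gcdr // divp_mulAC ?dvdp_gcdl.
Qed.

Section Finite.
Variable (Q : A).
Hypotheses (Qi : irreducible_poly Q).

Lemma ndvd_neq0 b : ~~ (Q %| b) -> b != 0.
Proof. by apply: contraNneq => ->; rewrite dvdp0. Qed.

Lemma Q_neq0 : Q != 0.
Proof. by case: Qi => s _; rewrite -size_poly_gt0 ltnW. Qed.

Lemma vfin_poly a : vfin Q (tf a).
Proof. by exists a, 1; rewrite irr_ndvd1 // rmorph1 divr1. Qed.

Lemma vfin_inv b : ~~ (Q %| b) -> vfin Q (tf b)^-1.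
Proof. by move=> Qb; exists 1, b; rewrite rmorph1 mul1r. Qed.

Lemma vfin_valuation : valuation_ring (vfin Q).
Proof.
split; first by rewrite -(rmorph1 tf); apply: vfin_poly.
- move=> _ _ [a [b [Qb ->]]] [c [d [Qd ->]]]; exists (a * d - c * b), (b * d).
  by rewrite (irr_dvdM Qi) negb_or Qb Qd frac_sub; [split | apply: ndvd_neq0 ..].
- move=> _ _ [a [b [Qb ->]]] [c [d [Qd ->]]]; exists (a * c), (b * d).
  by rewrite (irr_dvdM Qi) negb_or Qb Qd frac_mul; split.
- move=> x; have [a [b [b0 cab ->]]] := frac_coprimeP x.
  have [Qb|Qb] := boolP (Q %| b); [right | by left; exists a, b].
  exists b, a; rewrite invf_div; split => //; apply/negP => Qa.
  have : Q %| gcdp a b by rewrite dvdp_gcd Qa.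
  by rewrite (eqp_dvdr _ (_ : _ %= 1)) ?(negPf (irr_ndvd1 _)) // -size_poly_eq1.
Qed.
Let hv := vfin_valuation.

Lemma vfin_maxP x : max_ideal (vfin Q) x <-> exists2 y, vfin Q y & x = tf Q * y.
Proof.
split=> [[[a [b [Qb xE]]]]|[y [a [b [Qb ->]]] ->]].
- case=> [->|nx]; first by exists 0; [apply: vring0 | rewrite mulr0].
  have /dvdpP[c ac] : Q %| a.
    by apply: contrapT => /negP Qa; apply: nx; exists b, a; rewrite xE invf_div.
  exists (tf c / tf b); first by exists c, b.
  by rewrite xE ac rmorphM mulrCA mulrA.
- apply/(max_idealE hv); have [a0|a0] := eqVneq a 0.
    by left; rewrite a0 rmorph0 mul0r mulr0.
  right=> -[c [d [Qd]]]; rewrite mulrA invf_div -rmorphM.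
  move/(frac_eqP (mulf_neq0 Q_neq0 a0) (ndvd_neq0 Qd)) => E.
  have : Q %| b * d by rewrite E mulrCA dvdp_mulr.
  by rewrite (irr_dvdM Qi) (negPf Qb) (negPf Qd).
Qed.

Lemma vfin_max_poly a : max_ideal (vfin Q) (tf a) <-> Q %| a.
Proof.
split=> [|/dvdpP [c ->]].
  case/vfin_maxP => _ [c [d [Qd ->]]]; rewrite mulrA -rmorphM.
  rewrite -[tf a]divr1 -(rmorph1 tf) => /(frac_eqP (oner_neq0 _) (ndvd_neq0 Qd)).
  rewrite mulr1 => E.
  have : Q %| a * d by rewrite E dvdp_mulr.
  by rewrite (irr_dvdM Qi) (negPf Qd) orbF.
apply/vfin_maxP; exists (tf c); first exact: vfin_poly.
by rewrite rmorphM mulrC.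
Qed.

Lemma vfin_ninv : ~ vfin Q (tf Q)^-1.
Proof.
have /vfin_max_poly[_ []] := dvdpp Q => // /eqP.
by rewrite tf_eq0 (negPf Q_neq0).
Qed.

Lemma vfin_place : is_place (vfin Q).
Proof. by split; [exact: hv | exists (tf Q)^-1; exact: vfin_ninv]. Qed.

Lemma vfin_fermat x : Q \is monic -> vfin Q x ->
  exists2 y, vfin Q y & x - x ^+ (p ^ (size Q).-1) = tf Q * y.
Proof.
move=> Qm [a [b [Qb ->]]]; set N := (p ^ _)%N; apply/vfin_maxP.
have b0 := ndvd_neq0 Qb.
rewrite expr_div_n -!rmorphXn (frac_sub _ _ b0 (expf_neq0 N b0)).
apply: (max_idealMr hv); last first.
  rewrite rmorphM invfM; apply: (vringM hv); first exact: vfin_inv.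
  by rewrite rmorphXn -exprVn; apply: (vringX hv); apply: vfin_inv.
apply/vfin_max_poly.
have -> : a * b ^+ N - a ^+ N * b = a * (b ^+ N - b) - (a ^+ N - a) * b.
  by rewrite mulrBr mulrBl opprB addrA subrK.
by apply: dvdp_sub; [apply: dvdp_mull | apply: dvdp_mulr]; apply: poly_fermat.
Qed.

Lemma vfin_residue x : vfin Q x -> exists2 f : A, (size f < size Q)%N &
  max_ideal (vfin Q) (x - tf f).
Proof.
move=> [a [b [Qb ->]]].
have : coprimep Q b by rewrite irreducible_poly_coprime.
case/Bezout_eq1_coprimepP => -[u w] /= E.
(* By the Bezout relation w inverts b modulo Q. *)
exists ((a * w) %% Q); first by rewrite ltn_modp Q_neq0.
have b0 := ndvd_neq0 Qb.
rewrite -[tf (_ %% _)]divr1 -(rmorph1 tf) (frac_sub _ _ b0 (oner_neq0 _)) !mulr1.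
apply: (max_idealMr hv); last exact: vfin_inv.
apply/vfin_max_poly.
have -> : a - a * w %% Q * b = (a * u + (a * w) %/ Q * b) * Q.
  apply/eqP; rewrite subr_eq; apply/eqP.
  rewrite mulrDl -mulrA -{1}[a]mulr1 -E mulrDr -addrA; congr (_ + _).
  by rewrite mulrAC -mulrDl -divp_eq mulrA.
exact: dvdp_mulIr.
Qed.

End Finite.

Section Infinite.

Lemma vinf_const (c : 'F_p) : vinf (tf c%:P).
Proof.
by exists c%:P, 1; rewrite oner_neq0 rmorph1 divr1 size_polyC size_poly1; split=> //;
  case: (c != 0).
Qed.

Lemma vinf_valuation : valuation_ring vinf.
Proof.
split; first by rewrite -(rmorph1 tf) -polyC1; apply: vinf_const.
- move=> _ _ [a [b [b0 ab ->]]] [c [d [d0 cd ->]]]; exists (a * d - c * b), (b * d).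
  rewrite (mulf_neq0 b0 d0) (frac_sub _ _ b0 d0); split; [by []| |by []].
  have s (u v w z : A) : v != 0 -> z != 0 -> (size u <= size v)%N -> (size w <= size z)%N ->
    (size (u * w)%R <= size (v * z)%R)%N.
    move=> v0 z0 uv wz; have [->|u0] := eqVneq u 0; first by rewrite mul0r size_poly0.
    have [->|w0] := eqVneq w 0; first by rewrite mulr0 size_poly0.
    by rewrite !size_mul //; rewrite -!subn1 leq_sub2r // leq_add.
  apply: (leq_trans (size_polyD _ _)); rewrite geq_max size_polyN s // mulrC s //.
- move=> _ _ [a [b [b0 ab ->]]] [c [d [d0 cd ->]]]; exists (a * c), (b * d).
  rewrite (mulf_neq0 b0 d0) frac_mul; split; [by []| |by []].
  have [->|a0] := eqVneq a 0; first by rewrite mul0r size_poly0.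
  have [->|c0] := eqVneq c 0; first by rewrite mulr0 size_poly0.
  by rewrite !size_mul //; rewrite -!subn1 leq_sub2r // leq_add.
- move=> x; have [a [b [b0 ->]]] := tf_frac x.
  have [ab|ba] := leqP (size a) (size b); [by left; exists a, b | right].
  exists b, a; rewrite invf_div; split => //; last exact: ltnW.
  by rewrite -size_poly_gt0 (leq_ltn_trans _ ba).
Qed.
Let hv := vinf_valuation.

Lemma vinf_frac a b : b != 0 -> vinf (tf a / tf b) <-> (size a <= size b)%N.
Proof.
move=> b0; split => [[c [d [d0 cd]]]|]; last by exists a, b.
move/(frac_eqP b0 d0) => E.
have [->|a0] := eqVneq a 0; first by rewrite size_poly0.
have c0 : c != 0.
  apply: contraTneq (mulf_neq0 a0 d0) => c0; by rewrite E c0 mul0r negbK.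
have : (size a + size d).-1 = (size c + size b).-1 by rewrite -!size_mul ?E.
have : (0 < size a)%N by rewrite size_poly_gt0.
have : (0 < size d)%N by rewrite size_poly_gt0.
by move: cd; move: (size a) (size b) (size c) (size d); lia.
Qed.

Lemma tf_X0 : tf 'X != 0. Proof. by rewrite tf_eq0 polyX_eq0. Qed.

Lemma vinf_max_frac a b : b != 0 -> max_ideal vinf (tf a / tf b) <-> (size a < size b)%N.
Proof.
move=> b0; rewrite (max_idealE hv) invf_div; have [->|a0] := eqVneq a 0.
  by rewrite rmorph0 mul0r size_poly0 size_poly_gt0 b0; split => // _; left.
rewrite vinf_frac // ltnNge; split => [[/eqP|/negP //]|/negP]; last by right.
by rewrite mulf_eq0 invr_eq0 !tf_eq0 (negPf a0) (negPf b0).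
Qed.

Lemma vinf_maxP x : max_ideal vinf x <-> exists2 y, vinf y & x = t * y.
Proof.
split=> [mx|[y [a [b [b0 ab ->]]] ->]].
- have [a [b [b0 xE]]] := tf_frac x; move: mx; rewrite xE => /vinf_max_frac-/(_ b0) ab.
  exists (tf ('X * a) / tf b); last by rewrite rmorphM -mulrA mulKf ?tf_X0.
  apply/vinf_frac => //; have [->|a0] := eqVneq a 0; first by rewrite mulr0 size_poly0.
  by rewrite mulrC size_mulX.
- have -> : t * (tf a / tf b) = tf a / tf ('X * b) by rewrite rmorphM invfM mulrCA.
  apply/vinf_max_frac; first by rewrite mulf_neq0 ?polyX_eq0.
  by rewrite mulrC size_mulX.
Qed.

Lemma vinf_ninv : ~ vinf t^-1.
Proof.
rewrite invrK -[tf _]divr1 -(rmorph1 tf) vinf_frac ?oner_neq0 //.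
by rewrite size_polyX size_poly1.
Qed.

Lemma vinf_place : is_place vinf.
Proof. by split; [exact: hv | exists t^-1; exact: vinf_ninv]. Qed.

Lemma vinf_residue x : vinf x -> exists c : 'F_p, max_ideal vinf (x - tf c%:P).
Proof.
(* This is the value of a / b at infinity: the coefficient of a in the degree of b, zero when deg a
   < deg b, over the leading coefficient of b. *)
move=> [a [b [b0 ab ->]]]; exists (a`_(size b).-1 / lead_coef b).
have lb0 : lead_coef b != 0 by rewrite lead_coef_eq0.
set c := _ / lead_coef b; rewrite -[tf c%:P]divr1 -(rmorph1 tf) (frac_sub _ _ b0 (oner_neq0 _))
  !mulr1.
apply/vinf_max_frac => //; rewrite -(prednK (_ : 0 < size b)%N) ?size_poly_gt0 // ltnS.
apply/leq_sizeP => j; rewrite leq_eqVlt => /orP[/eqP<-|bj].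
  by rewrite coefB coefCM -lead_coefE /c divfK ?subrr.
have bj' : (size b <= j)%N by rewrite -(prednK (_ : 0 < size b)%N) ?size_poly_gt0.
by rewrite coefB coefCM !nth_default ?mulr0 ?subr0 // (leq_trans ab).
Qed.

Lemma vinf_fermat x : vinf x -> exists2 y, vinf y & x - x ^+ p = t * y.
Proof.
move=> vx; apply/vinf_maxP; have [c mc] := vinf_residue vx.
have := exprBpn x (tf c%:P) 1 pchar_frac.
rewrite expn1 -rmorphXn -polyC_exp (Fp_expp p_pr) => E.
have -> : x - x ^+ p = (x - tf c%:P) - (x - tf c%:P) ^+ p by rewrite E opprB addrA subrK.
apply: (max_idealB hv) => //; apply: (max_ideal_expn hv) => //; exact: prime_gt0.
Qed.

End Infinite.

Section Classification.
Variables (v : set k) (hv : valuation_ring v).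

Lemma place_const (c : 'F_p) : v (tf c%:P).
Proof.
rewrite -(natr_Zp c) polyC_natr rmorph_nat.
by elim: (nat_of_ord c) => [|n IH]; [apply: (vring0 hv) | rewrite mulrS;
  apply: (vringD hv) => //; apply: (vring1 hv)].
Qed.

Lemma place_const_unit (c : 'F_p) : c != 0 -> ~ max_ideal v (tf c%:P).
Proof.
move=> c0 mc; apply: (max_ideal1 hv); rewrite -(rmorph1 tf).
have -> : 1 = c%:P * c^-1%:P :> A by rewrite -polyCM mulfV.
by rewrite rmorphM; apply: (max_idealMr hv) => //; apply: place_const.
Qed.

Lemma place_poly a : v (tf 'X) -> v (tf a).
Proof.
move=> vX; rewrite -[a]coefK poly_def rmorph_sum; apply: (vring_sum hv) => i _ /=.
rewrite -mul_polyC rmorphM rmorphXn; apply: (vringM hv); first exact: place_const.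
exact: (vringX hv).
Qed.

Lemma place_prime b : v (tf 'X) -> b != 0 -> max_ideal v (tf b) ->
  exists Q, [/\ irreducible_poly Q, Q \is monic & max_ideal v (tf Q)].
Proof.
move=> vX; move: {2}(size b) (leqnn (size b)) => n; elim: n b => [|n IH] b.
  by rewrite leqn0 size_poly_eq0 => ->.
move=> bn b0 mb; have [b1|b1] := leqP (size b) 1.
  have /size_poly1P [c c0 bE] : size b == 1%N by rewrite eqn_leq b1 size_poly_gt0.
  by move: mb; rewrite bE => /(place_const_unit c0).
have [Q [Qi Qm /dvdpP [c bE]]] := exists_monic_irreducible_factor b1.
have c0 : c != 0 by apply: contraNneq b0 => c0; rewrite bE c0 mul0r.
move: mb; rewrite bE rmorphM => /(max_ideal_prime hv (place_poly c vX) (place_poly Q vX)).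
case=> [mc|mQ]; last by exists Q.
apply: (IH c) => //; move: bn; rewrite bE (size_mul c0 (monic_neq0 Qm)).
by case: Qi => s _; move: s; move: (size c) (size Q); lia.
Qed.

(** If T is in [v], then so is A, and the denominator of an element outside [v] is in the maximal
    ideal, hence so is one of its prime factors Q: [v] dominates [vfin Q]. Otherwise T^-1 is in the
    maximal ideal and [v] dominates [vinf]. Maximality under domination concludes. *)
Lemma place_classification : (exists x, ~ v x) ->
  v = vinf \/ exists Q, [/\ irreducible_poly Q, Q \is monic & v = vfin Q].
Proof.
move=> [x nx]; have [vX|vX] := EM (v (tf 'X)); [right | left].
- have [a [b [b0 xE]]] := tf_frac x.
  have mb : max_ideal v (tf b).
    split; first exact: place_poly.
    by right=> vb; apply: nx; rewrite xE; apply: (vringM hv) => //; apply: place_poly.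
  have [Q [Qi Qm mQ]] := place_prime vX b0 mb; exists Q; split=> //.
  have sub : vfin Q `<=` v.
    move=> _ [c [d [Qd ->]]]; apply: (vringM hv); first exact: place_poly.
    apply: vringV; first exact: place_poly.
    move=> md; apply: (max_ideal1 hv).
    have : coprimep Q d by rewrite irreducible_poly_coprime.
    case/Bezout_eq1_coprimepP => -[u w] /= E.
    rewrite -(rmorph1 tf) -E rmorphD !rmorphM; apply: (max_idealD hv);
      by apply: (max_idealMl hv) => //; apply: place_poly.
  apply/seteqP; split => //; apply: valuation_ring_max => //; first exact: vfin_valuation.
  move=> y /vfin_maxP-/(_ Qi) [z vz ->]; apply: (max_idealMr hv) => //; exact: sub.
- have mt : max_ideal v t by apply/(max_idealE hv); right; rewrite invrK.
  have vt := max_ideal_sub mt.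
  (* Modulo the maximal ideal a T^-n reduces to the coefficient of T^n in a; with n = deg b this
     makes the denominator b T^-n a unit. *)
  have key a n : (size a <= n.+1)%N -> max_ideal v (tf a * t ^+ n - tf (a`_n)%:P).
    move=> an; have -> : tf a * t ^+ n = \sum_(i < n.+1) tf (a`_i)%:P * t ^+ (n - i).
      rewrite -[a in LHS](coefK a) (_ : \poly_(i < size a) a`_i = \poly_(i < n.+1) a`_i).
        rewrite poly_def rmorph_sum mulr_suml; apply: eq_bigr => i _ /=.
        rewrite -mul_polyC rmorphM rmorphXn -mulrA; congr (_ * _).
        have -> : t ^+ n = t ^+ (i + (n - i)) by rewrite subnKC // -ltnS.
        by rewrite exprD mulrA -exprMn mulfV ?tf_X0 // expr1n mul1r.
      apply/polyP => i; rewrite !coef_poly.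
      case: ltnP => ia; first by rewrite (leq_trans ia an).
      by rewrite nth_default // if_same.
    rewrite big_ord_recr /= subnn expr0 mulr1 addrK; apply: (max_ideal_sum hv) => i _.
    apply: (max_idealMl hv); first exact: place_const.
    have -> : (n - i = (n - i).-1.+1)%N by rewrite prednK // subn_gt0.
    by rewrite exprS; apply: (max_idealMr hv) => //; apply: (vringX hv).
  have sub : vinf `<=` v.
    move=> _ [a [b [b0 ab ->]]].
    have sb : size b = (size b).-1.+1 by rewrite prednK // size_poly_gt0.
    have -> : tf a / tf b = (tf a * t ^+ (size b).-1) / (tf b * t ^+ (size b).-1).
      by rewrite -mulf_div divff ?mulr1 // expf_neq0 // invr_eq0 tf_X0.
    have vn c : (size c <= size b)%N -> v (tf c * t ^+ (size b).-1).
      rewrite {1}sb => /key /max_ideal_sub H.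
      by rewrite -[_ * _](subrK (tf (c`_(size b).-1)%:P)); apply: (vringD hv) => //;
        apply: place_const.
    apply: (vringM hv); first exact: vn.
    apply: vringV; first exact: vn.
    move=> mb; have := @place_const_unit (lead_coef b).
    rewrite lead_coef_eq0 => /(_ b0); apply.
    rewrite lead_coefE -[tf _](subKr (tf b * t ^+ (size b).-1)); apply: (max_idealB hv) => //.
    by apply: key; rewrite -sb.
  apply/seteqP; split => //; apply: valuation_ring_max => //; first exact: vinf_valuation.
  by move=> y /vinf_maxP [z vz ->]; apply: (max_idealMr hv) => //; apply: sub.
Qed.

End Classification.
End FractionPlaces.

(** * Degrees of the places *)

Section PlaceDegrees.
Variables (p : nat) (p_pr : prime p).
Local Notation A := {poly 'F_p}.
Variables (k : fieldType) (tf : {rmorphism A -> k}).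
Hypothesis tf_inj : injective tf.
Hypothesis tf_frac : forall x, exists a b, b != 0 /\ x = tf a / tf b.

(** [is_place_degree] over an arbitrary field of fractions of A; with [frac_embed] for [tf] the two
    are convertible. *)
Definition residue_dim (v : set k) d :=
  exists e : 'I_d -> k, (forall i, v (e i)) /\
    forall x, v x -> exists! c : {ffun 'I_d -> 'F_p},
      max_ideal v (x - \sum_i tf (c i)%:P * e i).

(** Expanding in the second family the combinations of the first gives an injection of 'F_p^d into
    'F_p^d', and the cardinals are compared. *)
Lemma residue_dim_leq v d d' : valuation_ring v ->
  residue_dim v d -> residue_dim v d' -> (d <= d')%N.
Proof.
move=> hv [e [ve He]] [e' [ve' He']].
pose S (c : {ffun 'I_d -> 'F_p}) := \sum_i tf (c i)%:P * e i.
have vS c : v (S c).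
  by apply: (vring_sum hv) => i _; apply: (vringM hv) => //; apply: (place_const tf hv).
have ex c : exists c' : {ffun 'I_d' -> 'F_p}, max_ideal v (S c - \sum_i tf (c' i)%:P * e' i).
  by have [c' [H _]] := He' _ (vS c); exists c'.
have [f Hf] := boolp.choice ex.
have inj : injective f.
  move=> c1 c2 E; have [c [_ uc]] := He _ (vS c1).
  rewrite -(uc c1); last by rewrite -/(S c1) subrr; apply: max_ideal0.
  apply: uc; rewrite -/(S c2) -(subrK (\sum_i tf (f c1 i)%:P * e' i) (S c1)).
  rewrite -addrA; apply: (max_idealD hv); first exact: Hf.
  by rewrite -opprB; apply: (max_idealN hv); rewrite E; apply: Hf.
have := leq_card f inj; rewrite !card_ffun (card_Fp p_pr) (card_ord d) (card_ord d').
by rewrite leq_exp2l ?prime_gt1.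
Qed.

Lemma residue_dim_vfin (Q : A) : irreducible_poly Q -> residue_dim (vfin tf Q) (size Q).-1.
Proof.
move=> Qi; have hv := vfin_valuation tf_inj tf_frac Qi.
have sumE (c : {ffun 'I_(size Q).-1 -> 'F_p}) :
    \sum_i tf (c i)%:P * tf 'X^i = tf (\sum_i c i *: 'X^i).
  rewrite rmorph_sum; apply: eq_bigr => i _; by rewrite -mul_polyC rmorphM.
exists (fun i => tf 'X^i); split => [i|x vx]; first exact: (vfin_poly tf Qi).
have [f sf mf] := vfin_residue tf_inj tf_frac Qi vx.
have Q1 : (size Q).-1.+1 = size Q by case: Qi => s _; rewrite prednK // ltnW.
exists [ffun i : 'I_(size Q).-1 => f`_i]; split => [|c mc].
  rewrite sumE (_ : \sum_i _ = f) //.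
  have sf' : (size f <= (size Q).-1)%N by rewrite -ltnS Q1.
  rewrite (eq_bigr (fun i : 'I_(size Q).-1 => f`_i *: 'X^i)); last by move=> i _; rewrite ffunE.
  rewrite -(poly_def (size Q).-1 (fun i => f`_i)); apply/polyP => i; rewrite coef_poly.
  by case: ltnP => // le; rewrite nth_default // (leq_trans sf').
apply/ffunP => i; rewrite ffunE.
have /(vfin_max_poly tf_inj tf_frac Qi) : max_ideal (vfin tf Q) (tf (f - \sum_i c i *: 'X^i)).
  rewrite rmorphB -sumE -(subrK x (tf f)) -addrA; apply: (max_idealD hv) => //.
  by rewrite -opprB; apply: (max_idealN hv).
set g := _ - _ => Qg.
have sg : (size g < size Q)%N.
  rewrite (leq_ltn_trans (size_polyD _ _)) // gtn_max sf size_polyN /=.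
  rewrite (leq_ltn_trans (size_sum _ _ _)) // ltnNge -[X in (X <= _)%N]Q1 -ltnNge ltnS.
  apply/bigmax_leqP => j _.
  by rewrite (leq_trans (size_scale_leq _ _)) // size_polyXn.
have g0 : g = 0.
  by apply: contraTeq Qg => g0; apply/negP => /(dvdp_leq g0); rewrite leqNgt sg.
have : g`_i = 0 by rewrite g0 coef0.
rewrite /g coefB coef_sum (bigD1 i) //= big1 => [|j ji]; last first.
  by rewrite coefZ coefXn eq_sym val_eqE (negPf ji) mulr0.
by rewrite coefZ coefXn eqxx mulr1 addr0 => /eqP; rewrite subr_eq0 => /eqP.
Qed.

Lemma residue_dim_vinf : residue_dim (vinf tf) 1.
Proof.
have hv := vinf_valuation tf_inj tf_frac.
exists (fun=> 1); split => [_|x vx]; first exact: (vring1 hv).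
have [c mc] := vinf_residue p_pr tf_inj tf_frac vx.
exists [ffun=> c]; split; first by rewrite big_ord1 mulr1 ffunE.
move=> c' mc'; apply/ffunP => i; rewrite ffunE (ord1 i).
move: mc'; rewrite big_ord1 mulr1 => mc'.
apply/eqP; rewrite -subr_eq0; apply/negPn/negP => d0.
apply: (place_const_unit (tf := tf) hv d0).
have -> : tf (c - c' 0)%:P = (tf c%:P - x) + (x - tf (c' 0)%:P).
  by rewrite addrA subrK polyCB rmorphB.
apply: (max_idealD hv) => //.
by rewrite -opprB; apply: (max_idealN hv).
Qed.

End PlaceDegrees.

Definition frac_embed (R : idomainType) : {rmorphism R -> {fraction R}} := @tofrac R.

Lemma frac_embed_inj (R : idomainType) : injective (frac_embed R).
Proof. by move=> x y /eqP; rewrite tofrac_eq => /eqP. Qed.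

Lemma place_degreeE (p : nat) (v : set (ratfun p)) d : prime p -> valuation_ring v ->
  residue_dim (frac_embed {poly 'F_p}) v d -> place_degree v = d.
Proof.
move=> p_pr hv Hd; apply/eqP; rewrite eqn_leq /place_degree.
case: xgetP => [d' _ Hd'|/(_ d)]; last by case.
by apply/andP; split; apply: (residue_dim_leq p_pr hv); [exact: Hd'|exact: Hd|exact: Hd|exact: Hd'].
Qed.

(** * The Carlitz module and its torsion *)

Section CarlitzAction.
Variables (p : nat) (p_pr : prime p).
Local Notation A := {poly 'F_p}.
Let p0 : (p == 0)%N = false. Proof. by rewrite eqn0Ngt prime_gt0. Qed.

Section Action.
Variables (L : comNzRingType) (phi : {rmorphism A -> L}).
Implicit Types (b c : A) (l : L).

Lemma pchar_image : p \in [pchar L].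
Proof. exact: (rmorph_pchar phi (pchar_polyFp p_pr)). Qed.

Definition ctau l := phi 'X * l + l ^+ p.

(** C_b(l) in any A-algebra. Besides extensions of k, it is used below in an algebra where T acts as
    0, so that C_T is the p-power map. *)
Definition cact b l := \sum_(i < size b) phi (b`_i)%:P * iter i ctau l.

Lemma phi_const_exp (c : 'F_p) n : phi c%:P ^+ (p ^ n) = phi c%:P.
Proof. by rewrite -rmorphXn -polyC_exp Fp_exppn. Qed.

Lemma exprDp (x y : L) : (x + y) ^+ p = x ^+ p + y ^+ p.
Proof. by have := exprDpn x y 1 pchar_image; rewrite expn1. Qed.

Lemma ctauD l1 l2 : ctau (l1 + l2) = ctau l1 + ctau l2.
Proof. by rewrite /ctau mulrDr exprDp addrACA. Qed.

Lemma ctau0 : ctau 0 = 0.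
Proof. by rewrite /ctau mulr0 add0r expr0n p0. Qed.

Lemma ctauZ (c : 'F_p) l : ctau (phi c%:P * l) = phi c%:P * ctau l.
Proof.
rewrite /ctau mulrDr mulrCA exprMn; congr (_ + _ * _).
by have := phi_const_exp c 1; rewrite expn1.
Qed.

Lemma iter_ctauD n l1 l2 : iter n ctau (l1 + l2) = iter n ctau l1 + iter n ctau l2.
Proof. by elim: n => //= n ->; rewrite ctauD. Qed.

Lemma iter_ctauZ n (c : 'F_p) l : iter n ctau (phi c%:P * l) = phi c%:P * iter n ctau l.
Proof. by elim: n => //= n ->; rewrite ctauZ. Qed.

Lemma cact_wide n b l : (size b <= n)%N ->
  cact b l = \sum_(i < n) phi (b`_i)%:P * iter i ctau l.
Proof.
move=> bn; rewrite /cact (big_ord_widen n (fun i => phi (b`_i)%:P * iter i ctau l)) //.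
rewrite big_mkcond; apply: eq_bigr => i _; case: ltnP => // ib.
by rewrite nth_default // polyC0 rmorph0 mul0r.
Qed.

Lemma cactDl b c l : cact (b + c) l = cact b l + cact c l.
Proof.
pose n := maxn (size b) (size c).
rewrite (@cact_wide n (b + c)) ?size_polyD // (@cact_wide n b) ?leq_maxl //.
rewrite (@cact_wide n c) ?leq_maxr // -big_split; apply: eq_bigr => i _ /=.
by rewrite coefD polyCD rmorphD mulrDl.
Qed.

Lemma cactDr b l1 l2 : cact b (l1 + l2) = cact b l1 + cact b l2.
Proof. by rewrite -big_split; apply: eq_bigr => i _; rewrite iter_ctauD mulrDr. Qed.

Lemma cact0 b : cact b 0 = 0.
Proof. by apply: (addrI (cact b 0)); rewrite -cactDr !addr0. Qed.

Lemma cact0l l : cact 0 l = 0.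
Proof. by rewrite /cact size_poly0 big_ord0. Qed.

Lemma cactNl b l : cact (- b) l = - cact b l.
Proof. by apply: (addrI (cact b l)); rewrite -cactDl !subrr cact0l. Qed.

Lemma cactC (c : 'F_p) l : cact c%:P l = phi c%:P * l.
Proof.
by rewrite (@cact_wide 1) ?size_polyC ?big_ord1 ?coefC //; case: (c != 0).
Qed.

Lemma cact1 l : cact 1 l = l.
Proof. by rewrite -polyC1 cactC rmorph1 mul1r. Qed.

Lemma cactMX b l : cact (b * 'X) l = cact b (ctau l).
Proof.
have s : (size (b * 'X)%R <= (size b).+1)%N.
  by rewrite (leq_trans (size_polyMleq _ _)) // size_polyX addn2.
rewrite (cact_wide _ s) big_ord_recl coefMX eqxx polyC0 rmorph0 mul0r add0r.
by apply: eq_bigr => i _; rewrite coefMX /= -iterSr.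
Qed.

Lemma cactCr b (c : 'F_p) l : cact b (phi c%:P * l) = phi c%:P * cact b l.
Proof. by rewrite mulr_sumr; apply: eq_bigr => i _; rewrite iter_ctauZ mulrCA. Qed.

Lemma ctau_act b l : ctau (cact b l) = cact b (ctau l).
Proof.
rewrite /cact (big_morph ctau ctauD ctau0); apply: eq_bigr => i _.
by rewrite ctauZ -iterS iterSr.
Qed.

Lemma cactCl (c : 'F_p) b l : cact (c%:P * b) l = phi c%:P * cact b l.
Proof.
have s : (size (c%:P * b)%R <= size b)%N by rewrite mul_polyC size_scale_leq.
rewrite (cact_wide _ s) mulr_sumr; apply: eq_bigr => i _.
by rewrite coefCM polyCM rmorphM mulrA.
Qed.

Lemma cactM b c l : cact (b * c) l = cact b (cact c l).
Proof.
elim/poly_ind: b c l => [|b a IH] c l; first by rewrite mul0r !cact0l.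
rewrite mulrDl !cactDl cactMX ctau_act cactCl cactC; congr (_ + _).
by rewrite mulrAC cactMX IH.
Qed.

End Action.

(* carlitz_coef i j is the coefficient of x^(p^j) in C_{T^i}, and
   carlitz_coefs b j the one in C_b. *)
Fixpoint carlitz_coef (i j : nat) : A :=
  match i with
  | 0 => (j == 0%N)%:R
  | i'.+1 => 'X * carlitz_coef i' j + (if j is j'.+1 then carlitz_coef i' j' ^+ p else 0)
  end.

Arguments carlitz_coef : simpl never.

Definition carlitz_coefs (b : A) (j : nat) : A :=
  \sum_(i < size b) (b`_i)%:P * carlitz_coef i j.

Lemma carlitz_coefS0 i : carlitz_coef i.+1 0 = 'X * carlitz_coef i 0.
Proof. exact: addr0. Qed.

Lemma carlitz_coefSS i j :
  carlitz_coef i.+1 j.+1 = 'X * carlitz_coef i j.+1 + carlitz_coef i j ^+ p.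
Proof. by []. Qed.

Implicit Type b : A.

Lemma carlitz_coef_gt i j : (i < j)%N -> carlitz_coef i j = 0.
Proof.
elim: i j => [|i IH] [|j] // ij.
rewrite carlitz_coefSS !IH ?mulr0 ?expr0n ?p0 ?add0r //; exact: ltnW.
Qed.

Lemma carlitz_coef_diag i : carlitz_coef i i = 1.
Proof.
by elim: i => // i IH; rewrite carlitz_coefSS IH carlitz_coef_gt // mulr0 add0r expr1n.
Qed.

Lemma carlitz_coef_0 i : carlitz_coef i 0 = 'X^i.
Proof. by elim: i => // i IH; rewrite carlitz_coefS0 IH exprS. Qed.

Lemma polyFp_exprD (x y : A) : (x + y) ^+ p = x ^+ p + y ^+ p.
Proof. by have := exprDpn x y 1 (pchar_polyFp p_pr); rewrite expn1. Qed.

(* The same coefficients, computed from C_{T^(i+1)} = C_{T^i} \o C_T. *)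
Lemma carlitz_coef_rec i j : carlitz_coef i.+1 j.+1 =
  'X^(p ^ j.+1) * carlitz_coef i j.+1 + carlitz_coef i j.
Proof.
elim: i j => [|i IH] j.
  rewrite carlitz_coefSS -[carlitz_coef 0 j.+1]/(0 : A) !mulr0 !add0r.
  by case: j => [|j]; rewrite /= ?expr1n // expr0n p0.
rewrite carlitz_coefSS {1}(IH j) mulrDr mulrCA -addrA.
rewrite [in RHS]carlitz_coefSS mulrDr -addrA; congr (_ + _).
case: j => [|j].
  by rewrite expn1 !carlitz_coefS0 exprMn addrC.
rewrite {1}(IH j) polyFp_exprD exprMn -exprM -expnSr carlitz_coefSS.
by rewrite addrCA addrA [LHS]addrC -!addrA addrC -addrA.
Qed.

Lemma carlitz_coefs_wide n b j : (size b <= n)%N ->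
  carlitz_coefs b j = \sum_(i < n) (b`_i)%:P * carlitz_coef i j.
Proof.
move=> bn; rewrite /carlitz_coefs (big_ord_widen n (fun i => (b`_i)%:P * carlitz_coef i j)) //.
rewrite big_mkcond; apply: eq_bigr => i _; case: ltnP => // ib.
by rewrite nth_default // polyC0 mul0r.
Qed.

Lemma carlitz_coefs_0 b : carlitz_coefs b 0 = b.
Proof.
rewrite -[RHS]coefK poly_def; apply: eq_bigr => i _.
by rewrite carlitz_coef_0 mul_polyC.
Qed.

Lemma carlitz_coefs_lead b : b != 0 -> carlitz_coefs b (size b).-1 = (lead_coef b)%:P.
Proof.
rewrite -size_poly_gt0 lead_coefE /carlitz_coefs; case: (size b) => // n _.
rewrite big_ord_recr /= carlitz_coef_diag mulr1 big1 ?add0r // => i _.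
by rewrite carlitz_coef_gt ?mulr0.
Qed.

(** C_b commutes with C_T, and the identity compares the coefficients of x^(p^(j+1)) in the two
    composites. It determines all the coefficients from the one of x, which is b. *)
Lemma carlitz_coefs_rec b j :
  ('X^(p ^ j.+1) - 'X) * carlitz_coefs b j.+1 =
  carlitz_coefs b j ^+ p - carlitz_coefs b j.
Proof.
have E : 'X * carlitz_coefs b j.+1 + carlitz_coefs b j ^+ p =
         'X^(p ^ j.+1) * carlitz_coefs b j.+1 + carlitz_coefs b j.
  have := sum_expp p_pr (index_enum 'I_(size b)) xpredT
    (fun i => (b`_i)%:P * carlitz_coef i j) 1 (pchar_polyFp p_pr).
  rewrite expn1 => ->; rewrite /carlitz_coefs !mulr_sumr -!big_split /=.
  apply: eq_bigr => i _; rewrite exprMn -polyC_exp Fp_expp // !(mulrCA _ (b`_i)%:P) -!mulrDr.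
  by rewrite -carlitz_coefSS carlitz_coef_rec.
by rewrite mulrBl; apply/eqP; rewrite subr_eq addrAC eq_sym subr_eq addrC E.
Qed.

Section ActCoefs.
Variables (L : comNzRingType) (phi : {rmorphism A -> L}).

Lemma iter_ctau_coef n i (l : L) : (i < n)%N ->
  iter i (ctau phi) l = \sum_(j < n) phi (carlitz_coef i j) * l ^+ (p ^ j).
Proof.
elim: i n => [|i IH] [//|n] iN.
  rewrite big_ord_recl /= carlitz_coef_diag rmorph1 mul1r expr1 big1 ?addr0 // => j _.
  by rewrite carlitz_coef_gt // rmorph0 mul0r.
rewrite iterS /ctau [X in X ^+ p](IH n iN) (IH n.+1) ?(ltnW iN) // mulr_sumr.
have := sum_expp p_pr (index_enum 'I_n) xpredT
    (fun j => phi (carlitz_coef i j) * l ^+ (p ^ j)) 1 (pchar_image phi).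
rewrite expn1 => ->.
rewrite big_ord_recl [in RHS]big_ord_recl -addrA carlitz_coefS0 rmorphM mulrA; congr (_ + _).
rewrite -big_split; apply: eq_bigr => j _ /=.
by rewrite carlitz_coefSS rmorphD rmorphM mulrDl mulrA rmorphXn exprMn -exprM -expnSr.
Qed.

Lemma cact_coefs n b (l : L) : (size b <= n)%N ->
  cact phi b l = \sum_(j < n) phi (carlitz_coefs b j) * l ^+ (p ^ j).
Proof.
move=> bn; rewrite (cact_wide _ _ bn).
rewrite (eq_bigr (fun i : 'I_n => \sum_(j < n)
   phi ((b`_i)%:P * carlitz_coef i j) * l ^+ (p ^ j))) => [|i _].
  rewrite exchange_big; apply: eq_bigr => j _.
  by rewrite (carlitz_coefs_wide _ bn) rmorph_sum mulr_suml.
rewrite (iter_ctau_coef l (ltn_ord i)) mulr_sumr; apply: eq_bigr => j _.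
by rewrite rmorphM mulrA.
Qed.

End ActCoefs.

Lemma carlitzE n b : (size b <= n)%N ->
  carlitz b = \sum_(j < n) (carlitz_coefs b j)%:P * 'X^(p ^ j).
Proof.
move=> bn; rewrite -(cact_coefs (polyC : {rmorphism A -> {poly A}}) 'X bn) /cact.
apply: eq_bigr => i _; rewrite mul_polyC; congr (_ *: _).
elim: (nat_of_ord i) => //= n' ->; rewrite /carlitzT /ctau comp_polyD comp_polyZ.
by rewrite comp_polyX comp_Xn_poly mul_polyC.
Qed.

Lemma horner_carlitz (L : comNzRingType) (phi : {rmorphism A -> L}) b (l : L) :
  (map_poly phi (carlitz b)).[l] = cact phi b l.
Proof.
rewrite (carlitzE (leqnn _)) rmorph_sum horner_sum (cact_coefs _ _ (leqnn _)).
by apply: eq_bigr => j _; rewrite rmorphM /= map_polyC map_polyXn hornerM hornerC hornerXn.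
Qed.

End CarlitzAction.

(** * Divisibility and degrees of the coefficients of C_P *)

Section CarlitzDivisibility.
Variables (p : nat) (p_pr : prime p).
Local Notation A := {poly 'F_p}.
Variable (P : A).
Hypotheses (Pi : irreducible_poly P) (Pm : P \is monic).
Let d := (size P).-1.

Let d1 : (size P) = d.+1. Proof. by rewrite /d prednK // size_poly_gt0 monic_neq0. Qed.

(** In (T^(p^(j+1)) - T) c_(j+1) = c_j^p - c_j the prime P does not divide the first factor while j
    + 1 < d, so divisibility passes from c_0 = P upwards. Hence C_P(x) is x^(p^d) modulo P, the
    congruence behind Frobenius at a finite place. *)
Lemma carlitz_coefs_dvd j : (j < d)%N -> P %| carlitz_coefs P j.
Proof.
elim: j => [|j IH] jd; first by rewrite carlitz_coefs_0.
have := ndvd_Xq_sub_X p_pr Pi Pm (j := j.+1) jd.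
have : P %| ('X^(p ^ j.+1) - 'X) * carlitz_coefs P j.+1.
  have {}IH := IH (ltnW jd).
  by rewrite carlitz_coefs_rec //; apply: dvdp_sub => //; apply: dvdp_exp => //; apply: prime_gt0.
by rewrite (irr_dvdM Pi) => /orP[->|].
Qed.

Lemma size_Xq_sub_X j : size ('X^(p ^ j.+1) - 'X : A) = (p ^ j.+1).+1.
Proof.
rewrite size_polyDl ?size_polyXn // size_polyN size_polyX ltnS.
exact: exp_prime_gt1.
Qed.

(** In the recursion the degree bound is multiplied by p and then lowered by p^(j+1), and p p^j (d -
    j) - p^(j+1) = p^(j+1) (d - j - 1). *)
Lemma carlitz_coefs_size j : (j <= d)%N ->
  (size (carlitz_coefs P j) <= p ^ j * (d - j) + 1)%N.
Proof.
elim: j => [|j IH] jd; first by rewrite carlitz_coefs_0 subn0 mul1n addn1 d1.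
have {}IH := IH (ltnW jd); set c := carlitz_coefs P j in IH *.
set c' := carlitz_coefs P j.+1; have [->|c'0] := eqVneq c' 0; first by rewrite size_poly0.
have p1 := prime_gt1 p_pr.
have sc : (size (c ^+ p - c)%R <= p * (p ^ j * (d - j)) + 1)%N.
  rewrite (leq_trans (size_polyD _ _)) // geq_max size_polyN.
  rewrite (leq_trans (size_poly_exp_leq _ _)); last first.
    by rewrite addn1 ltnS mulnC leq_mul2l; apply/orP; right; move: IH; case: (size c) => //= n;
      rewrite addn1.
  rewrite (leq_trans IH) // leq_add2r leq_pmull //; exact: ltnW.
have q0 : 'X^(p ^ j.+1) - 'X != 0 :> A by rewrite -size_poly_gt0 size_Xq_sub_X.
have : (size (('X^(p ^ j.+1) - 'X) * c')%R <= p * (p ^ j * (d - j)) + 1)%N.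
  by rewrite carlitz_coefs_rec.
rewrite size_mul // size_Xq_sub_X addSn /= mulnA -expnS.
have -> : (d - j = (d - j.+1).+1)%N by rewrite -subSn.
by rewrite mulnS -addnA leq_add2l.
Qed.

(** Here the degree p (d - 1) is exact, both sides of (T^p - T) c_1 = P^p - P being products or
    differences with leading coefficient 1. It fixes the scaling exponent at infinity. *)
Lemma carlitz_coefs_1 : (0 < d)%N ->
  size (carlitz_coefs P 1) = (p * (d - 1) + 1)%N /\ carlitz_coefs P 1 \is monic.
Proof.
move=> d0; have p1 := prime_gt1 p_pr.
have qm : 'X^(p ^ 1) - 'X \is @monic 'F_p.
  by rewrite monicE lead_coefDl ?lead_coefXn // size_polyXn size_polyN size_polyX expn1.
have sPp : size (P ^+ p) = (p * d).+1.
  have := size_exp P p; rewrite -/d mulnC => <-.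
  by rewrite prednK // size_poly_gt0 expf_neq0 // monic_neq0.
have pd : (d < p * d)%N by rewrite -{1}[d]mul1n ltn_mul2r d0.
have E := carlitz_coefs_rec p_pr P 0; rewrite carlitz_coefs_0 in E.
have rm : P ^+ p - P \is monic.
  rewrite monicE lead_coefDl; first by rewrite -monicE monic_exp.
  by rewrite sPp size_polyN d1 ltnS.
have sr : size (P ^+ p - P) = (p * d).+1.
  by rewrite size_polyDl // sPp size_polyN d1 ltnS.
have cm : carlitz_coefs P 1 \is monic by rewrite -(monicMl _ qm) E.
split => //; have := congr1 (fun f : A => size f) E.
rewrite /= sr size_Mmonic // ?monic_neq0 // size_Xq_sub_X expn1 addSn /=.
move: d0; case: (d) => // e _; rewrite mulnS subn1 /= => H.
by apply: (@addnI p); rewrite addnA addn1 H.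
Qed.

End CarlitzDivisibility.

(** * The P-torsion of the Carlitz module *)

Section Torsion.
Variables (p : nat) (p_pr : prime p).
Local Notation A := {poly 'F_p}.
Variables (K : fieldType) (phi : {rmorphism A -> K}).
Hypothesis phi_inj : injective phi.
Variable (P : A).
Hypotheses (Pi : irreducible_poly P) (Pm : P \is monic).
Let d := (size P).-1.
Let d1 : (size P) = d.+1. Proof. by rewrite /d prednK // size_poly_gt0 monic_neq0. Qed.
Let d0 : (0 < d)%N. Proof. by case: Pi => s _; rewrite -ltnS -d1. Qed.
Variable rs : seq K.
Hypothesis rsP : map_poly phi (carlitz P) = \prod_(r <- rs) ('X - r%:P).

Local Notation cact := (cact phi).

Lemma phi_eq0 a : (phi a == 0) = (a == 0).
Proof. by rewrite -(rmorph0 phi) (inj_eq phi_inj). Qed.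

Lemma carlitz_lead : carlitz_coefs P d = 1.
Proof. by rewrite carlitz_coefs_lead ?monic_neq0 // (monicP Pm). Qed.

Lemma map_carlitz : map_poly phi (carlitz P) =
  \sum_(j < d.+1) (phi (carlitz_coefs P j))%:P * 'X^(p ^ j).
Proof.
rewrite (carlitzE p_pr (n := d.+1)) ?d1 // rmorph_sum; apply: eq_bigr => j _ /=.
by rewrite rmorphM /= map_polyC map_polyXn.
Qed.

Lemma size_map_carlitz : size (map_poly phi (carlitz P)) = (p ^ d).+1.
Proof.
rewrite map_carlitz big_ord_recr /= carlitz_lead rmorph1 mul1r addrC size_polyDl size_polyXn //.
rewrite ltnS (leq_trans (size_sum _ _ _)) //; apply/bigmax_leqP => j _.
rewrite mul_polyC (leq_trans (size_scale_leq _ _)) // size_polyXn.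
by rewrite ltn_exp2l ?prime_gt1.
Qed.

Lemma size_torsion : size rs = (p ^ d)%N.
Proof. by have := size_map_carlitz; rewrite rsP size_prod_XsubC => -[]. Qed.

(** Only the linear term P x of C_P survives in characteristic p. Both the separability of C_P and
    the product formula for P come from this. *)
Lemma deriv_map_carlitz : (map_poly phi (carlitz P))^`() = (phi P)%:P.
Proof.
rewrite map_carlitz big_ord_recl carlitz_coefs_0 expn0 expr1 derivD derivM derivC mul0r add0r.
rewrite derivX mulr1 raddf_sum big1 ?addr0 // => j _.
rewrite [LHS]derivM derivC mul0r add0r derivXn lift0 expnS mulrnA.
have pK : p \in [pchar {poly K}].
  by rewrite pchar_poly; apply: (rmorph_pchar phi); apply: pchar_polyFp.
by rewrite (mulrn_pchar pK) mul0rn mulr0.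
Qed.

Lemma torsion_uniq : uniq rs.
Proof.
have : separable_poly (\prod_(r <- rs) ('X - r%:P)).
  rewrite -rsP unlock deriv_map_carlitz.
  by rewrite -alg_polyC coprimepZr ?coprimep1 // phi_eq0 monic_neq0.
by rewrite separable_prod_XsubC.
Qed.

Lemma mem_torsion l : (l \in rs) = (cact P l == 0).
Proof. by rewrite -root_prod_XsubC -rsP rootE horner_carlitz. Qed.

Lemma torsion_dvd b l : l \in rs -> l != 0 -> cact b l = 0 -> P %| b.
Proof.
rewrite mem_torsion => /eqP Pl l0 bl; apply: contraNT l0 => Pb.
have : coprimep P b by rewrite irreducible_poly_coprime.
case/Bezout_eq1_coprimepP => -[u w] /= E.
by rewrite -(cact1 phi l) -E cactDl !cactM // Pl bl !cact0 // addr0.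
Qed.

Lemma cact_torsion b l : l \in rs -> cact b l \in rs.
Proof.
rewrite !mem_torsion => /eqP Pl.
by rewrite -cactM // mulrC cactM // Pl cact0.
Qed.

Lemma cact_dvd b l : l \in rs -> P %| b -> cact b l = 0.
Proof. by rewrite mem_torsion => /eqP Pl /dvdpP[c ->]; rewrite cactM // Pl cact0. Qed.

(** The p^d polynomials b of degree below d give distinct points C_b(l), since P does not divide a
    nonzero difference of two of them, and there are exactly p^d torsion points. *)
Lemma torsion_cyclic l l' : l \in rs -> l != 0 -> l' \in rs ->
  exists2 b : {poly_d 'F_p}, l' = cact b l & (size b <= d)%N.
Proof.
move=> lr l0 l'r; pose f (b : {poly_d 'F_p}) := cact b l.
have finj : injective f.
  move=> b c E; apply/val_inj/eqP; rewrite -subr_eq0 /=; apply/eqP.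
  have : P %| val b - val c by apply: (torsion_dvd lr l0); rewrite cactDl cactNl -/(f b) E subrr.
  have sz : (size (val b - val c)%R <= d)%N.
    by rewrite (leq_trans (size_polyD _ _)) // geq_max size_polyN !size_npoly.
  move=> Pbc; apply: contraTeq Pbc => bc0; apply/negP => /(dvdp_leq bc0).
  by rewrite d1 leqNgt ltnS sz.
have sub : {subset [seq f b | b <- enum {poly_d 'F_p}] <= rs}.
  by move=> _ /mapP[b _ ->]; apply: cact_torsion.
have un : uniq [seq f b | b <- enum {poly_d 'F_p}] by rewrite map_inj_uniq ?enum_uniq.
have [|_ E] := uniq_min_size un sub.
  by rewrite size_map -cardE card_polyn // size_torsion.
move: l'r; rewrite -E => /mapP[b _ ->]; exists b => //; exact: size_npoly.
Qed.

Lemma exists_torsion : exists2 l, l \in rs & l != 0.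
Proof.
have p1 : (1 < p ^ d)%N by rewrite -(prednK d0) exp_prime_gt1.
apply: contrapT => H.
have sub : {subset rs <= [:: 0]}.
  move=> l lr; rewrite inE; apply: contrapT => /negP l0; by apply: H; exists l.
by have := uniq_leq_size torsion_uniq sub; rewrite size_torsion leqNgt p1.
Qed.

Lemma torsion_poly :
  map_poly phi (carlitz P) = 'X * \prod_(r <- rs | r != 0) ('X - r%:P).
Proof.
have r0 : 0 \in rs by rewrite mem_torsion cact0.
rewrite rsP (bigID (fun r => r != 0)) /= mulrC; congr (_ * _).
have -> : \prod_(r <- rs | ~~ (r != 0)) ('X - r%:P) = \prod_(r <- rs | r == 0) 'X.
  by apply: eq_big => [r|r]; rewrite negbK // => /eqP ->; rewrite subr0.
rewrite -big_filter (_ : [seq _ <- rs | _] = [:: 0]) ?big_seq1 //.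
apply: perm_small_eq => //; apply: uniq_perm => //; first by rewrite filter_uniq ?torsion_uniq.
by move=> r; rewrite mem_filter inE; case: eqP => // ->.
Qed.

(** Both sides are the linear coefficient of C_P, read off as its derivative at 0. *)
Lemma torsion_prod : phi P = \prod_(r <- rs | r != 0) - r.
Proof.
have := congr1 (fun f : {poly K} => (f^`()).[0]) torsion_poly.
rewrite /= deriv_map_carlitz hornerC derivM derivX mul1r hornerD hornerM hornerX mul0r addr0 => ->.
by rewrite horner_prod; apply: eq_bigr => r _; rewrite hornerXsubC sub0r.
Qed.

End Torsion.

Definition vunit (E : fieldType) (W : set E) (z : E) := [/\ z != 0, W z & W z^-1].

Section ValuationUnits.
Variables (E : fieldType) (W : set E) (hW : valuation_ring W).

Lemma vunit1 : vunit W 1.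
Proof. by split; rewrite ?oner_neq0 ?invr1 //; apply: (vring1 hW). Qed.

Lemma vunitM x y : vunit W x -> vunit W y -> vunit W (x * y).
Proof.
by move=> [x0 Wx Vx] [y0 Wy Vy]; split; rewrite ?mulf_neq0 ?invfM //; apply: (vringM hW).
Qed.

Lemma vunitV x : vunit W x -> vunit W x^-1.
Proof. by move=> [x0 Wx Vx]; split; rewrite ?invr_eq0 ?invrK. Qed.

Lemma vunitX x n : vunit W x -> vunit W (x ^+ n).
Proof. by move=> ux; elim: n => [|n IH]; [apply: vunit1 | rewrite exprS; apply: vunitM]. Qed.

Lemma vunit_prod (I : Type) (r : seq I) (Q : pred I) (F : I -> E) :
  (forall i, Q i -> vunit W (F i)) -> vunit W (\prod_(i <- r | Q i) F i).
Proof. by move=> H; apply: big_ind => //; [apply: vunit1 | apply: vunitM]. Qed.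

Lemma vunit_nmax x : vunit W x -> ~ max_ideal W x.
Proof. by move=> [x0 Wx Vx]; apply: unit_notin_max. Qed.

End ValuationUnits.

Lemma size_sub_monic (R : nzRingType) (f g : {poly R}) :
  f \is monic -> g \is monic -> size f = size g -> (size (f - g)%R < size f)%N.
Proof.
move=> fm gm fg; have f0 : (0 < size f)%N by rewrite size_poly_gt0 monic_neq0.
rewrite -[X in (_ < X)%N](prednK f0) ltnS; apply/leq_sizeP => j.
rewrite leq_eqVlt => /orP[/eqP<-|fj].
  by rewrite coefB -lead_coefE (monicP fm) fg -lead_coefE (monicP gm) subrr.
have fj' : (size f <= j)%N by rewrite -(prednK f0).
by rewrite coefB !nth_default ?subrr // -fg.
Qed.

(** * Torsion points at the place at infinity *)

Section InfinitePlace.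
Variables (p : nat) (p_pr : prime p).
Local Notation A := {poly 'F_p}.
Variables (k : fieldType) (tf : {rmorphism A -> k}).
Hypothesis tf_inj : injective tf.
Hypothesis tf_frac : forall x, exists a b, b != 0 /\ x = tf a / tf b.
Variables (K : fieldType) (io : {rmorphism k -> K}) (phi : {rmorphism A -> K}).
Hypothesis phiE : forall a, phi a = io (tf a).
Local Notation cact := (cact phi).
Variable (P : A).
Hypotheses (Pi : irreducible_poly P) (Pm : P \is monic).
Let d := (size P).-1.
Hypothesis d_gt1 : (1 < d)%N.
Let d1 : (size P) = d.+1. Proof. by rewrite /d prednK // size_poly_gt0 monic_neq0. Qed.
Variables (rs : seq K).
Hypothesis rsP : map_poly phi (carlitz P) = \prod_(r <- rs) ('X - r%:P).

(* The largest multiples of T^(-1/(p-1)) among the valuations at infinity of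
   the torsion points: u below is a unit for the points closest to 0. *)
Let e := ((d - 1) * (p - 1) - 1)%N.
Let geo j := (\sum_(i < j) p ^ i)%N.
Let c := carlitz_coefs P.
Let h j : k := tf (c j) / tf 'X^(e * geo j + d).
Let u (l : K) : K := phi 'X ^+ e * l ^+ p.-1.
Local Notation t := (tf 'X)^-1.
Local Notation v := (vinf tf).

Let hv : valuation_ring v. Proof. exact: vinf_valuation. Qed.
Let p1 : (1 < p)%N. Proof. exact: prime_gt1. Qed.

Let geoE j : (p ^ j = (p.-1 * geo j).+1)%N.
Proof. by rewrite -predn_exp prednK // expn_gt0 prime_gt0. Qed.

Let X0 : tf 'X != 0. Proof. exact: tf_X0. Qed.
Let phiX0 : phi 'X != 0. Proof. by rewrite phiE fmorph_eq0. Qed.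

Let phi_inj : injective phi.
Proof. by move=> a b; rewrite !phiE => /fmorph_inj /tf_inj. Qed.

Let eE : (e + d = p * (d - 1))%N.
Proof.
rewrite /e; move: d_gt1 p1; move: (d) (p) => x y; clear.
case: x => [|[|x]] // _; case: y => [|[|y]] // _.
by rewrite !subn1 /= !mulSn !mulnS; lia.
Qed.

(** The exponents in [h] are chosen so that the equation satisfied by u(l) reduces to 1 + u at
    infinity: h_0 and h_1 reduce to 1, because deg c_0 = d and deg c_1 = e + d, and the later h_j
    reduce to 0. *)
Lemma coef0_principal_unit : max_ideal v (h 0 - 1).
Proof.
rewrite /h /geo big_ord0 muln0 add0n /c carlitz_coefs_0.
have X0' : 'X^d != 0 :> A by rewrite -size_poly_gt0 size_polyXn.
rewrite -[1](divff (_ : tf 'X^d != 0)) ?(tf_eq0 tf_inj) // -mulrBl -rmorphB.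
apply/(vinf_max_frac p_pr tf_inj tf_frac) => //; rewrite size_polyXn -d1.
by apply: size_sub_monic; rewrite ?monicXn // size_polyXn.
Qed.

Lemma coef1_principal_unit : max_ideal v (h 1 - 1).
Proof.
rewrite /h /geo big_ord1 expn0 muln1 eE.
have X0' : 'X^(p * (d - 1)) != 0 :> A by rewrite -size_poly_gt0 size_polyXn.
rewrite -[1](divff (_ : tf 'X^(p * (d - 1)) != 0)) ?(tf_eq0 tf_inj) // -mulrBl -rmorphB.
have [sc cm] := carlitz_coefs_1 p_pr Pm (ltnW d_gt1).
have {}sc : size (carlitz_coefs P 1) = (p * (d - 1)).+1 by rewrite sc addn1.
apply/(vinf_max_frac p_pr tf_inj tf_frac) => //; rewrite size_polyXn -sc.
by apply: size_sub_monic; rewrite ?monicXn // size_polyXn sc.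
Qed.

Lemma coef_gt1_max j : (1 < j)%N -> (j <= d)%N -> max_ideal v (h j).
Proof.
move=> j1 jd.
have X0' : 'X^(e * geo j + d) != 0 :> A by rewrite -size_poly_gt0 size_polyXn.
apply/(vinf_max_frac p_pr tf_inj tf_frac) => //; rewrite size_polyXn.
apply: leq_ltn_trans (carlitz_coefs_size p_pr Pm jd) _; rewrite addn1 ltnS -/d.
have dE : (d = (d - j) + j)%N by rewrite subnK.
(* With q = p - 1, y = d - j and g = [geo j] the claim is (q g + 1) y < ((y + j - 1) q - 1) g + y +
   j, and j > 1 gives y q < (y + j - 1) q. *)
rewrite geoE /e {2 3}dE; move: (d - j)%N (geo j) => y g; clear dE.
have q1 : (0 < p.-1)%N by rewrite -subn1 subn_gt0.
rewrite (subn1 p); move: (p.-1) q1 => q q1.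
apply: (@leq_ltn_trans ((y * q) * g + y)); first by rewrite mulSn mulnC mulnA addnC.
rewrite -addnS; apply: leq_add; last by rewrite -[X in (X < _)%N]addn0 ltn_add2l ltnW.
rewrite leq_mul2r; apply/orP; right.
have yj : (y < y + j - 1)%N by rewrite ltn_subRL addnC ltn_add2l.
have yq : (y * q < (y + j - 1) * q)%N by rewrite ltn_mul2r q1.
by rewrite leq_subRL ?add1n // (leq_ltn_trans (leq0n _) yq).
Qed.

Lemma coef_integral j : (j <= d)%N -> v (h j).
Proof.
case: j => [|[|j]] jd; last exact: max_ideal_sub (coef_gt1_max _ jd).
  by rewrite -(subrK 1 (h 0)); apply: (vringD hv); [apply: max_ideal_sub coef0_principal_unit |
    apply: (vring1 hv)].
by rewrite -(subrK 1 (h 1)); apply: (vringD hv); [apply: max_ideal_sub coef1_principal_unit |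
  apply: (vring1 hv)].
Qed.

(** As p^j = (p - 1) geo j + 1, multiplying this sum by l T^d gives C_P(l). *)
Lemma torsion_equation l : l \in rs -> l != 0 ->
  \sum_(j < d.+1) io (h j) * u l ^+ geo j = 0.
Proof.
rewrite (mem_torsion p_pr rsP) => /eqP lP l0.
have sP : (size P <= d.+1)%N by rewrite d1.
apply: (mulfI (mulf_neq0 l0 (expf_neq0 d phiX0))); rewrite mulr0 -[RHS]lP.
rewrite (cact_coefs p_pr phi l sP) mulr_sumr; apply: eq_bigr => j _.
rewrite /h /u exprMn fmorph_div -!phiE rmorphXn -!exprM (geoE j) exprS.
rewrite exprD -/c.
have Te : phi 'X ^+ (e * geo j) != 0 by rewrite expf_neq0.
have Td : phi 'X ^+ d != 0 by rewrite expf_neq0.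
move: (phi 'X ^+ (e * geo j)) (phi 'X ^+ d) (l ^+ (p.-1 * geo j)) (phi (c j)) Te Td.
by move=> x y z w Te Td; field; rewrite Te Td.
Qed.

Section Place.
Variable W : set K.
Hypotheses (hW : valuation_ring W) (WE : forall x, v x <-> W (io x)).

Let mW x : max_ideal v x -> max_ideal W (io x).
Proof.
move=> [vx H]; split; first exact/WE.
by case: H => [->|nx]; [left; rewrite rmorph0 | right; rewrite -fmorphV => /WE].
Qed.

(** Apart from 1 + u, all terms of [torsion_equation] have coefficients divisible by T^-1. [R] is
    left arbitrary in order to be the ring generated by the local ring and u(l): there u = -1 + T^-1
    r, so that u - u^p is divisible by T^-1 and the identity behaves as a Frobenius of degree 1. *)
Lemma u_congr l (R : set K) (hR : subring R) : l \in rs -> l != 0 ->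
  (forall x, v x -> R (io x)) -> R (u l) -> exists2 r, R r & u l + 1 = io t * r.
Proof.
move=> lr l0 Rv Ru.
have RP x : reflect (R x) (x \in mem_subring hR) by apply: mem_subringP.
pose good x := exists2 r, R r & x = io t * r.
have goodD x y : good x -> good y -> good (x + y).
  move=> [r Rr ->] [r' Rr' ->]; exists (r + r'); rewrite ?mulrDr //.
  by apply/RP; rewrite rpredD //; apply/RP.
have goodM x y : max_ideal v x -> R y -> good (io x * y).
  move=> /(vinf_maxP p_pr tf_inj tf_frac)[z vz ->] Ry; exists (io z * y).
    by apply/RP; rewrite rpredM //; apply/RP => //; apply: Rv.
  by rewrite rmorphM mulrA.
have RX n : R (u l ^+ n) by apply/RP; rewrite rpredX //; apply/RP.
have := torsion_equation lr l0; rewrite big_ord_recl.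
have [d' dE] : exists d', d = d'.+1 by exists d.-1; rewrite prednK // ltnW.
move: (coef_gt1_max); rewrite dE => hjm; rewrite big_ord_recl /= /geo big_ord0 big_ord1 expn0
  expr0 expr1 mulr1.
move=> E; apply: (_ : good _).
have -> : u l + 1 = (- io (h 0 - 1) * 1 - io (h 1 - 1) * u l)
   - \sum_(i < d') io (h (lift ord0 (lift ord0 i))) * u l ^+ geo (lift ord0 (lift ord0 i)).
  move: E; set X := \sum_(i < d') _ => E; rewrite !rmorphB rmorph1.
  rewrite -[LHS]subr0 -E; clear E; move: X (io (h 0)) (io (h 1)) (u l) => X y z x; ring.
have good_neg x : good x -> good (- x).
  move=> [r Rr ->]; exists (- r); rewrite ?mulrN //.
  by apply/RP; rewrite rpredN; apply/RP.
apply: (goodD); first apply: (goodD).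
- by rewrite -rmorphN; apply: (goodM _ _ _ (RX 0%N)); apply: (max_idealN hv);
  apply: coef0_principal_unit.
- by rewrite -mulNr -rmorphN; apply: (goodM) => //; apply: (max_idealN hv);
  apply: coef1_principal_unit.
- apply: good_neg; apply: (big_ind good) => //.
    by exists 0; rewrite ?mulr0 //; apply/RP; rewrite rpred0.
  move=> i _; apply: (goodM) => //; apply: hjm; rewrite !lift0 ?ltnS //.
Qed.

Let polyX0 : 'X != 0 :> {poly K}. Proof. by rewrite polyX_eq0. Qed.
Let psi : {rmorphism 'F_p -> K} := (phi \o polyC)%FUN.

(** The factorization of X^p - X over the prime field, rescaled by r and divided by X. *)
Lemma prod_Fp_units (r : K) : r != 0 ->
  \prod_(a : 'F_p | a != 0) ('X - (phi a%:P * r)%:P) = 'X^(p.-1) - (r ^+ p.-1)%:P.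
Proof.
move=> r0.
have /(congr1 (map_poly psi)) := finField_genPoly 'F_p.
rewrite card_Fp // rmorphB /= map_polyXn map_polyX rmorph_prod /= => E.
apply: (mulfI polyX0).
have X1 : 'X * \prod_(a : 'F_p | a != 0) ('X - (phi a%:P * r)%:P) =
    \prod_(a : 'F_p) ('X - (phi a%:P * r)%:P).
  by rewrite [RHS](bigD1 0) //= polyC0 rmorph0 mul0r subr0.
rewrite X1 mulrBr -exprS prednK ?prime_gt0 //.
have rp : r%:P != 0 by rewrite polyC_eq0.
have := congr1 (fun f => r%:P ^+ p * (f \Po (r^-1%:P * 'X))) E.
rewrite /= comp_polyB comp_Xn_poly comp_polyX exprMn mulrBr mulrA -exprMn -polyCM mulfV //.
rewrite expr1n mul1r => E'.
have -> : 'X * (r ^+ p.-1)%:P = r%:P ^+ p * (r^-1%:P * 'X).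
  have -> : r%:P ^+ p = r%:P ^+ p.-1 * r%:P by rewrite -exprSr prednK // prime_gt0.
  by rewrite -mulrA [r%:P * _]mulrA -polyCM mulfV // polyC1 mul1r mulrC polyC_exp.
rewrite E' (rmorph_prod (comp_poly _)) /=.
have -> : r%:P ^+ p = \prod_(a : 'F_p) r%:P by rewrite prodr_const card_Fp.
rewrite -big_split; apply: eq_bigr => a _ /=.
rewrite map_polyXsubC comp_polyB comp_polyX comp_polyC /=.
by rewrite mulrBr mulrA -polyCM mulfV // mul1r -polyCM mulrC.
Qed.

Let G := \prod_(r <- rs | r != 0) ('X - r%:P).
(** C_P(X) / X is a polynomial in X^(p-1), and [ht] is that polynomial. *)
Let ht := \sum_(j < d.+1) phi (c j) *: 'X^(geo j).

Lemma torsion_poly_comp : ht \Po 'X^(p.-1) = G.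
Proof.
apply: (mulfI polyX0).
rewrite -(torsion_poly p_pr phi_inj Pm rsP) (map_carlitz p_pr phi Pm) -/d rmorph_sum mulr_sumr.
apply: eq_bigr => j _ /=; rewrite comp_polyZ comp_Xn_poly -exprM -scalerAr -exprS -geoE.
by rewrite mul_polyC.
Qed.

Lemma scaled_torsion (a : 'F_p) : a != 0 ->
  \prod_(r <- rs | r != 0) ('X - (phi a%:P * r)%:P) = G.
Proof.
move=> a0; pose f r := phi a%:P * r.
have pa0 : phi a%:P != 0 by rewrite (phi_eq0 phi_inj) polyC_eq0.
have perm : perm_eq [seq f r | r <- rs] rs.
  have fi : injective f by apply: mulfI.
  apply: uniq_perm; rewrite ?map_inj_uniq ?(torsion_uniq p_pr phi_inj Pm rsP) //.
  have sub : {subset [seq f r | r <- rs] <= rs}.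
    move=> _ /mapP[r rr ->]; rewrite /f -cactC; exact: (cact_torsion p_pr rsP).
  have un : uniq [seq f r | r <- rs].
    by rewrite map_inj_uniq // (torsion_uniq p_pr phi_inj Pm rsP).
  have le : (size rs <= size [seq f r | r <- rs])%N by rewrite size_map.
  by have [_ H] := uniq_min_size un sub le.
rewrite /G -[RHS](perm_big _ perm) [RHS]big_map; apply: eq_bigl => r.
by rewrite mulf_eq0 (negPf pa0).
Qed.

(** Once X is replaced by X^(p-1), both sides are the product of the X - a r over the nonzero
    constants a and the nonzero torsion points r: for each a, multiplication by a permutes the
    points. The coefficients are then compared at the multiples of p - 1. *)
Lemma torsion_power_poly :
  \prod_(r <- rs | r != 0) ('X - (r ^+ p.-1)%:P) = ht ^+ p.-1.
Proof.
have pp0 : (0 < p.-1)%N by rewrite -subn1 subn_gt0.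
set H := \prod_(r <- rs | _) _.
have E : H \Po 'X^(p.-1) = (ht ^+ p.-1) \Po 'X^(p.-1).
  rewrite rmorphXn /= torsion_poly_comp rmorph_prod /=.
  under eq_bigr => r r0 do rewrite comp_polyB comp_polyX comp_polyC -(prod_Fp_units r0).
  rewrite exchange_big /=.
  rewrite (eq_bigr (fun=> G)) => [|a a0]; last exact: scaled_torsion.
  by rewrite prodr_const; congr (_ ^+ _); rewrite cardC1 card_Fp.
apply/polyP => i; have := congr1 (fun f : {poly K} => f`_(i * p.-1)) E.
by rewrite /= !coef_comp_poly_Xn // dvdn_mull // mulnK.
Qed.

(* Otherwise all the 1/u are in the maximal ideal; comparing the value at -T^(-e)
   of the polynomial with roots l^(p-1) with the product of its roots, del would
   be a unit times h 0, whereas del = h 0 - h 1 + ... is in the maximal ideal. *)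
Lemma exists_integral_u : exists l, [/\ l \in rs, l != 0 & W (u l)].
Proof.
apply: contrapT => H.
have mz l : l \in rs -> l != 0 -> max_ideal W (u l)^-1.
  move=> lr l0; apply/(max_idealE hW); right; rewrite invrK => Wu.
  by apply: H; exists l.
(* At this y each factor y - r^(p-1) is -r^(p-1) (1 + 1/u(r)), while in the value of [ht] the terms
   from h_0 and h_1 cancel modulo the maximal ideal. *)
pose y := - (phi 'X ^+ e)^-1.
have Te : phi 'X ^+ e != 0 by rewrite expf_neq0.
have Td : phi 'X ^+ d != 0 by rewrite expf_neq0.
pose del := \sum_(j < d.+1) io (h j) * (-1) ^+ geo j.
have hy : ht.[y] = phi 'X ^+ d * del.
  rewrite /ht horner_sum mulr_sumr; apply: eq_bigr => j _.
  rewrite hornerZ hornerXn /h fmorph_div -!phiE rmorphXn /y exprD exprM.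
  rewrite [(- _^-1) ^+ _]exprNn exprVn.
  have Tg : (phi 'X ^+ e) ^+ geo j != 0 by rewrite expf_neq0.
  move: (phi 'X ^+ d) (_ ^+ geo j) (_ ^+ geo j) (phi (c j)) Td Tg => x z w q x0 w0.
  by field; rewrite x0 w0.
have mdel : max_ideal W del.
  have [d' dE] : exists d', d = d'.+1 by exists d.-1; rewrite prednK // ltnW.
  rewrite /del; move: (coef_gt1_max); rewrite dE => hjm.
  rewrite big_ord_recl big_ord_recl /= {1 2}/geo big_ord0 big_ord1 expn0 expr0 expr1 mulr1 mulrN1.
  rewrite addrA; apply: (max_idealD hW).
    have -> : io (h 0) - io (h (bump 0 0)) = io (h 0 - 1) - io (h 1 - 1).
      by rewrite !rmorphB !rmorph1 opprB addrA subrK.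
    by apply: (max_idealB hW); apply: mW; [apply: coef0_principal_unit | apply:
      coef1_principal_unit].
  apply: (max_ideal_sum hW) => j _; apply: (max_idealMr hW).
    by apply: mW; apply: hjm; rewrite /bump /= !add1n ?ltnS.
  by apply: (vringX hW); apply: (vringN hW); apply: (vring1 hW).
have uN1 : vunit W (-1).
  by split; rewrite ?oppr_eq0 ?oner_neq0 ?invrN ?invr1 //; apply: (vringN hW); apply: (vring1 hW).
have eps r : r \in rs -> r != 0 -> vunit W ((y - r ^+ p.-1) / (- r) ^+ p.-1).
  move=> rr r0; have rp0 : r ^+ p.-1 != 0 by rewrite expf_neq0.
  have -> : (y - r ^+ p.-1) / (- r) ^+ p.-1 = (-1) * (1 + (u r)^-1) / (-1) ^+ p.-1.
    rewrite -[- r]mulN1r exprMn /y /u.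
    have N0 : (-1) ^+ p.-1 != 0 :> K by rewrite expf_neq0 // oppr_eq0 oner_neq0.
    move: (r ^+ p.-1) (phi 'X ^+ e) ((-1) ^+ p.-1) rp0 Te N0 => a b q a0 b0 q0.
    by field; rewrite a0 b0 q0.
  apply: (vunitM hW); last by apply: vunitV; apply: (vunitX hW).
  apply: (vunitM hW) => //; have mzr := mz r rr r0.
  have W1z : W (1 + (u r)^-1).
    by apply: (vringD hW); [apply: (vring1 hW) | apply: max_ideal_sub].
  have nm : ~ max_ideal W (1 + (u r)^-1).
    by move=> m1; apply: (max_ideal1 hW); rewrite -(addrK (u r)^-1 1); apply: (max_idealB hW).
  split => //; last exact: vringV.
  by apply/eqP => z0; apply: nm; rewrite z0; apply: (max_ideal0 hW).
have := congr1 (fun f : {poly K} => f.[y]) torsion_power_poly.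
rewrite /= horner_exp hy horner_prod => E.
have E2 : \prod_(r <- rs | r != 0) ('X - (r ^+ p.-1)%:P).[y] =
    phi P ^+ p.-1 * \prod_(r <- rs | r != 0) ((y - r ^+ p.-1) / (- r) ^+ p.-1).
  rewrite (torsion_prod p_pr phi_inj Pm rsP) -prodrXl -big_split /=.
  apply: eq_bigr => r r0; rewrite hornerXsubC mulrC divfK //.
  by rewrite expf_neq0 // oppr_eq0.
have ue : vunit W (\prod_(r <- rs | r != 0) ((y - r ^+ p.-1) / (- r) ^+ p.-1)).
  by rewrite big_seq_cond; apply: (vunit_prod hW) => r /andP[rr r0]; apply: eps.
have PE : phi P = phi 'X ^+ d * io (h 0).
  rewrite /h /geo big_ord0 muln0 add0n /c carlitz_coefs_0 fmorph_div -!phiE rmorphXn.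
  by rewrite mulrC divfK.
apply: (vunit_nmax ue).
have h00 : io (h 0) != 0.
  rewrite fmorph_eq0; apply/eqP => h00; have := coef0_principal_unit; rewrite h00 sub0r.
  by move/(max_idealN hv); rewrite opprK; apply: max_ideal1.
have Wh : W (io (h 0))^-1.
  apply: vringV; first by apply/WE; apply: coef_integral.
  move=> mh; apply: (max_ideal1 hW); rewrite -(subKr (io (h 0)) 1).
  apply: (max_idealB hW) => //.
  have -> : io (h 0) - 1 = io (h 0 - 1) by rewrite rmorphB rmorph1.
  exact/mW/coef0_principal_unit.
have -> : \prod_(r <- rs | r != 0) ((y - r ^+ p.-1) / (- r) ^+ p.-1) =
    (del / io (h 0)) ^+ p.-1.
  apply: (mulfI (_ : phi P ^+ p.-1 != 0)).
    by rewrite expf_neq0 // (phi_eq0 phi_inj) monic_neq0.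
  rewrite -E2 E -exprMn; congr (_ ^+ _); rewrite PE -mulrA [io (h 0) * _]mulrC divfK //.
apply: (max_ideal_expn hW); first by rewrite -subn1 subn_gt0.
exact: (max_idealMr hW).
Qed.

End Place.
End InfinitePlace.

(** * The cyclotomic extension *)

Section FixedFieldFrobenius.
Variables (p e : nat) (k : fieldType) (K : splittingFieldType k).
Hypotheses (pK : p \in [pchar K]) (e_gt0 : (0 < e)%N).
Let N := (p ^ e)%N.
Hypothesis gal_abelian : forall s t : gal_of {:K}, (s * t = t * s)%g.
Variable S : {set gal_of {:K}}.
Local Notation F := (fixedField_aspace S).
Local Notation E := (subvs_of F).

Lemma gal_fixed_stable (s : gal_of {:K}) x : x \in F -> s x \in F.
Proof.
case/mem_fixedFieldP => _ xS; apply/fixedFieldP => [|h hS]; first exact: memvf.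
by rewrite -galM ?memvf // gal_abelian galM ?memvf // xS.
Qed.

Lemma gal_restrict (s : gal_of {:K}) :
  exists g : {rmorphism E -> E}, (forall x, vsval (g x) = s (vsval x)) /\
    forall x, g x = vsproj F (s (vsval x)).
Proof.
pose g (x : E) : E := vsproj F (s (vsval x)).
have gE x : vsval (g x) = s (vsval x) by rewrite vsprojK // gal_fixed_stable ?subvsP.
have gB : zmod_morphism g by move=> x y; apply: subvs_inj; rewrite gE !rmorphB; congr (_ - _);
  apply/esym/gE.
have gM : monoid_morphism g.
  split => [|x y]; apply: subvs_inj; first by rewrite gE !rmorph1.
  by rewrite gE !rmorphM; congr (_ * _); apply/esym/gE.
pose ga := GRing.isZmodMorphism.Build _ _ g gB.
pose gm := GRing.isMonoidMorphism.Build _ _ g gM.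
pose gr : {rmorphism E -> E} := HB.pack g ga gm.
by exists gr; split.
Qed.

Variables (v : set k) (hv : valuation_ring v) (t : k) (t0 : t != 0) (tv : v t) (tnv : ~ v t^-1).
Hypothesis v_fermat : forall x, v x -> exists2 y, v y & x - x ^+ N = t * y.
Variables (B : set K) (sigma : gal_of {:K}).
Local Notation R := (gen_ring ((fun x : k => x%:A) @` v `|` B)).
Hypothesis B_frob : forall b, B b -> exists2 r, R r & sigma b - b ^+ N = t%:A * r.
Hypothesis FR : forall x, x \in F -> exists n, R (t%:A ^+ n * x).
Variables (w : set E) (hw : valuation_ring w) (wv : forall x, v x <-> w x%:A).
Hypothesis wR : forall x : E, R (vsval x) -> w x.

Let hR := gen_ring_subring ((fun x : k => x%:A) @` v `|` B).
Let RP x : reflect (R x) (x \in mem_subring hR). Proof. exact: mem_subringP. Qed.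
Let Rv x : v x -> R x%:A. Proof. by move=> vx; apply: gen_base; left; exists x. Qed.

Lemma gal_base (s : gal_of {:K}) (x : k) : s x%:A = x%:A.
Proof. by rewrite linearZ /= rmorph1. Qed.

(** Checking the generators is enough: on the local ring the congruence is Fermat's in the residue
    field, and it is stable under differences and products because sigma and the N-th power are both
    ring morphisms. *)
Lemma frob_gen y : R y -> exists2 r, R r & sigma y - y ^+ N = t%:A * r.
Proof.
elim=> {y} [_ [[x vx <-]|/B_frob //]||x y Rx [r Rr xr] Ry [r' Rr' yr]|x y Rx [r Rr xr] Ry [r'
  Rr' yr]].
- have [y vy xy] := v_fermat vx; exists y%:A; first exact: Rv.
  by rewrite gal_base; have := congr1 (in_alg K) xy; rewrite rmorphB rmorphXn rmorphM.
- by exists 0; [apply/RP; rewrite rpred0 | rewrite rmorph1 expr1n subrr mulr0].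
- exists (r - r'); first exact: gen_sub.
  by rewrite rmorphB exprBpn // mulrBr -xr -yr !opprD !opprK addrACA.
- exists (r * (sigma y) + x ^+ N * r').
    apply/RP; rewrite rpredD ?rpredM ?rpredX //; try exact/RP.
    rewrite -(subrK (y ^+ N) (sigma y)) yr rpredD ?rpredM ?rpredX //; try exact/RP.
    exact/RP/Rv.
  rewrite rmorphM exprMn mulrDr mulrA -xr mulrCA -yr mulrBl mulrBr.
  by rewrite addrA subrK.
Qed.

Let pE : p \in [pchar E].
Proof. by rewrite -(fmorph_pchar (vsval : {rmorphism E -> K})). Qed.

(** The abstract criterion is applied on E to the trace of [R] on F, with the order of sigma as M.
    That sigma acts on F at all comes from the group being abelian. *)
Lemma frobenius_at : exists2 sE : {rmorphism E -> E},
  (forall x, sE x = vsproj F (sigma (vsval x))) /\ (forall x, vsval (sE x) = sigma (vsval x)) &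
  [/\ (forall y, max_ideal w y -> exists2 z, w z & y = t *: z),
      (forall x, w x -> max_ideal w (sE x - x ^+ N)) &
      forall s : gal_of {:K},
        (forall x, w x -> max_ideal w (vsproj F (s (vsval x)) - x ^+ N)) ->
        forall x, x \in F -> s x = sigma x].
Proof.
have [sE [sE1 sE2]] := gal_restrict sigma; exists sE; first by split.
pose RE : set E := [set x | R (vsval x)].
have REE x : RE x = R (vsval x) by [].
have M_gt0 : (0 < #[sigma]%g)%N by apply: order_gt0.
have tE0 : (t%:A : E) != 0 by rewrite (fmorph_eq0 (in_alg E)).
have tEw : ~ w (t%:A)^-1 by rewrite -[_^-1](fmorphV (in_alg E)) => /wv.
have hRE : subring RE.
  split => [|x y Rx Ry|x y Rx Ry]; rewrite REE.
  - by rewrite rmorph1; apply: gen_one.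
  - by rewrite rmorphB; apply: gen_sub.
  - by rewrite rmorphM; apply: gen_mul.
have vsA (x : k) : vsval (x%:A : E) = x%:A by rewrite linearZ /= algid1.
have RtE : RE t%:A by rewrite REE vsA; apply: Rv.
have ER x : exists n, RE ((t%:A) ^+ n * x).
  have [n Rn] := FR (subvsP x); exists n.
  by rewrite REE rmorphM rmorphXn -[X in X ^+ _]/(vsval (t%:A : E)) vsA.
have sEt : sE t%:A = t%:A by apply: subvs_inj; rewrite sE1 vsA gal_base.
have sEM x : iter #[sigma]%g sE x = x.
  apply: subvs_inj.
  have H n : vsval (iter n sE x) = (sigma ^+ n)%g (vsval x).
    elim: n => [|n IH]; first by rewrite gal_id.
    by rewrite iterS sE1 IH expgSr galM ?memvf.
  by rewrite H expg_order gal_id.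
have sER y : RE y -> exists2 r, RE r & sE y - y ^+ N = t%:A * r.
  move=> Ry; have [r Rr rE] := frob_gen Ry.
  have tA0 : (t%:A : K) != 0 by rewrite (fmorph_eq0 (in_alg K)).
  have DE : vsval (sE y - y ^+ N) = t%:A * r.
    by rewrite rmorphB rmorphXn -rE; congr (_ - _); apply: sE1.
  (* The remainder lies in [R] by [frob_gen], and also in F, being a quotient of elements of F. *)
  have rF : r = vsval ((t%:A)^-1 * (sE y - y ^+ N)).
    by apply: (mulfI tA0); rewrite -DE -[t%:A in RHS]vsA -rmorphM mulVKf.
  exists ((t%:A)^-1 * (sE y - y ^+ N)); first by rewrite REE -rF.
  by rewrite mulVKf.
have Rw : RE `<=` w by move=> x; apply: wR.
split.
- move=> y my.
  have [z wz ->] := unramified_uniformizer pE e_gt0 M_gt0 hw tE0 tEw hRE Rw RtE ER sEM sER my.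
  by exists z => //; rewrite mulr_algl.
- exact: (frobenius_congr pE e_gt0 M_gt0 hw tE0 tEw hRE Rw RtE ER sEM sER).
- move=> s Hs x xF; have [g [g1 g2]] := gal_restrict s.
  have gt : g t%:A = t%:A by apply: subvs_inj; rewrite g1 vsA gal_base.
  have gsE : g =1 sE.
    apply: (frobenius_unique pE e_gt0 M_gt0 hw tE0 tEw hRE Rw RtE ER sEt sEM sER gt).
    by move=> y wy; rewrite g2; apply: Hs.
  have := congr1 vsval (gsE (vsproj F x)).
  by rewrite g1 sE1 vsprojK.
Qed.

End FixedFieldFrobenius.

(** * Galois action, Frobenius and ramification in the cyclotomic function field *)

Section CyclotomicGalois.
Variables (p : nat) (p_pr : prime p).
Local Notation A := {poly 'F_p}.
Variables (k : fieldType) (tf : {rmorphism A -> k}).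
Hypothesis tf_inj : injective tf.
Hypothesis tf_frac : forall x, exists a b, b != 0 /\ x = tf a / tf b.
Variable K : splittingFieldType k.

Variable phi : {rmorphism A -> K}.
Hypothesis phiE : forall a, phi a = (tf a)%:A.
Local Notation cact := (cact phi).

Variable (P : A).
Hypotheses (Pi : irreducible_poly P) (Pm : P \is monic).
Hypothesis hK : splittingFieldFor 1%VS (map_poly phi (carlitz P)) {:K}.
Let d := (size P).-1.
Let d1 : (size P) = d.+1. Proof. by rewrite /d prednK // size_poly_gt0 monic_neq0. Qed.
Let d0 : (0 < d)%N. Proof. by case: Pi => s _; rewrite -ltnS -d1. Qed.

Lemma phi_inj : injective phi.
Proof. by move=> a b; rewrite !phiE => /(fmorph_inj (in_alg K)) /tf_inj. Qed.

Lemma map_carlitz_monic : map_poly phi (carlitz P) \is monic.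
Proof.
rewrite monicE lead_coefE (size_map_carlitz p_pr phi Pm) /= (map_carlitz p_pr phi Pm).
rewrite -/d coef_sum big_ord_recr /= big1 ?add0r => [|j _].
  by rewrite coefCM coefXn eqxx mulr1 (carlitz_lead p_pr Pm) rmorph1.
rewrite coefCM coefXn eqn_exp2l ?prime_gt1 //.
by rewrite eq_sym (ltn_eqF (ltn_ord j)) mulr0.
Qed.

Lemma cyclotomic_roots : exists rs : seq K,
  map_poly phi (carlitz P) = \prod_(r <- rs) ('X - r%:P) /\ <<1 & rs>>%VS = {:K}%VS.
Proof.
case: hK => rs E1 E2; exists rs; split=> //.
by apply/eqP; rewrite -eqp_monic ?map_carlitz_monic ?monic_prod_XsubC.
Qed.

Lemma cyclotomic_galois : galois 1 {:K}.
Proof.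
apply/splitting_galoisField; exists (map_poly phi (carlitz P)); split => //.
  by apply/polyOverP => i; rewrite coef_map /= phiE memvZ ?mem1v.
have [rs [E _]] := cyclotomic_roots; rewrite E separable_prod_XsubC.
exact: (torsion_uniq p_pr phi_inj Pm E).
Qed.

Variables (rs : seq K).
Hypothesis rsP : map_poly phi (carlitz P) = \prod_(r <- rs) ('X - r%:P).
Hypothesis rsK : <<1 & rs>>%VS = {:K}%VS.
Variable (lam : K).
Hypotheses (lam_rs : lam \in rs) (lam0 : lam != 0).

Lemma cact_in_adjoin b : cact b lam \in <<1; lam>>%VS.
Proof.
rewrite (cact_coefs p_pr _ _ (leqnn _)); apply: rpred_sum => j _.
by apply: rpredM; [rewrite phiE rpredZ // rpred1 | rewrite rpredX // memv_adjoin].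
Qed.

Lemma cyclotomic_generator x : exists q : {poly k}, x = (map_poly (in_alg K) q).[lam].
Proof.
apply/Fadjoin1_polyP; apply: (subvP _ _ (memvf x)); rewrite -rsK.
apply/Fadjoin_seqP; split; first exact: sub1v.
move=> r rrs; have [b -> _] := torsion_cyclic p_pr Pi Pm rsP lam_rs lam0 rrs.
exact: cact_in_adjoin.
Qed.

Lemma gal_cact (s : gal_of {:K}) b l : s (cact b l) = cact b (s l).
Proof.
rewrite !(cact_coefs p_pr _ _ (leqnn _)) rmorph_sum; apply: eq_bigr => j _.
by rewrite rmorphM rmorphXn /= phiE gal_base.
Qed.

Lemma gal_torsion (s : gal_of {:K}) l : l \in rs -> s l \in rs.
Proof.
rewrite !(mem_torsion p_pr rsP) => /eqP l0.
by rewrite -gal_cact l0 rmorph0.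
Qed.

Lemma gal_eq_on_generator (s t : gal_of {:K}) : s lam = t lam -> s = t.
Proof.
move=> E; apply/eqP/gal_eqP => x _; have [q ->] := cyclotomic_generator x.
rewrite !horner_coef !rmorph_sum; apply: eq_bigr => i _.
by rewrite !rmorphM !rmorphXn /= coef_map /= !gal_base E.
Qed.

Lemma gal_acts_exists (s : gal_of {:K}) :
  exists b : {poly_d 'F_p}, [/\ ~~ (P %| b), s lam = cact b lam & (size b <= d)%N].
Proof.
have [b E sb] := torsion_cyclic p_pr Pi Pm rsP lam_rs lam0 (gal_torsion s lam_rs).
exists b; split => //; apply/negP => Pb; move: lam0.
rewrite -(fmorph_eq0 s) /=. 
by rewrite E (cact_dvd p_pr rsP lam_rs Pb) eqxx.
Qed.

Lemma acts_all (s : gal_of {:K}) b l :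
  s lam = cact b lam -> l \in rs -> s l = cact b l.
Proof.
move=> E lr; have [c -> _] := torsion_cyclic p_pr Pi Pm rsP lam_rs lam0 lr.
by rewrite gal_cact E -!cactM // mulrC.
Qed.

Lemma gal_comm (s t : gal_of {:K}) : (s * t = t * s)%g.
Proof.
apply: gal_eq_on_generator; rewrite !galM ?memvf //.
have [b [_ Eb _]] := gal_acts_exists s; have [c [_ Ec _]] := gal_acts_exists t.
by rewrite Eb gal_cact Ec gal_cact Eb -!cactM // mulrC.
Qed.

Section AbovePrime.
Variable W : set K.
Hypotheses (hW : valuation_ring W) (WP : forall x : k, vfin tf P x <-> W x%:A).

Lemma above_phi b : W (phi b).
Proof. by rewrite phiE; apply/WP; apply: vfin_poly. Qed.

Lemma above_torsion l : l \in rs -> W l.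
Proof.
move=> lr; apply: (valuation_integral hW map_carlitz_monic).
  by move=> i; rewrite coef_map; apply: above_phi.
by rewrite rsP root_prod_XsubC.
Qed.

Lemma above_cact b l : l \in rs -> exists2 z, W z & cact b l = l * z.
Proof.
move=> lr; exists (\sum_(j < size b) phi (carlitz_coefs b j) * l ^+ (p ^ j).-1).
  apply: (vring_sum hW) => j _; apply: (vringM hW); first exact: above_phi.
  by apply: (vringX hW); apply: above_torsion.
rewrite (cact_coefs p_pr _ _ (leqnn _)) mulr_sumr; apply: eq_bigr => j _.
by rewrite mulrCA -exprS prednK // expn_gt0 prime_gt0.
Qed.

(** Each nonzero torsion point is C_b of any other one, and C_b(l) is l times an element integral
    above P; so the ratio and its inverse are both integral. *)
Lemma above_ratio l l' : l \in rs -> l != 0 -> l' \in rs -> l' != 0 -> vunit W (l' / l).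
Proof.
have half l1 l2 : l1 \in rs -> l1 != 0 -> l2 \in rs -> W (l2 / l1).
  move=> l1r l10 l2r; have [b E _] := torsion_cyclic p_pr Pi Pm rsP l1r l10 l2r.
  by have [z Wz Ez] := above_cact b l1r; rewrite E Ez mulrC mulKf.
move=> lr l0 l'r l'0; split; first by rewrite mulf_neq0 ?invr_eq0.
  exact: half.
by rewrite invf_div; apply: half.
Qed.

(** P is the product of the -r over the p^d - 1 nonzero torsion points, each of which is a unit
    times [lam]. *)
Lemma above_prime_power : vunit W (phi P / lam ^+ (p ^ d).-1).
Proof.
have c : count (fun r => r != 0) rs = (p ^ d).-1.
  rewrite -(size_torsion p_pr Pm rsP) -(count_predC (fun r => r != 0) rs).
  suff -> : count (predC (fun r => r != 0)) rs = 1%N by rewrite addn1.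
  rewrite (eq_count (a2 := pred1 0)); last by move=> r; apply: negbK.
  rewrite (count_uniq_mem _ (torsion_uniq p_pr phi_inj Pm rsP)).
  by rewrite (mem_torsion p_pr rsP) cact0 // eqxx.
rewrite (torsion_prod p_pr phi_inj Pm rsP).
have -> : \prod_(r <- rs | r != 0) - r =
    lam ^+ (p ^ d).-1 * \prod_(r <- rs | r != 0) - (r / lam).
  rewrite -c -[lam ^+ _]iter_mulr_1 -big_const_seq -big_split /=.
  by apply: eq_bigr => r _; rewrite mulrN mulrC divfK.
rewrite mulrAC divff ?expf_neq0 // mul1r big_seq_cond; apply: (vunit_prod hW) => r /andP[rr r0].
rewrite -mulN1r; apply: (vunitM hW); last exact: above_ratio.
by split; rewrite ?oppr_eq0 ?oner_neq0 ?invrN ?invr1 //; apply: (vringN hW); apply: (vring1 hW).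
Qed.

Lemma above_prime_max : max_ideal W (phi P).
Proof.
have /(vfin_max_poly tf_inj tf_frac Pi)[vP [P0|nP]] := dvdpp P.
  by move/eqP: P0; rewrite (tf_eq0 tf_inj) (negPf (Q_neq0 Pi)).
split; first by rewrite phiE; apply/WP.
by right; rewrite phiE -[(_%:A)^-1](fmorphV (in_alg K)) => /WP.
Qed.

Lemma above_torsion_max : max_ideal W lam.
Proof.
have [//|ml] := EM (max_ideal W lam).
have ul : vunit W lam.
  by split => //; [apply: above_torsion | apply: vringV => //; apply: above_torsion].
case: (vunit_nmax _ above_prime_max).
rewrite -[phi P](divfK (expf_neq0 (p ^ d).-1 lam0)); apply: (vunitM hW).
  exact: above_prime_power.
exact: (vunitX hW).
Qed.

Lemma gal_lam_unit (s : gal_of {:K}) : vunit W (s lam / lam).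
Proof. by apply: above_ratio => //; [apply: gal_torsion | rewrite fmorph_eq0]. Qed.

End AbovePrime.

(* The norm of lam lies in k and P is, up to a unit, the (p^d - 1)-th power of
   lam: comparing valuations above P bounds the degree from below. *)
Lemma card_gal_cyclotomic_ge : ((p ^ d).-1 <= #|{: gal_of {:K}}|)%N.
Proof.
have [W hW WP] := place_extension (in_alg K) (vfin_valuation tf_inj tf_frac Pi).
have {}WP : forall x : k, vfin tf P x <-> W x%:A := WP.
set M := (p ^ d).-1; rewrite leqNgt; apply/negP => rM; set r := #|_| in rM.
pose N := \prod_(s : gal_of {:K}) s lam.
have NG (t : gal_of {:K}) : t N = N.
  rewrite /N rmorph_prod [RHS](reindex_inj (mulIg t)) /=.
  by apply: eq_bigr => s _; rewrite galM ?memvf.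
have : N \in fixedField 'Gal({:K} / 1)%g.
  by apply/fixedFieldP => [|t _]; [rewrite memvf | apply: NG].
have /galois_fixedField -> := cyclotomic_galois.
case/vlineP => x xN.
have uN : vunit W (N / lam ^+ r).
  have -> : N / lam ^+ r = \prod_(s : gal_of {:K}) (s lam / lam).
    by rewrite prodf_div prodr_const.
  by apply: (vunit_prod hW) => s _; apply: (gal_lam_unit hW WP).
have lr0 : lam ^+ r != 0 by rewrite expf_neq0.
have r0 : (0 < r)%N by apply/card_gt0P; exists 1%g.
have mN : max_ideal W N.
  rewrite -(divfK lr0 N); apply: (max_idealMl hW); first by case: uN.
  by apply: (max_ideal_expn hW) => //; apply: (above_torsion_max hW WP).
have N0 : N != 0 by apply/prodf_neq0 => s _; rewrite fmorph_eq0.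
have x0 : x != 0 by apply: contraNneq N0 => x0; rewrite xN x0 scale0r.
have /(vfin_maxP tf_inj tf_frac Pi) [y vy xy] : max_ideal (vfin tf P) x.
  have [WN [N0'|nN]] := mN; first by move/eqP: N0'; rewrite (negPf N0).
  split; first by apply/WP; rewrite -xN.
  right => vx; apply: nN; rewrite xN; move/WP: vx.
  by rewrite -[(x%:A)^-1](fmorphV (in_alg K)).
have NE : N = phi P * y%:A by rewrite xN xy phiE [RHS]mulr_algl scalerA.
(* Up to units N^M and P^r are both lam^(r M). But N = P y with y integral, so for r < M the
   quotient would be a multiple of P^(M - r). *)
have u : vunit W ((phi P * y%:A) ^+ M / phi P ^+ r).
  rewrite -NE.
  have -> : N ^+ M / phi P ^+ r =
      (N / lam ^+ r) ^+ M / (phi P / lam ^+ M) ^+ r.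
    rewrite !expr_div_n -!exprM [(M * r)%N]mulnC invf_div.
    by rewrite mulf_div [_ * lam ^+ _]mulrC -mulf_div divff ?mul1r // expf_neq0.
  apply: (vunitM hW); first exact: (vunitX hW).
  by apply: (vunitV); apply: (vunitX hW); apply: (above_prime_power hW WP).
have P0 : phi P != 0 by rewrite (phi_eq0 phi_inj) (Q_neq0 Pi).
have := vunit_nmax u; apply.
rewrite exprMn -{1}(subnK (ltnW rM)) exprD -[_ * phi P ^+ r * _]mulrAC mulfK ?expf_neq0 //.
apply: (max_idealMr hW); last by apply: (vringX hW); apply/WP.
by apply: (max_ideal_expn hW); [rewrite subn_gt0 | apply: (above_prime_max WP)].
Qed.

Lemma card_gal_cyclotomic_le : (#|{: gal_of {:K}}| <= (p ^ d).-1)%N.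
Proof.
have [f Hf] := boolp.choice gal_acts_exists.
have finj : injective f.
  move=> s t E; apply: gal_eq_on_generator.
  by have [_ -> _] := Hf s; have [_ -> _] := Hf t; rewrite E.
rewrite -cardsT -(card_imset _ finj) -(card_polyn p_pr) -(cardsC1 (0 : {poly_d 'F_p})).
apply/subset_leq_card/fintype.subsetP => _ /imsetP[s _ ->]; rewrite !inE; have [H _ _] := Hf s.
by apply: contra H => /eqP ->; apply: dvdp0.
Qed.

Lemma cact_mod b l : l \in rs -> cact (b %% P) l = cact b l.
Proof.
by move=> lr; rewrite [in RHS](divp_eq b P) cactDl (cact_dvd p_pr rsP lr (dvdp_mulIr _ _)) add0r.
Qed.

(** An automorphism is determined by a nonzero polynomial of degree below d, and the lower bound on
    the order of the group makes this injection onto. It supplies the automorphism attached to a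
    prime Q <> P. *)
Lemma gal_acts_surj b : ~~ (P %| b) -> exists s : gal_of {:K}, s lam = cact b lam.
Proof.
move=> Pb; have [f Hf] := boolp.choice gal_acts_exists.
have finj : injective f.
  move=> s t E; apply: gal_eq_on_generator.
  by have [_ -> _] := Hf s; have [_ -> _] := Hf t; rewrite E.
pose D : {set {poly_d 'F_p}} := [set~ 0]%SET.
have sub : f @: [set: gal_of {:K}]%SET \subset D.
  apply/fintype.subsetP => _ /imsetP[s _ ->]; rewrite !inE; have [H _ _] := Hf s.
  by apply: contra H => /eqP ->; apply: dvdp0.
have E : f @: [set: gal_of {:K}]%SET = D.
  apply/eqP; rewrite eqEcard sub /= cardsC1 card_polyn // card_imset // cardsT.
  exact: card_gal_cyclotomic_ge.
have sb : (size (b %% P)%R <= d)%N by rewrite -ltnS -d1 ltn_modp monic_neq0.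
have : npolyp d (b %% P) \in D.
  rewrite !inE -val_eqE /= npolypK //; exact: Pb.
rewrite -E => /imsetP[s _ sE]; exists s; have [_ -> _] := Hf s.
by rewrite -sE /= npolypK // cact_mod.
Qed.

Variable S : {set gal_of {:K}}.
Local Notation F := (fixedField_aspace S).
Local Notation E := (subvs_of F).

Let pK : p \in [pchar K]. Proof. exact: (pchar_image p_pr phi). Qed.

(** This is the condition that inverting t in [R] gives the whole field, on elements of k(b): one
    power of t clears the finitely many coefficients of [q]. *)
Lemma adjoin_denominators (v : set k) (B : set K) (t : k) (b : K) (q : {poly k}) :
  v t -> B b -> (forall c, exists n, v (t ^+ n * c)) ->
  exists n, gen_ring ((fun x : k => x%:A) @` v `|` B) (t%:A ^+ n * (map_poly (in_alg K) q).[b]).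
Proof.
move=> vt Bb vc; set R := gen_ring _; have hR := gen_ring_subring ((fun x : k => x%:A) @` v `|` B).
have RP x : reflect (R x) (x \in mem_subring hR) by apply: mem_subringP.
have Rv x : v x -> R x%:A by move=> vx; apply: gen_base; left; exists x.
have Rt n : t%:A ^+ n \in mem_subring hR by rewrite rpredX //; apply/RP/Rv.
have Rb n : b ^+ n \in mem_subring hR by rewrite rpredX //; apply/RP; apply: gen_base; right.
rewrite horner_coef; elim: (size _) => [|m [n IH]].
  by exists 0%N; rewrite big_ord0 mulr0; apply/RP; rewrite rpred0.
have [n' vn] := vc q`_m; exists (n + n')%N.
rewrite big_ord_recr /= mulrDr; apply/RP; apply: rpredD.
  by rewrite addnC exprD -mulrA rpredM //; apply/RP.
rewrite exprD -mulrA rpredM // mulrA rpredM // coef_map /=.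
have /RP := Rv _ vn; rewrite -[(_ * _)%:A]/(in_alg K _) rmorphM rmorphXn; exact.
Qed.

Lemma vfin_denominators (Q : A) c : irreducible_poly Q -> exists n, vfin tf Q (tf Q ^+ n * c).
Proof.
move=> Qi; have [a [b [b0 ->]]] := tf_frac c.
move: {2}(size b) (leqnn (size b)) => m; elim: m b b0 => [|m IH] b b0 bm.
  by move: b0; rewrite -size_poly_gt0; case: (size b) bm.
have [/dvdpP[b' bE]|Qb] := boolP (Q %| b); last by exists 0%N; rewrite expr0 mul1r; exists a, b.
have b'0 : b' != 0 by apply: contraNneq b0 => b'0; rewrite bE b'0 mul0r.
have Q0 := Q_neq0 Qi.
have [|n vn] := IH b' b'0.
  move: bm; rewrite bE (size_mul b'0 Q0); case: Qi => s _.
  by move: s; move: (size b') (size Q) => x y; clear; lia.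
exists n.+1; rewrite exprSr -mulrA (_ : tf Q * _ = tf a / tf b') //.
by rewrite bE rmorphM invfM [LHS]mulrC -!mulrA mulVf ?mulr1 // (tf_eq0 tf_inj).
Qed.

Lemma vinf_denominators c : exists n, vinf tf ((tf 'X)^-1 ^+ n * c).
Proof.
have [a [b [b0 ->]]] := tf_frac c; exists (size a).
have -> : (tf 'X)^-1 ^+ size a * (tf a / tf b) = tf a / tf ('X^(size a) * b).
  by rewrite rmorphM rmorphXn invfM -exprVn mulrCA.
have X0 : 'X^(size a) * b != 0 by rewrite mulf_neq0 // -size_poly_gt0 size_polyXn.
apply/(vinf_frac p_pr tf_inj) => //.
have [->|a0] := eqVneq a 0; first by rewrite size_poly0.
rewrite size_mul // -?size_poly_gt0 size_polyXn // addSn /= leq_addr //.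
Qed.

Lemma in_alg_vsval (x : k) : vsval (x%:A : E) = x%:A.
Proof. by rewrite linearZ /= algid1. Qed.

Lemma extend_place (v : set k) (w : set E) : valuation_ring w -> (forall x, v x <-> w x%:A) ->
  exists W : set K, [/\ valuation_ring W, (forall x, w x <-> W (vsval x)) &
    forall x, v x <-> W x%:A].
Proof.
move=> hw wv; have [W hW WE] := place_extension (vsval : {rmorphism E -> K}) hw.
exists W; split => // x; rewrite wv -in_alg_vsval; exact: WE.
Qed.

Lemma gen_ring_sub_place (v : set k) (w : set E) (W : set K) (B : set K) :
  valuation_ring W -> (forall x, w x <-> W (vsval x)) -> (forall x, v x <-> W x%:A) ->
  B `<=` W ->
  forall x : E, gen_ring ((fun x : k => x%:A) @` v `|` B) (vsval x) -> w x.
Proof.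
move=> hW wW vW BW x Rx; apply/wW; move: Rx; apply: gen_ring_min.
  exact: valuation_subring.
by move=> y [[z vz <-]|/BW //]; apply/vW.
Qed.

(** All coefficients of C_Q but the last are divisible by Q, and the last is 1; so (C_Q(lam) -
    lam^(p^deg Q)) / Q is in the ring generated by the local ring and [lam], and sigma satisfies the
    Frobenius congruence on [lam]. *)
Lemma frobenius_at_finite (Q : A) (sigma : gal_of {:K}) (w : set E) :
  irreducible_poly Q -> Q \is monic -> sigma lam = cact Q lam ->
  valuation_ring w -> (forall x, vfin tf Q x <-> w x%:A) ->
  exists2 sE : {rmorphism E -> E},
  (forall x, sE x = vsproj F (sigma (vsval x))) /\ (forall x, vsval (sE x) = sigma (vsval x)) &
  [/\ (forall y, max_ideal w y -> exists2 z, w z & y = tf Q *: z),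
      (forall x, w x -> max_ideal w (sE x - x ^+ (p ^ (size Q).-1))) &
      forall s : gal_of {:K},
        (forall x, w x -> max_ideal w (vsproj F (s (vsval x)) - x ^+ (p ^ (size Q).-1))) ->
        forall x, x \in F -> s x = sigma x].
Proof.
move=> Qi Qm sQ hw wv; have [W [hW wW vW]] := extend_place hw wv.
have e_gt0 : (0 < (size Q).-1)%N by case: Qi; case: (size Q) => [|[]].
pose B : set K := [set lam].
have BW : B `<=` W.
  move=> _ ->; apply: (valuation_integral hW map_carlitz_monic (z := lam)).
    by move=> i; rewrite coef_map /= phiE; apply/vW; apply: vfin_poly.
  by rewrite rsP root_prod_XsubC.
apply: (@frobenius_at p _ k K pK e_gt0 gal_comm S (vfin tf Q) (tf Q) _ _ _ _ B).
- by rewrite (tf_eq0 tf_inj) (Q_neq0 Qi).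
- exact: vfin_poly.
- exact: vfin_ninv.
- by move=> x; apply: (vfin_fermat p_pr tf_inj tf_frac Qi).
- move=> _ ->; rewrite sQ; set R := gen_ring _.
  have hR := gen_ring_subring ((fun x : k => x%:A) @` vfin tf Q `|` B).
  have RP x : reflect (R x) (x \in mem_subring hR) by apply: mem_subringP.
  have sQ1 : size Q = (size Q).-1.+1 by rewrite prednK // size_poly_gt0 monic_neq0.
  exists (\sum_(j < (size Q).-1) phi (carlitz_coefs Q j %/ Q) * lam ^+ (p ^ j)).
    apply/RP; apply: rpred_sum => j _; rewrite rpredM ?rpredX //; apply/RP; apply: gen_base.
      by left; exists (tf (carlitz_coefs Q j %/ Q)); [apply: vfin_poly | rewrite phiE].
    by right.
  rewrite (cact_coefs p_pr phi lam (eq_leq sQ1)) big_ord_recr /=.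
  rewrite (carlitz_lead p_pr Qm) rmorph1 mul1r addrK mulr_sumr; apply: eq_bigr => j _.
  rewrite mulrA -phiE -rmorphM [Q * _]mulrC divpK //.
  exact: (carlitz_coefs_dvd p_pr Qi Qm).
- move=> x _; have [q ->] := cyclotomic_generator x.
  apply: (adjoin_denominators q (v := vfin tf Q) (t := tf Q) (B := B)) => //.
    exact: vfin_poly.
  by move=> c; apply: vfin_denominators.
- exact: hw.
- exact: wv.
- exact: (gen_ring_sub_place hW wW vW BW).
Qed.

Lemma Fp_fixed_by_frobenius (z : K) : z ^+ p = z -> exists c : 'F_p, z = phi c%:P.
Proof.
move=> zp; pose psi : {rmorphism 'F_p -> K} := (phi \o polyC)%FUN.
have /(congr1 (map_poly psi)) := finField_genPoly 'F_p.
rewrite card_Fp // rmorphB /= map_polyXn map_polyX rmorph_prod /= => E.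
have := congr1 (fun f : {poly K} => f.[z]) E.
rewrite /= hornerD hornerN hornerXn hornerX zp subrr horner_prod => /esym/eqP.
case/prodf_eq0 => c _; rewrite map_polyXsubC hornerXsubC subr_eq0 => /eqP ->.
by exists c.
Qed.

Section Infinite.
Hypothesis d_gt1 : (1 < d)%N.
Hypothesis S_constants : forall (s : gal_of {:K}) (c : 'F_p),
  c != 0 -> s lam = phi c%:P * lam -> s \in S.

(** By the Galois correspondence it is enough that an automorphism fixing T^n l^(p-1) belong to [S].
    It multiplies l by some z with z^p = z, that is by a nonzero constant, and then acts on [lam] by
    the same constant. *)
Lemma fixed_in_adjoin_power (l x : K) n : l \in rs -> l != 0 -> x \in F ->
  x \in <<1; phi 'X ^+ n * l ^+ p.-1>>%VS.
Proof.
move=> lr l0; set u := _ * _.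
have gal_u : galois <<1; u>>%AS {:K}.
  by apply: galoisS cyclotomic_galois; rewrite subv_adjoin subvf.
have /galois_fixedField uE := gal_u.
suff : (F <= fixedField 'Gal({:K} / <<1; u>>%AS)%g)%VS by rewrite uE => /subvP; apply.
apply: fixedFieldS; apply/fintype.subsetP => s su.
have su' : s u = u by apply: (fixed_gal (subvf _) su); apply: memv_adjoin.
have X0 : phi 'X != 0 by rewrite (phi_eq0 phi_inj) polyX_eq0.
have slp : (s l / l) ^+ p = s l / l.
  have l1 : s l ^+ p.-1 = l ^+ p.-1.
    apply: (mulfI (expf_neq0 n X0)); rewrite -[RHS]su' rmorphM !rmorphXn /=.
    by rewrite phiE gal_base.
  rewrite -{1}(prednK (prime_gt0 p_pr)) exprS expr_div_n l1 divff ?mulr1 //.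
  by rewrite expf_neq0.
have [c cE] := Fp_fixed_by_frobenius slp.
have sl : s l = phi c%:P * l by rewrite -cE divfK.
have c0 : c != 0.
  apply: contraNneq l0 => c0; move: sl; rewrite c0 polyC0 rmorph0 mul0r => /eqP.
  by rewrite fmorph_eq0.
apply: (S_constants c0).
have [b -> _] := torsion_cyclic p_pr Pi Pm rsP lr l0 lam_rs.
by rewrite gal_cact sl cactCr.
Qed.

(** The element adjoined to the local ring is u = T^e l^(p-1) for a torsion point l at which u is
    integral. This l depends on the place, but F lies in k(u) for each choice of l. As u is -1
    modulo T^-1, the trivial automorphism satisfies the Frobenius congruence. *)
Lemma frobenius_at_infinite (w : set E) :
  valuation_ring w -> (forall x, vinf tf x <-> w x%:A) ->
  exists2 sE : {rmorphism E -> E},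
  (forall x, sE x = vsproj F ((1%g : gal_of {:K}) (vsval x))) /\
  (forall x, vsval (sE x) = (1%g : gal_of {:K}) (vsval x)) &
  [/\ (forall y, max_ideal w y -> exists2 z, w z & y = (tf 'X)^-1 *: z),
      (forall x, w x -> max_ideal w (sE x - x ^+ (p ^ 1))) &
      forall s : gal_of {:K},
        (forall x, w x -> max_ideal w (vsproj F (s (vsval x)) - x ^+ (p ^ 1))) ->
        forall x, x \in F -> s x = (1%g : gal_of {:K}) x].
Proof.
move=> hw wv; have [W [hW wW vW]] := extend_place hw wv.
have vW' : forall x, vinf tf x <-> W (in_alg K x) := vW.
have phiE' a : phi a = in_alg K (tf a) by apply: phiE.
have [l [lr l0 Wu]] := exists_integral_u p_pr tf_inj tf_frac phiE' Pm d_gt1 rsP hW vW'.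
set u := _ * _ in Wu.
pose B : set K := [set u]; have BW : B `<=` W by move=> _ ->.
set R := gen_ring ((fun x : k => x%:A) @` vinf tf `|` B).
have hR : subring R := gen_ring_subring _.
have RP x : reflect (R x) (x \in mem_subring hR) by apply: mem_subringP.
have Rv x : vinf tf x -> R (in_alg K x) by move=> vx; apply: gen_base; left; exists x.
have Ru : R u by apply: gen_base; right.
have X0 := tf_X0 tf_inj.
have vt : vinf tf (tf 'X)^-1.
  have /(vinf_maxP p_pr tf_inj tf_frac) : exists2 y, vinf tf y & (tf 'X)^-1 = (tf 'X)^-1 * y.
    by exists 1; rewrite ?mulr1 //; case: (vinf_valuation tf_inj tf_frac).
  exact: max_ideal_sub.
apply: (@frobenius_at p 1 k K pK isT gal_comm S (vinf tf) (tf 'X)^-1 _ vt _ _ B).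
- by rewrite invr_eq0.
- exact: (vinf_ninv p_pr tf_inj).
- by move=> x; rewrite expn1; apply: (vinf_fermat p_pr tf_inj tf_frac).
- move=> _ ->.
  have [r Rr ur] := u_congr p_pr tf_inj tf_frac phiE' Pm d_gt1 rsP hR lr l0 Rv Ru.
  have uE : u = (tf 'X)^-1%:A * r - 1 by rewrite -[_%:A]/(in_alg K _) -ur addrK.
  rewrite gal_id expn1 uE.
  have := exprBpn ((tf 'X)^-1%:A * r) 1 1 pK; rewrite expn1 expr1n => ->.
  exists (r - (tf 'X)^-1%:A ^+ p.-1 * r ^+ p).
    apply/RP; rewrite rpredB ?rpredM ?rpredX //; apply/RP => //; exact: Rv.
  rewrite mulrBr mulrA -exprS prednK ?prime_gt0 // exprMn.
  by rewrite opprB addrA subrK.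
- move=> x /(fixed_in_adjoin_power (((size P).-1 - 1) * (p - 1) - 1) lr l0).
  case/Fadjoin1_polyP => q ->.
  apply: (adjoin_denominators q (v := vinf tf) (t := (tf 'X)^-1) (B := B)) => //.
  by move=> c; apply: vinf_denominators.
- exact: hw.
- exact: wv.
- exact: (gen_ring_sub_place hW wW vW BW).
Qed.

End Infinite.

Section Ramified.
Hypotheses (S_group : group_set S) (S_proper : (#|S| < #|{: gal_of {:K}}|)%N).

(** The product of the conjugates of [lam] under [S] lies in F and is a unit times lam^|S|, whereas
    P is a unit times lam^(p^d - 1). As |S| is smaller, this product is in the maximal ideal without
    being divisible by P. *)
Lemma ramified_at_conductor : exists w : set E,
  [/\ valuation_ring w, (forall x, vfin tf P x <-> w x%:A) &
      exists2 y, max_ideal w y & forall t z, max_ideal (vfin tf P) t -> w z -> y <> t *: z].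
Proof.
have [W hW WP] := place_extension (in_alg K) (vfin_valuation tf_inj tf_frac Pi).
have {}WP : forall x : k, vfin tf P x <-> W x%:A := WP.
have hw : valuation_ring (fun x : E => W (vsval x)).
  case: hW => W1 WB WM WV; split; first by rewrite rmorph1.
  - by move=> x y wx wy; rewrite rmorphB; apply: WB.
  - by move=> x y wx wy; rewrite rmorphM; apply: WM.
  - by move=> x; rewrite fmorphV; apply: WV.
exists (fun x : E => W (vsval x)); split => //.
  by move=> x; rewrite in_alg_vsval.
pose G := Group S_group.
pose N := \prod_(s in S) s lam.
have NF : N \in F.
  apply/fixedFieldP => [|t tS]; first exact: memvf.
  rewrite /N rmorph_prod [RHS](reindex_inj (mulIg t)) /=; apply: eq_big => s.
    by rewrite (groupMr (G := G) s tS).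
  by rewrite galM ?memvf.
have uN : vunit W (N / lam ^+ #|S|).
  have -> : N / lam ^+ #|S| = \prod_(s in S) (s lam / lam) by rewrite prodf_div prodr_const.
  by apply: (vunit_prod hW) => s _; apply: (gal_lam_unit hW WP).
have S0 : (0 < #|S|)%N by apply/card_gt0P; exists 1%g; apply: (group1 G).
have lS0 : lam ^+ #|S| != 0 by rewrite expf_neq0.
have ml := above_torsion_max hW WP.
have mN : max_ideal W N.
  rewrite -(divfK lS0 N); apply: (max_idealMl hW); first by case: uN.
  exact: (max_ideal_expn hW).
have N0 : N != 0 by apply/prodf_neq0 => s _; rewrite fmorph_eq0.
exists (vsproj F N).
  apply/(max_idealE hw); right; rewrite fmorphV /= vsprojK // => VN.
  by case: mN => _ [/eqP|//]; rewrite (negPf N0).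
move=> t z mt wz E1.
have /(vfin_maxP tf_inj tf_frac Pi)[y vy tE] := mt.
have NE : N = phi P * (y%:A * vsval z).
  have := congr1 vsval E1; rewrite vsprojK // => ->.
  by rewrite linearZ /= tE phiE !mulr_algl scalerA.
have uP := above_prime_power hW WP.
have M_lt : (#|S| < (p ^ (size P).-1).-1)%N.
  exact: leq_trans S_proper card_gal_cyclotomic_le.
set M := (p ^ _).-1 in uP M_lt.
have lM0 : lam ^+ M != 0 by rewrite expf_neq0.
apply: (vunit_nmax uN).
have -> : N / lam ^+ #|S| = lam ^+ (M - #|S|) * ((phi P / lam ^+ M) * (y%:A * vsval z)).
  have lE : lam ^+ M = lam ^+ (M - #|S|) * lam ^+ #|S| by rewrite -exprD subnK // ltnW.
  have lD0 : lam ^+ (M - #|S|) != 0 by rewrite expf_neq0.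
  rewrite lE NE; move: (lam ^+ (M - #|S|)) (lam ^+ #|S|) lD0 lS0 (phi P) (y%:A * vsval z).
  by move=> a b a0 b0 P' q; field; rewrite a0 b0.
apply: (max_idealMr hW); first by apply: (max_ideal_expn hW) => //; rewrite subn_gt0.
apply: (vringM hW); first by case: uP.
by apply: (vringM hW) => //; apply/WP.
Qed.

End Ramified.

End CyclotomicGalois.

(** * Power sums modulo P_a *)

Section MonicSums.
Variables (p : nat) (p_pr : prime p).
Local Notation A := {poly 'F_p}.

Lemma size_Xn_add m (h : A) : (size h <= m)%N -> size ('X^m + h) = m.+1.
Proof. by move=> hm; rewrite size_polyDl size_polyXn. Qed.

Lemma monic_Xn_add m (h : A) : (size h <= m)%N -> 'X^m + h \is monic.
Proof. by move=> hm; rewrite monicE lead_coefDl ?lead_coefXn // size_polyXn. Qed.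

Lemma sum_monic (R : nmodType) (G : A -> R) m :
  \sum_(b : {poly_m.+1 'F_p} | (size b == m.+1) && ((b : A) \is monic)) G b =
  \sum_(h : {poly_m 'F_p}) G ('X^m + h).
Proof.
rewrite (reindex_onto (fun h : {poly_m 'F_p} => npolyp m.+1 ('X^m + h))
  (fun b => npolyp m b)) /=.
  apply: eq_big => h; last first.
    by rewrite npolypK ?size_Xn_add ?size_npoly.
  rewrite npolypK ?size_Xn_add ?size_npoly // eqxx monic_Xn_add ?size_npoly //=.
  apply/eqP/val_inj/polyP => i; rewrite coef_npolyp coefD coefXn.
  case: ltnP => im; first by rewrite (ltn_eqF im) add0r.
  by rewrite nth_default // (leq_trans (size_npoly h)).
move=> b /andP[/eqP sb bm]; apply/val_inj; rewrite /= npolypK; last first.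
  by rewrite size_Xn_add // size_npoly.
apply/polyP => i; rewrite coefD coefXn coef_npolyp.
case: (ltngtP i m) => im; rewrite ?add0r //.
  by rewrite nth_default // sb.
by move/monicP: bm; rewrite im addr0 lead_coefE sb.
Qed.

Lemma sum_npolyS (R : nmodType) (G : A -> R) m :
  \sum_(b : {poly_m.+1 'F_p}) G b =
  \sum_(c : 'F_p) \sum_(h : {poly_m 'F_p}) G (c *: 'X^m + h).
Proof.
have sz (c : 'F_p) (h : {poly_m 'F_p}) : (size (c *: 'X^m + val h)%R <= m.+1)%N.
  rewrite (leq_trans (size_polyD _ _)) // geq_max (leq_trans (size_scale_leq _ _)) ?size_polyXn //.
  by rewrite (leq_trans (size_npoly h)).
rewrite pair_big /= (reindex (fun ch : 'F_p * {poly_m 'F_p} => npolyp m.+1 (ch.1 *: 'X^m + val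
  ch.2))).
  by apply: eq_bigr => -[c h] _; rewrite npolypK ?sz.
exists (fun b : {poly_m.+1 'F_p} => (b`_m, npolyp m b)) => [[c h] _|b _] /=.
  rewrite npolypK ?sz //= coefD coefZ coefXn eqxx mulr1 nth_default ?size_npoly // addr0.
  congr (_, _); apply/val_inj/polyP => i; rewrite coef_npolyp coefD coefZ coefXn.
  case: ltnP => im; first by rewrite (ltn_eqF im) mulr0 add0r.
  by rewrite nth_default // (leq_trans (size_npoly h)).
apply/val_inj; rewrite /= (npolypK (sz b`_m (npolyp m b))).
apply/polyP => i; rewrite coefD coefZ coefXn coef_npolyp.
case: (ltngtP i m) => im; rewrite ?mulr0 ?add0r ?mulr1 ?addr0 //.
  by rewrite nth_default // (leq_trans (size_npoly b)).
by rewrite im.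
Qed.

(** As a polynomial in x the left side has degree at most j, but it takes the same value at the p^m
    polynomials of degree below m, since translating by one of them permutes its terms. *)
Lemma translate_sum_const m j (x : A) : (j < p ^ m)%N ->
  \sum_(h : {poly_m 'F_p}) (x + val h) ^+ j = \sum_(h : {poly_m 'F_p}) val h ^+ j.
Proof.
move=> jm; pose g : {poly A} := \sum_(h : {poly_m 'F_p}) ('X + (val h)%:P) ^+ j -
   (\sum_(h : {poly_m 'F_p}) val h ^+ j)%:P.
suff g0 : g = 0.
  have := congr1 (fun f : {poly A} => f.[x]) g0.
  rewrite /g /= horner0 hornerD hornerN hornerC horner_sum => /eqP; rewrite subr_eq0 => /eqP <-.
  by apply: eq_bigr => h _; rewrite horner_exp hornerD hornerX hornerC.
apply/eqP/negPn/negP => g0.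
have sg : (size g <= j.+1)%N.
  rewrite (leq_trans (size_polyD _ _)) // geq_max size_polyN size_polyC; apply/andP; split.
    rewrite (leq_trans (size_sum _ _ _)) //; apply/bigmax_leqP => h _.
    by rewrite (leq_trans (size_poly_exp_leq _ _)) // size_XaddC mul1n.
  by case: (_ != 0).
have := max_poly_roots g0 (_ : all (root g) [seq val h | h <- enum {poly_m 'F_p}]).
rewrite map_inj_uniq ?enum_uniq; last exact: val_inj.
move=> /(_ _ isT); rewrite size_map -cardE card_polyn // => H.
have : (p ^ m < size g)%N.
  apply: H; apply/allP => _ /mapP[h' _ ->].
  rewrite rootE /g hornerD hornerN hornerC horner_sum subr_eq0; apply/eqP.
  rewrite [RHS](reindex_inj (addrI h')) /=; apply: eq_bigr => h _.
  by rewrite horner_exp hornerD hornerX hornerC.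
by rewrite ltnNge (leq_trans sg).
Qed.

(** For each coefficient c of T^m the inner sum is the same, and it occurs p times. *)
Lemma translate_sum_eq0 m j (x : A) : (j < p ^ m)%N ->
  \sum_(h : {poly_m.+1 'F_p}) (x + val h) ^+ j = 0.
Proof.
move=> jm; rewrite (sum_npolyS (fun f => (x + f) ^+ j)).
under eq_bigr => c _.
  under eq_bigr => h _ do rewrite addrA.
  rewrite (translate_sum_const _ jm); over.
rewrite sumr_const card_Fp // -mulr_natr -polyC_natr.
by rewrite (pcharf0 (pchar_Fp p_pr)) polyC0 mulr0.
Qed.

Lemma power_sum_eq0 m i : (i < m)%N -> power_sum p m (p ^ i - 1) = 0.
Proof.
case: m => // m im; rewrite /power_sum (sum_monic (fun f => f ^+ _)).
apply: translate_sum_eq0; rewrite subn1 prednK ?expn_gt0 ?prime_gt0 //.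
by rewrite leq_exp2l // prime_gt1.
Qed.

End MonicSums.

Lemma deriv_prod_XaddC (R : fieldType) (I : Type) (s : seq I) (c : I -> R) y :
  (forall i, y + c i != 0) ->
  ((\prod_(i <- s) ('X + (c i)%:P))^`()).[y] =
  (\prod_(i <- s) (y + c i)) * \sum_(i <- s) (y + c i)^-1.
Proof.
move=> y0; elim: s => [|i s IH]; first by rewrite !big_nil derivC horner0 mulr0.
rewrite !big_cons derivM hornerD !hornerM derivD derivX derivC addr0 hornerC mul1r IH.
rewrite hornerD hornerX hornerC horner_prod.
have -> : \prod_(j <- s) ('X + (c j)%:P).[y] = \prod_(j <- s) (y + c j).
  by apply: eq_bigr => j _; rewrite hornerD hornerX hornerC.
by rewrite mulrDr [_ * _ * (y + c i)^-1]mulrAC mulfV // mul1r mulrA.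
Qed.

(** * Artin-Schreier polynomials and operators that are polynomials in Frobenius *)

Section ArtinSchreier.
Variables (p : nat) (p_pr : prime p) (a : 'F_p) (a_neq0 : a != 0).
Local Notation A := {poly 'F_p}.
Local Notation P := (Pa a).

Let sX : (size (- 'X : A) < size ('X^p : A))%N.
Proof. by rewrite size_polyN size_polyX size_polyXn ltnS prime_gt1. Qed.

Let sa : (size (- a%:P) < size ('X^p - 'X : A)%R)%N.
Proof.
rewrite size_polyDl ?sX // size_polyXn size_polyN size_polyC ltnS.
by case: (a != 0); rewrite // prime_gt0.
Qed.

Lemma size_Pa : size P = p.+1.
Proof. by rewrite /Pa size_polyDl ?sa // size_polyDl ?sX // size_polyXn. Qed.

Lemma Pa_monic : P \is monic.
Proof. by rewrite monicE lead_coefDl ?sa // lead_coefDl ?sX // lead_coefXn. Qed.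

Lemma Pa_frobenius n : P %| 'X^(p ^ n) - 'X - (n%:R * a)%:P.
Proof.
elim: n => [|n IH]; first by rewrite expn0 expr1 mul0r polyC0 subrr subr0 dvdp0.
have -> : 'X^(p ^ n.+1) - 'X - (n.+1%:R * a)%:P =
    (('X^(p ^ n) ^+ p - ('X + (n%:R * a)%:P) ^+ p) + P).
  rewrite polyFp_exprD // -exprM -expnSr -polyC_exp Fp_expp // /Pa mulrSr mulrDl mul1r polyCD.
  set u := 'X^_; set v := 'X^_; set x := 'X; move: u v x => u v x.
  by rewrite !opprD !addrA; move: (_%:P) (a%:P) => b c; ring.
apply: dvdp_add => //; rewrite subrXX; apply: dvdp_mulr.
by rewrite opprD addrA.
Qed.

(** For an irreducible factor Q of degree e, Fermat modulo Q and [Pa_frobenius] give T = T + e a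
    modulo Q, so p divides e. Every nonconstant divisor then has degree at least p. *)
Lemma Pa_irreducible : irreducible_poly P.
Proof.
split=> [|q q1 qP]; first by rewrite size_Pa ltnS prime_gt0.
have P0 : P != 0 by rewrite monic_neq0 ?Pa_monic.
have q0 : q != 0 by apply: contraNneq P0 => q0; move: qP; rewrite q0 dvd0p.
have sq : (1 < size q)%N by case: (size q) (size_poly_gt0 q) q1 q0 => [|[|]] // <-.
have [Q [Qi Qm Qq]] := exists_monic_irreducible_factor sq.
have QP := dvdp_trans Qq qP.
have : Q %| ((size Q).-1%:R * a)%:P.
  have -> : ((size Q).-1%:R * a)%:P = ('X^(p ^ (size Q).-1) - 'X) -
      ('X^(p ^ (size Q).-1) - 'X - ((size Q).-1%:R * a)%:P) by rewrite subKr.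
  apply: dvdp_sub; first exact: poly_fermat.
  exact: dvdp_trans (Pa_frobenius _).
have s1 : (1 < size Q)%N by case: Qi.
have [/eqP|c0] := eqVneq ((size Q).-1%:R * a) 0; last first.
  move/dvdp_leq; rewrite polyC_eq0 c0 size_polyC c0 => /(_ isT).
  by rewrite leqNgt s1.
rewrite mulf_eq0 (negPf a_neq0) orbF -(dvdn_pcharf (pchar_Fp p_pr)) => pd _.
have pQ : (p < size Q)%N.
  rewrite -(prednK (ltnW s1)) ltnS; apply: dvdn_leq => //.
  by rewrite -ltnS prednK // ltnW.
rewrite -dvdp_size_eqp // eqn_leq dvdp_leq //= size_Pa.
by apply: leq_trans pQ _; apply: dvdp_leq.
Qed.

Section Residue.
Variables (FF : fieldType) (pi : {rmorphism A -> FF}).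
Hypothesis piX : pi 'X ^+ p = pi 'X + pi a%:P.
Hypothesis pi_neq0 : forall f : A, f != 0 -> (size f <= p)%N -> pi f != 0.

(** A acts with T sent to 0, so that C_T becomes the p-power map F and [op q] is the operator q(F);
    composition of such operators is then the Carlitz identity [cactM]. *)
Let phi0 : {rmorphism A -> FF} := (pi \o (polyC \o horner_eval (0 : 'F_p)))%FUN.

Lemma phi0C c : phi0 c%:P = pi c%:P.
Proof. by rewrite /phi0 /= /horner_eval hornerC. Qed.

Lemma phi0X : phi0 'X = 0.
Proof. by rewrite /phi0 /= /horner_eval hornerX polyC0 rmorph0. Qed.

Local Notation op := (cact phi0).

Lemma iter_ctau0 i y : iter i (ctau phi0) y = y ^+ (p ^ i).
Proof.
elim: i => [|i IH]; first by rewrite expr1.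
by rewrite iterS IH /ctau phi0X mul0r add0r -exprM -expnSr.
Qed.

Lemma op_coef n (q : A) y : (size q <= n)%N -> op q y = \sum_(i < n) pi (q`_i)%:P * y ^+ (p ^ i).
Proof.
move=> qn; rewrite (cact_wide _ _ qn); apply: eq_bigr => i _.
by rewrite iter_ctau0 phi0C.
Qed.

Lemma op_Xn n y : op 'X^n y = y ^+ (p ^ n).
Proof.
elim: n y => [|n IH] y; first by rewrite cact1 expr1.
by rewrite exprSr cactMX IH /ctau phi0X mul0r add0r -exprM -expnS.
Qed.

Lemma pi_exp (f : A) : pi f ^+ p = pi (f \Po ('X + a%:P)).
Proof.
rewrite -[f in LHS]coefK poly_def rmorph_sum.
have := sum_expp p_pr (index_enum 'I_(size f)) xpredT (fun i => pi (f`_i *: 'X^i)) 1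
  (pchar_image p_pr pi).
rewrite expn1 => ->; rewrite comp_polyE rmorph_sum; apply: eq_bigr => i _.
rewrite -!mul_polyC !rmorphM !rmorphXn exprMn /=; congr (_ * _).
  by have := phi_const_exp p_pr pi f`_i 1; rewrite expn1.
by rewrite -exprM mulnC exprM piX rmorphD.
Qed.

Definition diff (f : A) := f \Po ('X + a%:P) - f.

Lemma op_diff f : op ('X - 1) (pi f) = pi (diff f).
Proof.
rewrite cactDl cactNl cact1 -['X]mul1r cactMX cact1 /ctau phi0X mul0r add0r pi_exp.
by rewrite /diff rmorphB.
Qed.

Lemma diffXn i : (size (diff 'X^i) <= i)%N /\ (diff 'X^i)`_i.-1 = i%:R * a.
Proof.
rewrite /diff comp_Xn_poly exprDn big_ord_recl subn0 expr0 mulr1 bin0 mulr1n addrAC subrr add0r.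
case: i => [|i]; first by rewrite big_ord0 size_poly0 coef0 mul0r.
have sj j : (size ('X^(i - j) * a%:P ^+ j.+1 *+ 'C(i.+1, j.+1) : A) <= (i - j).+1)%N.
  rewrite -mulrnAr -polyC_exp -polyCMn mulrC mul_polyC (leq_trans (size_scale_leq _ _)) //.
  by rewrite size_polyXn.
split.
  rewrite (leq_trans (size_sum _ _ _)) //; apply/bigmax_leqP => j _.
  by rewrite lift0 subSS (leq_trans (sj j)) // ltnS leq_subr.
rewrite coef_sum big_ord_recl lift0 subSS subn0 big1 ?addr0 => [|j _].
  by rewrite expr1 bin1 coefMn mulrC coefCM coefXn eqxx mulr1 mulr_natl.
rewrite nth_default // lift0 subSS lift0 (leq_trans (sj j.+1)) //.
by rewrite ltn_subrL /= (leq_ltn_trans _ (ltn_ord j)).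
Qed.

Lemma diffE (f : A) n : (size f <= n)%N -> diff f = \sum_(i < n) f`_i *: diff 'X^i.
Proof.
move=> fn; rewrite /diff.
have {1 2}-> : f = \sum_(i < n) f`_i *: 'X^i.
  rewrite -(poly_def n (fun i => f`_i)); apply/polyP => i; rewrite coef_poly.
  by case: ltnP => // ni; rewrite nth_default // (leq_trans fn).
rewrite raddf_sum /= -sumrB; apply: eq_bigr => i _.
by rewrite comp_polyZ scalerBr.
Qed.

Lemma diff_coef (f : A) m : (size f <= m.+2)%N ->
  (size (diff f) <= m.+1)%N /\ (diff f)`_m = m.+1%:R * a * f`_m.+1.
Proof.
move=> fm; rewrite (diffE fm); split.
  rewrite (leq_trans (size_sum _ _ _)) //; apply/bigmax_leqP => i _.
  rewrite (leq_trans (size_scale_leq _ _)) //; have [s _] := diffXn i.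
  by rewrite (leq_trans s) // -ltnS.
rewrite coef_sum big_ord_recr /= coefZ (proj2 (diffXn m.+1)) big1 ?add0r => [|i _].
  by rewrite mulrC.
rewrite coefZ [X in _ * X]nth_default ?mulr0 //; have [s _] := diffXn i.
by rewrite (leq_trans s) // -ltnS.
Qed.

(** Each application of F - 1 lowers the degree by one and multiplies the coefficient of T^i by i a
    as it becomes that of T^(i-1); after m steps only a constant is left. *)
Lemma op_power m (f : A) : (size f <= m.+1)%N ->
  op (('X - 1) ^+ m) (pi f) = pi (m`!%:R * a ^+ m * f`_m)%:P.
Proof.
elim: m f => [|m IH] f fm.
  by rewrite expr0 cact1 expr0 fact0 !mul1r [f in LHS]size1_polyC.
have [s c] := diff_coef fm.
rewrite exprSr cactM // op_diff IH // c; congr (pi _%:P).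
by rewrite factS natrM exprSr; move: (m.+1%:R) (m`!%:R) => u v; ring.
Qed.

Section Degree.
Variable m : nat.
Hypothesis m_lt : (m < p)%N.
Let y (g : {poly_m 'F_p}) : FF := pi ('X^m + val g).
Let q : A := ('X - 1) ^+ m.

Let y_neq0 g : y g != 0.
Proof.
by apply: pi_neq0; rewrite -?size_poly_gt0 size_Xn_add ?size_npoly.
Qed.

Lemma size_Xsub1_exp k : size (('X - 1) ^+ k : A) = k.+1.
Proof. by rewrite -polyC1 size_exp_XsubC. Qed.

Lemma sum_y_power n : \sum_g y g ^+ (p ^ n - 1) = pi (power_sum p m (p ^ n - 1)).
Proof.
rewrite /power_sum (sum_monic (fun f => f ^+ (p ^ n - 1))) rmorph_sum.
by apply: eq_bigr => g _; rewrite rmorphXn.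
Qed.

Let D k := \sum_g op (('X - 1) ^+ k) (y g) / y g.

Let ypow n g : y g ^+ (p ^ n - 1) = y g ^+ (p ^ n) / y g.
Proof.
have -> : (p ^ n = (p ^ n - 1).+1)%N by rewrite subn1 prednK // expn_gt0 prime_gt0.
by rewrite subn1 /= exprSr mulfK.
Qed.

Lemma delta_sum_lt k : (k < m)%N -> D k = 0.
Proof.
move=> km; rewrite /D.
under eq_bigr => g _ do rewrite (op_coef _ (eq_leq (size_Xsub1_exp k))) mulr_suml.
rewrite exchange_big big1 // => i _.
under eq_bigr => g _ do rewrite -mulrA -ypow.
by rewrite -mulr_sumr sum_y_power power_sum_eq0 ?rmorph0 ?mulr0 // (leq_trans _ km).
Qed.

Lemma delta_sum_gt k : (m < k)%N -> D k = 0.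
Proof.
move=> mk; apply: big1 => g _.
have s : size ('X^m + val g) = m.+1 by rewrite size_Xn_add ?size_npoly.
rewrite op_power ?s ?(leq_trans mk) //.
have -> : ('X^m + val g)`_k = 0 by rewrite nth_default ?s.
by rewrite mulr0 polyC0 rmorph0 mul0r.
Qed.

(** The derivative enters through the logarithmic derivative: for E = prod (X + g) over the g of
    degree below m, E'(T^m) is E(T^m) times the sum of the 1 / (T^m + g). *)
Lemma delta_sum_eq : D m = (-1) ^+ m.
Proof.
pose E : {poly FF} := \sum_(i < m.+1) (pi (q`_i)%:P)%:P * 'X^(p ^ i).
have Ey z : E.[z] = op q z.
  rewrite (op_coef _ (eq_leq (size_Xsub1_exp m))) horner_sum; apply: eq_bigr => i _.
  by rewrite hornerM hornerC hornerXn.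
have qm : q`_m = 1.
  have : q \is monic by rewrite /q -polyC1 monic_exp // monicXsubC.
  by move/monicP; rewrite lead_coefE size_Xsub1_exp.
pose E0 : {poly FF} := \sum_(i < m) (pi (q`_i)%:P)%:P * 'X^(p ^ i).
have Elow : (size E0 < (p ^ m).+1)%N.
  rewrite ltnS (leq_trans (size_sum _ _ _)) //; apply/bigmax_leqP => i _.
  rewrite mul_polyC (leq_trans (size_scale_leq _ _)) // size_polyXn.
  by rewrite ltn_exp2l ?prime_gt1.
have EE : E = 'X^(p ^ m) + E0.
  by rewrite /E big_ord_recr /= qm polyC1 rmorph1 polyC1 mul1r addrC.
have sE : size E = (p ^ m).+1 by rewrite EE size_polyDl size_polyXn.
have lE : lead_coef E = 1 by rewrite EE lead_coefDl ?lead_coefXn // size_polyXn.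
pose rs := [seq - pi (val g) | g <- enum {poly_m 'F_p}].
have srs : size E = (size rs).+1 by rewrite sE size_map -cardE card_polyn.
(* Distinct g of degree below m stay distinct modulo P_a because their difference has degree below
   p. *)
have urs : uniq rs.
  rewrite map_inj_uniq ?enum_uniq // => g1 g2 /oppr_inj H; apply/val_inj/eqP.
  rewrite -subr_eq0; apply/negPn/negP => d0; have := pi_neq0 d0.
  rewrite rmorphB H subrr eqxx => /(_ _)/notF; apply.
  by rewrite (leq_trans (size_polyD _ _)) // geq_max size_polyN !(leq_trans (size_npoly _)) // ltnW.
have ars : all (root E) rs.
  apply/allP => _ /mapP[g _ ->]; rewrite rootE Ey -rmorphN op_power.
    by rewrite coefN [X in - X]nth_default ?size_npoly // oppr0 mulr0 polyC0 rmorph0.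
  by rewrite size_polyN (leq_trans (size_npoly g)).
have Eprod : E = \prod_(g <- enum {poly_m 'F_p}) ('X + (pi (val g))%:P).
  rewrite (all_roots_prod_XsubC srs ars) ?uniq_rootsE // lE scale1r big_map.
  by apply: eq_bigr => g _; rewrite polyCN opprK.
have E' : E^`() = ((-1) ^+ m)%:P.
  rewrite /E big_ord_recl derivD expn0 expr1 derivM derivC mul0r add0r derivX mulr1.
  have -> : q`_(@ord0 m) = (-1) ^+ m.
    by rewrite -horner_coef0 /q horner_exp hornerD hornerN hornerX -polyC1 hornerC add0r.
  rewrite raddf_sum big1 ?addr0 => [|i _]; first by rewrite polyC_exp polyCN rmorphXn rmorphN
    rmorph1.
  rewrite [LHS]derivM derivC mul0r add0r derivXn lift0 expnS mulrnA.
  have pK : p \in [pchar {poly FF}].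
    by rewrite pchar_poly; apply: (rmorph_pchar pi); apply: pchar_polyFp.
  by rewrite (mulrn_pchar pK) mul0rn mulr0.
have := deriv_prod_XaddC (enum {poly_m 'F_p}) (c := fun g => pi (val g)) (y := pi 'X^m).
move=> H; have {}H := H (fun g => _); move: H; rewrite -Eprod E' hornerC => H.
have {}H : (-1) ^+ m = op q (pi 'X^m) * \sum_(g <- enum {poly_m 'F_p}) (y g)^-1.
  rewrite H => [|g]; last by rewrite -rmorphD; apply: y_neq0.
  congr (_ * _); last by apply: eq_bigr => g _; rewrite /y rmorphD.
  rewrite -Ey Eprod horner_prod; apply: eq_bigr => g _.
  by rewrite hornerD hornerX hornerC.
rewrite H mulr_sumr big_enum /=; apply: eq_bigr => g _; congr (_ / _).
rewrite /y !op_power ?size_polyXn ?size_Xn_add ?size_npoly //.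
by rewrite coefD [X in _ + X]nth_default ?size_npoly // addr0.
Qed.

Lemma power_sum_residue n : pi (power_sum p m (p ^ n - 1)) = (-1) ^+ m *+ 'C(n, m).
Proof.
rewrite -sum_y_power.
have yE g : y g ^+ (p ^ n - 1) = \sum_(k < n.+1) op (('X - 1) ^+ k) (y g) / y g *+ 'C(n, k).
  rewrite ypow -op_Xn.
  have -> : 'X^n = \sum_(k < n.+1) ('X - 1) ^+ k *+ 'C(n, k) :> A.
    rewrite -{1}(subrK 1 'X) addrC exprDn; apply: eq_bigr => k _.
    by rewrite expr1n mul1r.
  rewrite (big_morph (fun f => op f (y g)) (fun b c => cactDl phi0 b c (y g)) (cact0l phi0 _)).
  rewrite mulr_suml; apply: eq_bigr => k _.
  rewrite (_ : op (_ *+ _) _ = op (('X - 1) ^+ k) (y g) *+ 'C(n, k)) ?mulrnAl //.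
  elim: 'C(n, k) => [|c IH]; first by rewrite !mulr0n cact0l.
  by rewrite !mulrS cactDl IH.
under eq_bigr => g _ do rewrite yE.
rewrite exchange_big /=.
under eq_bigr => k _ do rewrite sumrMnl -/(D k).
(* For n < m the index k never reaches m, in accordance with the vanishing of the binomial
   coefficient. *)
have [nm|mn] := ltnP n m.
  rewrite bin_small // mulr0n big1 // => k _.
  by rewrite delta_sum_lt ?mul0rn // (leq_trans _ nm).
rewrite (bigD1 (inord m)) //= inordK // big1 ?addr0 ?delta_sum_eq // => k km.
have : (k != m :> nat).
  by apply: contra km => /eqP km; apply/eqP/val_inj; rewrite /= inordK.
by rewrite neq_ltn => /orP[/delta_sum_lt|/delta_sum_gt] ->; rewrite mul0rn.
Qed.

End Degree.
End Residue.
End ArtinSchreier.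

Section ArtinSchreierResidue.
Variables (p : nat) (p_pr : prime p) (a : 'F_p) (a_neq0 : a != 0).
Local Notation A := {poly 'F_p}.
Local Notation P := (Pa a).

Let Pi := Pa_irreducible p_pr a_neq0.
Let Pm := Pa_monic p_pr a.
Let P1 : (1 < size P)%N. Proof. by rewrite size_Pa // ltnS prime_gt0. Qed.

Lemma power_sum_in_qpoly m n : (m < p)%N ->
  in_qpoly P (power_sum p m (p ^ n - 1)) = (-1) ^+ m *+ 'C(n, m).
Proof.
move=> mp; have hP : monic_irreducible_poly P by split.
pose FF := {poly %/ P with hP}.
pose pi : {rmorphism A -> FF} := (in_qpoly P : A -> FF).
suff : pi (power_sum p m (p ^ n - 1)) = (-1) ^+ m *+ 'C(n, m) by [].
apply: (power_sum_residue p_pr (a := a)) => //.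
- rewrite -rmorphXn -rmorphD; apply/eqP; rewrite -subr_eq0 -rmorphB.
  by rewrite [_ == _](in_qpoly_eq0 _ Pm P1) opprD addrA.
- move=> f f0 sf; rewrite [_ == _](in_qpoly_eq0 _ Pm P1).
  by apply/negP => /(dvdp_leq f0); rewrite size_Pa // ltnNge sf.
Qed.

Lemma power_sum_dvd m n : (m < p)%N ->
  P %| power_sum p m (p ^ n - 1) - (-1) ^+ m *+ 'C(n, m).
Proof.
move=> mp; rewrite -(in_qpoly_eq0 _ Pm P1) rmorphB /= power_sum_in_qpoly //.
by rewrite rmorphMn rmorphXn rmorphN rmorph1 subrr.
Qed.

Lemma binomial_1subX (R : comNzRingType) n m : (n < m)%N ->
  \sum_(0 <= i < m) ((-1) ^+ i *+ 'C(n, i)) *: 'X^i = (1 - 'X) ^+ n :> {poly R}.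
Proof.
move=> nm; rewrite exprBn big_mkord (big_ord_widen m
  (fun i => (-1) ^+ i * 1 ^+ (n - i) * 'X^i *+ 'C(n, i) : {poly R})) //.
rewrite [RHS]big_mkcond; apply: eq_bigr => i _; case: ltnP => ni.
  rewrite expr1n mulr1 -mulrnAl -mul_polyC; congr (_ * _).
  by rewrite rmorphMn rmorphXn rmorphN rmorph1.
by rewrite bin_small // mulr0n scale0r.
Qed.

Lemma power_sum_generating n : (n <= p - 1)%N ->
  map_poly (in_qpoly P) (\sum_(0 <= m < p) power_sum p m (p ^ n - 1) *: 'X^m)
    = (1 - 'X) ^+ n.
Proof.
move=> np; have np' : (n < p)%N by rewrite -(subnK (prime_gt0 p_pr)) addn1 ltnS.
rewrite -(binomial_1subX _ np') rmorph_sum /=; apply: eq_big_nat => m /andP[_ mp].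
by rewrite linearZ_LR /= map_polyXn power_sum_in_qpoly.
Qed.

End ArtinSchreierResidue.

(** * The valuation ring of the p-adic valuation *)

Section ResidueMap.
Variables (p : nat) (Q : closedFieldType) (v : Q -> \bar rat).
Hypothesis hv : is_valuation_over_p p v.
Local Open Scope ereal_scope.

Let vinfE x : v x = +oo <-> x = 0%R. Proof. by case: hv. Qed.
Let vNinf x : v x != -oo. Proof. by case: hv. Qed.
Let vM x y : v (x * y)%R = v x + v y. Proof. by case: hv. Qed.

Let vfin_num x : x != 0%R -> exists r : rat, v x = r%:E.
Proof.
move=> x0; case E: (v x) => [r| |]; first by exists r.
- by move/vinfE: E => /eqP; rewrite (negPf x0).
- by have := vNinf x; rewrite E.
Qed.

Lemma padic_v1 : v 1 = 0.
Proof.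
have [r E] := vfin_num (oner_neq0 Q).
have := vM 1 1; rewrite mulr1 E -EFinD => -[] /eqP.
by rewrite -subr_eq0 opprD addrA subrr add0r oppr_eq0 => /eqP ->.
Qed.

Lemma padic_vV x : x != 0%R -> v x + v x^-1 = 0.
Proof. by move=> x0; rewrite -vM mulfV // padic_v1. Qed.

(** The finite values are rational numbers, a group without torsion; in particular roots of unity
    have valuation 0. *)
Lemma padic_vX_eq0 x n : (0 < n)%N -> v (x ^+ n) = 0 -> v x = 0.
Proof.
move=> n0; have [->|x0] := eqVneq x 0%R.
  by rewrite expr0n (gtn_eqF n0) => E; have := (vinfE 0%R).2 erefl; rewrite E.
have [r E] := vfin_num x0.
have -> : v (x ^+ n) = (r *+ n)%:E.
  elim: n {n0} => [|n IH]; first by rewrite expr0 padic_v1 mulr0n.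
  by rewrite exprS vM IH E -EFinD mulrS.
by rewrite E => -[] /eqP; rewrite mulrn_eq0 (gtn_eqF n0) /= => /eqP ->.
Qed.

Lemma padic_vN x : v (- x) = v x.
Proof.
have vN1 : v (-1) = 0 by apply: (@padic_vX_eq0 _ 2); rewrite // sqrrN expr1n padic_v1.
by rewrite -mulN1r vM vN1 add0e.
Qed.

Lemma padic_valuation_ring : valuation_ring (vring v).
Proof.
split; rewrite /vring /=; first by rewrite padic_v1.
- move=> x y vx vy; case: hv => _ _ _ /(_ x (- y)%R) H _; apply: le_trans H.
  by rewrite padic_vN le_min vx vy.
- by move=> x y vx vy; rewrite vM adde_ge0.
- move=> x; have [->|x0] := eqVneq x 0%R; first by left; rewrite (vinfE 0%R).2.
  have xV0 : (x^-1 != 0)%R by rewrite invr_eq0.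
  have [r E] := vfin_num x0; have [s E'] := vfin_num xV0.
  have := padic_vV x0; rewrite E E' !lee_fin -EFinD => -[] /eqP.
  rewrite addr_eq0 => /eqP ->; rewrite oppr_ge0; apply/orP; exact: le_total.
Qed.

Lemma padic_max_ideal x : max_ideal (vring v) x <-> 0 < v x.
Proof.
rewrite (max_idealE padic_valuation_ring); have [->|x0] := eqVneq x 0%R.
  by rewrite (vinfE 0%R).2 //; split => // _; left.
have xV0 : (x^-1 != 0)%R by rewrite invr_eq0.
have [r E] := vfin_num x0; have [s E'] := vfin_num xV0.
have := padic_vV x0; rewrite /vring /= E E' lee_fin lte_fin -EFinD => -[] /eqP.
rewrite addr_eq0 => /eqP ->; rewrite oppr_gt0 ltNge.
split => [[/eqP|/negP //]|/negP]; last by right.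
by rewrite (negPf x0).
Qed.

End ResidueMap.

(** * Reduction of polynomials and of their reciprocal roots *)

Section PolynomialReduction.
Variables (E : fieldType) (O : set E) (hO : valuation_ring O).
Variables (kappa : fieldType) (red : E -> kappa).
Hypothesis hred : is_residue_map O red.

Lemma red1 : red 1 = 1. Proof. by case: hred. Qed.
Lemma redB x y : O x -> O y -> red (x - y) = red x - red y.
Proof. by case: hred => _ H _ _ _; apply: H. Qed.
Lemma redM x y : O x -> O y -> red (x * y) = red x * red y.
Proof. by case: hred => _ _ H _ _; apply: H. Qed.
Lemma red_eq0 x : O x -> red x = 0 <-> max_ideal O x.
Proof. by case: hred => _ _ _ H _; apply: H. Qed.
Lemma red0 : red 0 = 0.
Proof. by rewrite -(subrr 1) redB ?subrr //; apply: (vring1 hO). Qed.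
Lemma redN x : O x -> red (- x) = - red x.
Proof. by move=> Ox; rewrite -sub0r redB ?red0 ?sub0r //; apply: (vring0 hO). Qed.
Lemma redD x y : O x -> O y -> red (x + y) = red x + red y.
Proof.
move=> Ox Oy; rewrite -[y in LHS]opprK redB ?redN ?opprK //; exact: (vringN hO).
Qed.
Lemma redX x n : O x -> red (x ^+ n) = red x ^+ n.
Proof.
move=> Ox; elim: n => [|n IH]; first exact: red1.
by rewrite !exprS redM ?IH //; apply: (vringX hO).
Qed.
Lemma red_sum (I : Type) (r : seq I) (F : I -> E) : (forall i, O (F i)) ->
  red (\sum_(i <- r) F i) = \sum_(i <- r) red (F i).
Proof.
move=> OF; elim: r => [|i r IH]; first by rewrite !big_nil red0.
by rewrite !big_cons redD ?IH //; apply: (vring_sum hO).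
Qed.

Definition integral_coefs (f : {poly E}) := forall i, O f`_i.
(** [red] is a ring morphism on [O] only, so the algebraic rules for [redp] hold under
    [integral_coefs]. *)
Definition redp (f : {poly E}) : {poly kappa} := map_poly red f.

Lemma coef_redp f i : (redp f)`_i = red f`_i.
Proof. by rewrite coef_map_id0 // red0. Qed.

Lemma integral_coefsM f g : integral_coefs f -> integral_coefs g -> integral_coefs (f * g).
Proof.
by move=> Of Og i; rewrite coefM; apply: (vring_sum hO) => j _; apply: (vringM hO).
Qed.

Lemma redpM f g : integral_coefs f -> integral_coefs g -> redp (f * g) = redp f * redp g.
Proof.
move=> Of Og; apply/polyP => i; rewrite coef_redp !coefM red_sum => [|j]; last exact: (vringM hO).
by apply: eq_bigr => j _; rewrite !coef_redp redM.
Qed.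

Lemma redp_linear c : O c -> redp (1 - c *: 'X) = 1 - red c *: 'X.
Proof.
move=> Oc; apply/polyP => i; rewrite coef_redp !coefB !coefZ !coefX !coef1.
have ob := vring_bool hO.
rewrite redB ?redM //; last exact: (vringM hO).
by congr (_ - _ * _); case: (_ == _); rewrite ?red1 ?red0.
Qed.

Lemma integral_linear c : O c -> integral_coefs (1 - c *: 'X).
Proof.
move=> Oc i; rewrite coefB coefZ coefX coef1.
have ob := vring_bool hO.
by apply: (vringB hO) => //; apply: (vringM hO).
Qed.

Lemma redp1 : redp 1 = 1.
Proof. by apply/polyP => i; rewrite coef_redp !coef1; case: (_ == _); rewrite ?red1 ?red0. Qed.

Lemma integral_coefs1 : integral_coefs 1.
Proof. by move=> i; rewrite coef1; apply: (vring_bool hO). Qed.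

Lemma redp_prod (I : eqType) (s : seq I) (F : I -> {poly E}) :
  (forall i, i \in s -> integral_coefs (F i)) ->
  integral_coefs (\prod_(i <- s) F i) /\ redp (\prod_(i <- s) F i) = \prod_(i <- s) redp (F i).
Proof.
elim: s => [|i s IH] OF; first by rewrite !big_nil redp1; split => //; apply: integral_coefs1.
have [|Os Es] := IH; first by move=> j js; apply: OF; rewrite inE js orbT.
have Oi : integral_coefs (F i) by apply: OF; rewrite inE eqxx.
by rewrite !big_cons redpM // Es; split => //; apply: integral_coefsM.
Qed.

(** A root of L in the maximal ideal would make the constant term 1 belong to it, so the reciprocal
    roots are integral and the factorization of L can be reduced. In prod (1 - red(x) X) = (1 - X)^m
    every nonzero red(x) is 1, and the degree counts them. *)
Lemma reciprocal_roots (L : {poly E}) (m : nat) (rs : seq E) :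
  integral_coefs L -> L`_0 = 1 -> L = lead_coef L *: \prod_(r <- rs) ('X - r%:P) ->
  redp L = (1 - 'X) ^+ m ->
  exists alphas : seq E, [/\ L = \prod_(x <- alphas) (1 - x *: 'X),
    (forall x, x \in alphas -> x != 0 /\ O x) &
    size [seq x <- alphas | red x == 1] = m].
Proof.
move=> OL L0 LE rL.
have L1 : L.[0] = 1 by rewrite horner_coef0.
have r0 r : r \in rs -> r != 0.
  move=> rr; apply: contraPneq L1 => re; rewrite LE hornerZ horner_prod.
  rewrite (big_rem r) //= hornerXsubC re subrr mul0r mulr0 => /esym/eqP.
  by rewrite oner_eq0.
have root_r r : r \in rs -> L.[r] = 0.
  move=> rr; rewrite LE hornerZ horner_prod (big_rem r) //=.
  by rewrite hornerXsubC subrr mul0r mulr0.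
exists [seq r^-1 | r <- rs].
have LA : L = \prod_(x <- [seq r^-1 | r <- rs]) (1 - x *: 'X).
  have E1 : L = (lead_coef L * \prod_(r <- rs) - r) *: \prod_(r <- rs) (1 - r^-1 *: 'X).
    rewrite {1}LE -scalerA; congr (_ *: _).
    rewrite -mul_polyC rmorph_prod -big_split /=; apply: eq_big_seq => r rr.
    rewrite mulrBr mulr1 -[r^-1 *: _]mul_polyC mulrA -polyCM mulNr mulfV ?r0 //.
    by rewrite (polyCN 1) polyC1 mulN1r opprK addrC polyCN.
  rewrite big_map {1}E1; suff -> : lead_coef L * \prod_(r <- rs) - r = 1 by rewrite scale1r.
  have := L1; rewrite {1}E1 hornerZ horner_prod [X in _ * X]big1 ?mulr1 // => r _.
  by rewrite hornerD hornerN hornerZ hornerX mulr0 subr0 hornerC.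
have prop x : x \in [seq r^-1 | r <- rs] -> x != 0 /\ O x.
  move=> /mapP[r rr ->]; rewrite invr_eq0 r0 //; split => //.
  apply: contrapT => nO; apply: (max_ideal1 hO).
  have mr : max_ideal O r by apply/(max_idealE hO); right.
  have := root_r r rr; rewrite horner_coef.
  have sL : (0 < size L)%N.
    by rewrite size_poly_gt0; apply: contraPneq L0 => ->; rewrite coef0 => /esym/eqP;
      rewrite oner_eq0.
  rewrite -(prednK sL) big_ord_recl L0 expr0 mulr1 => /eqP; rewrite addr_eq0 => /eqP ->.
  apply: (max_idealN hO); apply: (max_ideal_sum hO) => i _.
  apply: (max_idealMl hO) => //; exact: (max_ideal_expn hO).
split => //; move: LA prop; move: [seq _ | _ <- rs] => al LA prop.
have Oal x : x \in al -> integral_coefs (1 - x *: 'X).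
  by move=> /prop[_ Ox]; apply: integral_linear.
have [_] := redp_prod Oal; rewrite -LA rL => rE.
have {rE} : (1 - 'X) ^+ m = \prod_(x <- [seq x <- al | red x == 1]) (1 - 'X) :> {poly kappa}.
  rewrite rE big_filter [RHS]big_mkcond; apply: eq_big_seq => x xal.
  have [x0 Ox] := prop x xal; rewrite redp_linear //.
  case: eqP => [->|nx]; first by rewrite scale1r.
  have [->|rx0] := eqVneq (red x) 0; first by rewrite scale0r subr0.
  case: nx; have : ((1 - 'X) ^+ m).[(red x)^-1] = 0 :> kappa.
    rewrite rE horner_prod (big_rem x) //= redp_linear // hornerD hornerN hornerZ hornerX.
    by rewrite mulfV // hornerC subrr mul0r.
  rewrite horner_exp hornerD hornerN hornerX hornerC => /eqP.
  rewrite expf_eq0 subr_eq0 => /andP[_ /eqP E1].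
  by rewrite -[red x]invrK -E1 invr1.
rewrite big_const_seq count_predT iter_mulr_1 => /(congr1 (fun f : {poly kappa} => size f)).
have s1 : size (1 - 'X : {poly kappa}) = 2.
  by rewrite -opprB size_polyN -polyC1 size_XsubC.
by have := size_exp (1 - 'X : {poly kappa}); rewrite s1 => H /(congr1 predn); rewrite !H !mul1n.
Qed.

End PolynomialReduction.

(** * Teichmueller lifts *)

Section TeichmullerLift.
Variables (p : nat) (Q : closedFieldType) (v : Q -> \bar rat).
Hypothesis hv : is_valuation_over_p p v.
Variables (iota : {rmorphism algC -> Q}) (kappa : fieldType) (red : Q -> kappa).
Hypothesis hred : is_residue_map (vring v) red.
Variables (M : nat) (M_gt0 : (0 < M)%N) (M_kappa : M%:R != 0 :> kappa).

Let hO := padic_valuation_ring hv.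

Lemma root_of_unity_integral z : z ^+ M = 1 -> vring v (iota z).
Proof.
move=> zM; have : v (iota z ^+ M) = 0%E by rewrite -rmorphXn zM rmorph1 (padic_v1 hv).
by move/(padic_vX_eq0 hv M_gt0); rewrite /vring /= => ->.
Qed.

(** The factorization of X^M - 1 over the complex M-th roots of unity reduces to one over [kappa],
    and y must be a root of one of the reduced linear factors. *)
Lemma teichmuller_lift (y : kappa) : y ^+ M = 1 ->
  exists z : algC, z ^+ M = 1 /\ red (iota z) = y.
Proof.
move=> yM; have [z zP] := C_prim_root_exists M_gt0.
have zM i : (z ^+ i) ^+ M = 1 by rewrite exprAC (prim_expr_order zP) expr1n.
have := congr1 (map_poly iota) (factor_Xn_sub_1 zP).
rewrite rmorph_prod rmorphB /= map_polyXn rmorph1 => E.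
have Oz i : vring v (iota (z ^+ i)) by apply: root_of_unity_integral.
have OX i : integral_coefs (vring v) ('X - (iota (z ^+ i))%:P).
  move=> n; rewrite coefB coefX coefC; apply: (vringB hO).
    exact: (vring_bool hO).
  by case: (_ == _) => //; apply: (vring0 hO).
have rX i : redp red ('X - (iota (z ^+ i))%:P) = 'X - (red (iota (z ^+ i)))%:P.
  apply/polyP => n; rewrite (coef_redp hO hred) !coefB !coefX !coefC (redB hred).
  - by congr (_ - _); case: (_ == _); rewrite ?(red1 hred) ?(red0 hO hred).
  - exact: (vring_bool hO).
  - by case: (_ == _) => //; apply: (vring0 hO).
have OF i : i \in index_iota 0 M -> integral_coefs (vring v) (map_poly iota ('X - (z ^+ i)%:P)).
  by move=> _; rewrite map_polyXsubC; apply: OX.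
have [_] := redp_prod hO hred OF; rewrite E => E'.
have rXM : redp red ('X^M - 1) = 'X^M - 1.
  apply/polyP => n; rewrite (coef_redp hO hred) !coefB !coefXn !coef1 (redB hred).
  - by congr (_ - _); case: (_ == _); rewrite ?(red1 hred) ?(red0 hO hred).
  - exact: (vring_bool hO).
  - exact: (vring_bool hO).
move: E'; rewrite rXM => /(congr1 (fun f : {poly kappa} => f.[y])).
rewrite hornerD hornerN hornerXn yM hornerC subrr horner_prod => /esym/eqP.
rewrite prodf_seq_eq0 => /hasP[i _] /=; rewrite map_polyXsubC rX hornerXsubC subr_eq0 => /eqP ->.
by exists (z ^+ i).
Qed.

(** If z were not 1, the relation 1 + z + ... + z^(M-1) = 0 would reduce to M = 0 in [kappa]. *)
Lemma teichmuller_inj (z : algC) : z ^+ M = 1 -> red (iota z) = 1 -> z = 1.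
Proof.
move=> zM rz; apply/eqP; rewrite -subr_eq0; apply/negPn/negP => z1.
have Oz := root_of_unity_integral zM.
have : \sum_(i < M) z ^+ i = 0.
  by apply: (mulfI z1); rewrite -subrX1 zM subrr mulr0.
move/(congr1 (fun x => red (iota x))); rewrite rmorph_sum rmorph0 (red0 hO hred).
rewrite (red_sum hO hred) => [|i]; last by rewrite rmorphXn; apply: (vringX hO).
rewrite (eq_bigr (fun=> 1)) => [|i _].
  by rewrite sumr_const card_ord => /eqP; rewrite (negPf M_kappa).
by rewrite rmorphXn (redX hO hred) // rz expr1n.
Qed.

Lemma teichmuller_unique (z w : algC) : z ^+ M = 1 -> w ^+ M = 1 ->
  red (iota z) = red (iota w) -> z = w.
Proof.
move=> zM wM E; have w0 : w != 0.
  by apply: contra_eq_neq wM => ->; rewrite expr0n (gtn_eqF M_gt0) eq_sym oner_neq0.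
have wVM : w^-1 ^+ M = 1 by rewrite exprVn wM invr1.
suff : z / w = 1 by move=> H; rewrite -(divfK w0 z) H mul1r.
apply: teichmuller_inj; first by rewrite exprMn zM wVM mulr1.
have Ow := root_of_unity_integral wM; have OVw := root_of_unity_integral wVM.
rewrite rmorphM (redM hred) //; last exact: root_of_unity_integral.
by rewrite E -(redM hred) // -rmorphM mulfV // rmorph1 (red1 hred).
Qed.

End TeichmullerLift.

Section TeichmullerCharacter.
Variables (p : nat) (p_pr : prime p).
Local Notation A := {poly 'F_p}.
Variables (P : A) (Pi : irreducible_poly P) (Pm : P \is monic).
Variables (Q : closedFieldType) (v : Q -> \bar rat).
Hypothesis hv : is_valuation_over_p p v.
Variables (iota : {rmorphism algC -> Q}) (kappa : fieldType) (red : Q -> kappa).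
Hypothesis hred : is_residue_map (vring v) red.
Variable j : {rmorphism {poly %/ P} -> kappa}.
Let M := (p ^ (size P).-1 - 1)%N.
Let hO := padic_valuation_ring hv.
Let P1 : (1 < size P)%N. Proof. by case: Pi. Qed.

Lemma card_units_gt0 : (0 < M)%N.
Proof.
rewrite subn_gt0; have : (0 < (size P).-1)%N by rewrite -ltnS prednK // ltnW.
by case: (_.-1) => // n _; apply: exp_prime_gt1.
Qed.

Lemma pchar_kappa : p \in [pchar kappa].
Proof.
apply: (rmorph_pchar (j \o (in_qpoly P : {rmorphism A -> {poly %/ P}}))%FUN).
exact: pchar_polyFp.
Qed.

Lemma card_units_neq0 : M%:R != 0 :> kappa.
Proof.
rewrite -(dvdn_pcharf pchar_kappa) /M; apply/negP => pM.
have : (p %| 1)%N.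
  have E : (1 + M = p ^ (size P).-1)%N by rewrite /M subnKC // expn_gt0 prime_gt0.
  rewrite -(dvdn_addl 1 pM) E; apply: dvdn_exp => //.
  by rewrite -ltnS prednK // ltnW.
by rewrite dvdn1 => /eqP p1; move: p_pr; rewrite p1.
Qed.

Lemma j_eq0 f : (j (in_qpoly P f) == 0) = (P %| f).
Proof.
apply/eqP/idP => [jf|Pf]; last by rewrite (eqP (_ : in_qpoly P f == 0)) ?rmorph0 // in_qpoly_eq0.
apply/negPn/negP => Pf.
have : coprimep P f by rewrite irreducible_poly_coprime.
case/Bezout_eq1_coprimepP => -[u w] /= E.
have : j (in_qpoly P 1) = 0.
  rewrite -E !rmorphD !rmorphM /= jf mulr0 addr0.
  by rewrite (eqP (_ : in_qpoly P P == 0)) ?rmorph0 ?mulr0 // in_qpoly_eq0.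
by rewrite !rmorph1 => /eqP; rewrite oner_eq0.
Qed.

Lemma j_powM f : ~~ (P %| f) -> j (in_qpoly P f) ^+ M = 1.
Proof.
move=> Pf; have jf : j (in_qpoly P f) != 0 by rewrite j_eq0.
apply: (mulfI jf); rewrite mulr1 -exprS /M subn1 prednK ?expn_gt0 ?prime_gt0 //.
apply/eqP; rewrite -subr_eq0 -!rmorphXn -rmorphB -(rmorphB (in_qpoly P)) j_eq0.
exact: poly_fermat.
Qed.

(** The Teichmueller character as a function on A, extended by 0 to the multiples of P.
    Multiplicativity and periodicity follow from the uniqueness of the lift of a given residue. *)
Lemma exists_omega : exists omega : A -> algC,
  [/\ (forall f, P %| f -> omega f = 0),
      (forall f, ~~ (P %| f) -> omega f ^+ M = 1),
      (forall f, red (iota (omega f)) = j (in_qpoly P f)),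
      (forall f g, omega (f * g) = omega f * omega g) &
      (forall f g, P %| f - g -> omega f = omega g) /\ omega 1 = 1].
Proof.
have ex f : exists z : algC, (P %| f -> z = 0) /\ (~~ (P %| f) -> z ^+ M = 1) /\
    red (iota z) = j (in_qpoly P f).
  have [Pf|Pf] := boolP (P %| f).
    by exists 0; rewrite rmorph0 (red0 hO hred); split => //; split => //; apply/esym/eqP;
      rewrite j_eq0.
  have [z [zM rz]] := teichmuller_lift hv iota hred card_units_gt0 (j_powM Pf).
  by exists z.
have [om Hom] := boolp.choice ex; exists om.
have om0 f : P %| f -> om f = 0 by case: (Hom f).
have omM f : ~~ (P %| f) -> om f ^+ M = 1 by case: (Hom f) => _ [].
have omr f : red (iota (om f)) = j (in_qpoly P f) by case: (Hom f) => _ [].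
have uniq_om := teichmuller_unique hv (iota := iota) hred card_units_gt0 card_units_neq0.
split => //.
- move=> f g; have [Pf|Pf] := boolP (P %| f).
    by rewrite (om0 _ Pf) om0 ?mul0r // dvdp_mulr.
  have [Pg|Pg] := boolP (P %| g).
    by rewrite (om0 _ Pg) om0 ?mulr0 // dvdp_mull.
  apply: uniq_om; first by apply: omM; rewrite irr_dvdM // negb_or Pf.
    by rewrite exprMn !omM ?mulr1.
  rewrite omr (rmorphM iota) (redM hred); last 2 first.
    by apply: (root_of_unity_integral hv iota card_units_gt0); apply: omM.
    by apply: (root_of_unity_integral hv iota card_units_gt0); apply: omM.
  by rewrite !omr !rmorphM.
split => [f g Pfg|].
  have PE : (P %| f) = (P %| g) by rewrite -[f](subrK g) dvdp_addr.
  have [Pf|Pf] := boolP (P %| f).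
    by rewrite !om0 -?PE.
  apply: uniq_om; rewrite ?omM -?PE // !omr; apply/eqP.
  by rewrite -subr_eq0 -rmorphB -(rmorphB (in_qpoly P)) j_eq0.
have P1' := irr_ndvd1 Pi.
by apply: uniq_om; rewrite ?omM ?expr1n // omr !rmorph1 (red1 hred).
Qed.

End TeichmullerCharacter.

Lemma dvdp_XnP (R : fieldType) (f : {poly R}) n :
  (forall i, (i < n)%N -> f`_i = 0) -> 'X^n %| f.
Proof.
move=> f0; rewrite -(poly_take_drop n f).
have -> : take_poly n f = 0.
  by apply/polyP => i; rewrite coef_take_poly coef0; case: ltnP => // /f0.
by rewrite add0r dvdp_mull.
Qed.

(** * Monic multiples of a prime and lists of primes *)

Section MonicMultiples.
Variable p : nat.
Local Notation A := {poly 'F_p}.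

Lemma size_sub_Xn m (f : A) : f \is monic -> size f = m.+1 -> (size (f - 'X^m)%R <= m)%N.
Proof.
by move=> fm sf; rewrite -ltnS -sf; apply: size_sub_monic; rewrite ?monicXn ?size_polyXn.
Qed.

(** A monic polynomial of degree m is coded by its part h below X^m. In this coding multiplication
    by Q is a bijection from the monic polynomials of degree m - deg Q, inverted by division by
    Q. *)
Lemma sum_monic_multiples (R : nmodType) (F : A -> R) (Q : A) m :
  Q \is monic -> ((size Q).-1 <= m)%N ->
  \sum_(h : {poly_m 'F_p} | Q %| 'X^m + val h) F ('X^m + val h) =
  \sum_(h : {poly_(m - (size Q).-1) 'F_p}) F (Q * ('X^(m - (size Q).-1) + val h)).
Proof.
move=> Qm; set e := (size Q).-1 => em; set l := (m - e)%N.
have Q0 : Q != 0 by apply: monic_neq0.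
have sQ : size Q = e.+1 by rewrite /e prednK // lt0n size_poly_eq0.
have mon (h : {poly_l 'F_p}) : 'X^l + val h \is monic by rewrite monic_Xn_add ?size_npoly.
have sl (h : {poly_l 'F_p}) : size ('X^l + val h) = l.+1 by rewrite size_Xn_add ?size_npoly.
have szf (h : {poly_l 'F_p}) : (size (Q * ('X^l + val h)%R - 'X^m)%R <= m)%N.
  apply: size_sub_Xn; first by rewrite (monicMl _ Qm) mon.
  rewrite size_monicM ?monic_neq0 ?mon // sl sQ /l addSn addnS /= subnKC //.
rewrite (reindex_onto (fun h : {poly_l 'F_p} => npolyp m (Q * ('X^l + val h) - 'X^m))
   (fun h => npolyp l (('X^m + val h) %/ Q - 'X^l))) /=; last first.
  move=> h Qh; apply/val_inj => /=.
  have mh : 'X^m + val h \is monic by rewrite monic_Xn_add ?size_npoly.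
  have sh : size ('X^m + val h) = m.+1 by rewrite size_Xn_add ?size_npoly.
  have E : ('X^m + val h) %/ Q * Q = 'X^m + val h by rewrite divpK.
  have dm : ('X^m + val h) %/ Q \is monic.
    by rewrite -(monicMr _ Qm) E.
  have sd : size (('X^m + val h) %/ Q) = l.+1.
    by rewrite size_divp // sh -/e /l subSn.
  have E2 : Q * ('X^l + (('X^m + val h) %/ Q - 'X^l)) - 'X^m = val h.
    by rewrite (addrC 'X^l) subrK mulrC E addrC addKr.
  by rewrite (npolypK (size_sub_Xn dm sd)) E2 npolypK // size_npoly.
apply: eq_big => h; last by move=> _; rewrite (npolypK (szf h)) addrC subrK.
have E3 : 'X^m + (Q * ('X^l + val h) - 'X^m) = Q * ('X^l + val h) by rewrite addrC subrK.
rewrite (npolypK (szf h)) E3 dvdp_mulr ?dvdpp //=.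
apply/eqP/val_inj; rewrite /= mulKp // addrC addKr; apply: npolypK.
exact: size_npoly.
Qed.

Definition monic_irreducibles_upto N (s : seq A) :=
  forall Q, (Q \in s) <-> [/\ irreducible_poly Q, Q \is monic & ((size Q).-1 <= N)%N].

Lemma exists_irreducibles N : exists s : seq A, uniq s /\
  monic_irreducibles_upto N s.
Proof.
exists [seq val b | b <- enum {poly_N.+1 'F_p} & `[< irreducible_poly (val b) >] && (val b \is
  monic)].
split; first by rewrite map_inj_uniq; [rewrite filter_uniq // enum_uniq | exact: val_inj].
move=> Q; split.
  case/mapP => b; rewrite mem_filter => /andP[/andP[/asboolP bi bm] _] ->.
  by split => //; have := size_npoly b; case: (size _).
case=> Qi Qm sQ; have sQ' : (size Q <= N.+1)%N by move: sQ; case: (size Q).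
apply/mapP; exists (npolyp N.+1 Q); last by rewrite /= npolypK.
rewrite mem_filter mem_enum /= npolypK // Qm !andbT; exact/asboolP.
Qed.

Lemma irreducible_dvd_monic (Q R : A) : irreducible_poly Q -> Q \is monic ->
  irreducible_poly R -> R \is monic -> R %| Q -> R = Q.
Proof.
move=> Qi Qm Ri Rm RQ; apply/eqP; rewrite -eqp_monic //; apply: Qi.2 => //.
by case: Ri => /gtn_eqF ->.
Qed.

End MonicMultiples.

(** * L-functions *)

Section DirichletL.
Variables (p : nat) (p_pr : prime p).
Local Notation A := {poly 'F_p}.
Variables (P : A) (Pi : irreducible_poly P) (Pm : P \is monic).
Variables (C : numFieldType) (psi : A -> C).
Hypothesis psi1 : psi 1 = 1.
Hypothesis psiM : forall f g, psi (f * g) = psi f * psi g.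
Hypothesis psi_mod : forall f g, P %| f - g -> psi f = psi g.
Hypothesis psi0 : forall f, P %| f -> psi f = 0.
Hypothesis psi_const : forall c, c != 0 -> psi c%:P = 1.
Variable c0 : A.
Hypothesis c0_P : ~~ (P %| c0).
Hypothesis c0_psi : psi c0 != 1.
Let d := (size P).-1.
Let P0 : P != 0. Proof. exact: monic_neq0. Qed.
Let sP : size P = d.+1.
Proof. by rewrite /d prednK // lt0n size_poly_eq0. Qed.

Definition monic_char_sum m : C := \sum_(h : {poly_m 'F_p}) psi ('X^m + val h).

Lemma size_modP f : (size (f %% P)%R <= d)%N.
Proof. by rewrite -ltnS -sP ltn_modp. Qed.

Lemma psi_modp f : psi (f %% P) = psi f.
Proof. by apply: psi_mod; rewrite {2}(divp_eq f P) opprD addrCA subrr addr0 dvdpNr dvdp_mull. Qed.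

(** Multiplication by [c0] permutes the residues modulo P and multiplies the sum by psi(c0), which
    is not 1. *)
Lemma psi_full_sum : \sum_(b : {poly_d 'F_p}) psi (val b) = 0.
Proof.
set S := \sum_(b | _) _; suff E : S = psi c0 * S.
  apply/eqP; move/eqP: E; rewrite -subr_eq0 -{1}[S]mul1r -mulrBl mulf_eq0 subr_eq0 eq_sym.
  by rewrite (negPf c0_psi).
rewrite {1}/S (reindex_inj (h := fun b : {poly_d 'F_p} => npolyp d ((c0 * val b) %% P))).
  by rewrite mulr_sumr; apply: eq_bigr => b _; rewrite /= npolypK ?size_modP // psi_modp psiM.
move=> b b' /(congr1 val); rewrite /= !npolypK ?size_modP // => /eqP.
rewrite -subr_eq0 -modpN -modpD -mulrBr => /eqP/eqP.
rewrite -/(dvdp P _) irr_dvdM // (negPf c0_P) /= => Pb.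
apply/val_inj/eqP; rewrite -subr_eq0; apply: contraTT Pb => b0.
apply/negP => /(dvdp_leq b0); rewrite sP leqNgt ltnS (leq_trans (size_polyD _ _)) //.
by rewrite geq_max size_polyN !size_npoly.
Qed.

Lemma psi_translate f : \sum_(b : {poly_d 'F_p}) psi (f + val b) = 0.
Proof.
rewrite -[RHS]psi_full_sum.
rewrite [RHS](reindex_inj (addrI (npolyp d (f %% P)))) /=; apply: eq_bigr => b _.
rewrite /= npolypK ?size_modP //; apply: psi_mod.
rewrite opprD addrACA subrr addr0 {1}(divp_eq f P) addrK; exact: dvdp_mull.
Qed.

(* Averaging over the translations by polynomials of degree < d turns each
   term into a sum of psi over all residues modulo P. *)
Lemma monic_char_sum_eq0 m : (d <= m)%N -> monic_char_sum m = 0.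
Proof.
move=> dm; have E : (p ^ d)%:R * monic_char_sum m = 0.
  rewrite -[(p ^ d)%N]card_polyn // mulr_natl -sumr_const.
  have wid (b : {poly_d 'F_p}) : npolyp m (val b) = val b :> A.
    by rewrite /= npolypK // (leq_trans (size_npoly b)).
  transitivity (\sum_(b : {poly_d 'F_p}) \sum_(h : {poly_m 'F_p}) psi ('X^m + val h + val b)).
    apply: eq_bigr => b _; rewrite /monic_char_sum (reindex_inj (addIr (npolyp m (val b)))) /=.
    by apply: eq_bigr => h _; rewrite wid addrA.
  by rewrite exchange_big /= big1 // => h _; apply: psi_translate.
apply/eqP; move/eqP: E; rewrite mulf_eq0 pnatr_eq0 expn_eq0 => /orP[|//].
by rewrite (gtn_eqF (prime_gt0 p_pr)).
Qed.

(** Each nonzero polynomial is one of the p - 1 nonzero constants, on which psi is 1, times a monic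
    one. *)
Lemma psi_sum_npoly n :
  \sum_(b : {poly_n 'F_p}) psi (val b) = (p - 1)%:R * \sum_(m < n) monic_char_sum m.
Proof.
elim: n => [|n IH].
  rewrite big_ord0 mulr0 big1 // => b _; apply: psi0.
  suff -> : val b = 0 by exact: dvdp0.
  by apply/eqP; rewrite -size_poly_leq0 size_npoly.
rewrite big_ord_recr /= mulrDr -IH (sum_npolyS psi) (bigD1 0) //=.
congr (_ + _); first by apply: eq_bigr => h _; rewrite scale0r add0r.
have cE (c : 'F_p) : c != 0 ->
    \sum_(h : {poly_n 'F_p}) psi (c *: 'X^n + val h) = monic_char_sum n.
  move=> c_n0; rewrite (reindex_inj (h := fun h : {poly_n 'F_p} => npolyp n (c *: val h))).
    apply: eq_bigr => h _; rewrite /= npolypK; last by rewrite size_scale // size_npoly.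
    by rewrite -scalerDr -mul_polyC psiM psi_const // mul1r.
  move=> h h' /(congr1 val) /=; rewrite !npolypK ?size_scale ?size_npoly // => E.
  by apply/val_inj; move/(congr1 (fun f => c^-1 *: f)): E; rewrite !scalerA mulVf // !scale1r.
rewrite (eq_bigr _ cE) sumr_const mulr_natl; congr (_ *+ _).
by rewrite -[in RHS](card_Fp p_pr) cardC1 subn1.
Qed.

Lemma monic_char_sum_total : \sum_(m < d) monic_char_sum m = 0.
Proof.
have := psi_sum_npoly d; rewrite psi_full_sum => /esym/eqP; rewrite mulf_eq0 pnatr_eq0.
by rewrite subn_eq0 leqNgt prime_gt1 //= => /eqP.
Qed.

Definition dirichlet_poly : {poly C} := \poly_(m < d) monic_char_sum m.

Lemma coef_dirichlet_poly m : dirichlet_poly`_m = monic_char_sum m.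
Proof. by rewrite coef_poly; case: ltnP => // /monic_char_sum_eq0 ->. Qed.

(** A trivial zero, due to psi being trivial on constants. Dividing by 1 - X supplies the Euler
    factor at infinity, where the character takes the value 1. *)
Lemma dirichlet_poly_1 : dirichlet_poly.[1] = 0.
Proof.
rewrite horner_poly -[RHS]monic_char_sum_total; apply: eq_bigr => i _.
by rewrite expr1n mulr1.
Qed.

Lemma dirichlet_poly_0 : dirichlet_poly`_0 = 1.
Proof.
rewrite coef_dirichlet_poly /monic_char_sum (big_pred1 0).
  by rewrite expr0 addr0.
move=> h; apply/esym/eqP/val_inj/eqP => /=.
by rewrite -size_poly_leq0 size_npoly.
Qed.

(** The coefficient of X^m in the Dirichlet series once the Euler factors of the primes in [s] have
    been removed. *)
Definition sieved (s : seq A) m : C :=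
  \sum_(h : {poly_m 'F_p} | all (fun Q => ~~ (Q %| 'X^m + val h)) s) psi ('X^m + val h).

(** Among the polynomials prime to [s], those divisible by Q are the Q f with f again prime to [s],
    because Q itself is not in [s]. *)
Lemma sieved_cons Q s m : irreducible_poly Q -> Q \is monic ->
  (forall R, R \in s -> irreducible_poly R /\ R \is monic) -> Q \notin s ->
  sieved s m = sieved (Q :: s) m +
    (if ((size Q).-1 <= m)%N then psi Q * sieved s (m - (size Q).-1) else 0).
Proof.
move=> Qi Qm s_irr Qs; rewrite {1}/sieved (bigID (fun h => ~~ (Q %| 'X^m + val h))) /=.
congr (_ + _).
  by apply: eq_bigl => h; rewrite /= andbC.
case: ifP => em; last first.
  rewrite big_pred0 // => h; apply/negP => /andP[_ /negPn Qh].
  have := dvdp_leq _ Qh; rewrite size_Xn_add ?size_npoly // -size_poly_eq0.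
  rewrite size_Xn_add ?size_npoly // => /(_ isT) sQ.
  by move: em; rewrite -ltnS prednK ?sQ // lt0n size_poly_eq0 monic_neq0.
under eq_bigl => h do rewrite andbC negbK.
rewrite big_mkcondr /=.
rewrite (sum_monic_multiples (fun f => if all (fun R => ~~ (R %| f)) s then psi f else 0)) //.
rewrite /sieved mulr_sumr [RHS]big_mkcond /=; apply: eq_bigr => h _.
rewrite psiM; congr (if _ then _ else _).
apply: eq_in_all => R Rs /=; have [Ri Rm] := s_irr _ Rs.
rewrite irr_dvdM //; case RQ: (R %| Q) => //.
by case/negP: Qs; rewrite -(irreducible_dvd_monic Qi Qm Ri Rm RQ) Rs.
Qed.

Lemma sieved_product N s : uniq s ->
  (forall R, R \in s -> irreducible_poly R /\ R \is monic) ->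
  'X^(N.+1) %| dirichlet_poly * (\prod_(Q <- s) (1 - psi Q *: 'X^((size Q).-1)))
               - \poly_(m < N.+1) sieved s m.
Proof.
elim: s => [_ _|Q s IH /= /andP[Qs us] s_irr].
  rewrite big_nil mulr1; apply: dvdp_XnP => i iN.
  by rewrite coefB coef_dirichlet_poly coef_poly iN /sieved /= subrr.
have s_irr' R : R \in s -> irreducible_poly R /\ R \is monic.
  by move=> Rs; apply: s_irr; rewrite inE Rs orbT.
have [Qi Qm] := s_irr Q (mem_head _ _).
rewrite big_cons mulrCA; set G := dirichlet_poly * _ in IH *.
set W := \poly_(m < N.+1) sieved s m in IH.
have /(dvdp_mull (1 - psi Q *: 'X^((size Q).-1))) := IH us s_irr'.
rewrite mulrBr => H; rewrite -(dvdp_subr _ H) opprB addrC addrA subrK; apply: dvdp_XnP => i iN.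
set e := (size Q).-1.
rewrite coefB mulrBl mul1r coefB -scalerAl coefZ coefXnM /W !coef_poly iN.
have iNe : (i - e < N.+1)%N by rewrite (leq_ltn_trans (leq_subr _ _)).
rewrite iNe (sieved_cons _ Qi Qm s_irr' Qs) -/e ltnNge.
by case: (e <= i)%N => /=; rewrite ?mulr0 ?subr0 ?addr0 ?addrK subrr.
Qed.

(** Once the primes of degree at most N are sieved out, 1 is the only monic polynomial of degree at
    most N that is left. *)
Lemma dirichlet_euler N s : uniq s ->
  monic_irreducibles_upto N s ->
  'X^(N.+1) %| dirichlet_poly * (\prod_(Q <- s) (1 - psi Q *: 'X^((size Q).-1))) - 1.
Proof.
move=> us s_irr; have s_irr' R : R \in s -> irreducible_poly R /\ R \is monic.
  by case/s_irr.
suff E : \poly_(m < N.+1) sieved s m = 1 by rewrite -[X in _ - X]E; apply: sieved_product.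
apply/polyP => -[|m]; rewrite coef_poly coef1 /=.
  rewrite /sieved (big_pred1 0); first by rewrite expr0 addr0.
  move=> h; have -> : h = 0 by apply/val_inj/eqP; rewrite -size_poly_leq0 size_npoly.
  rewrite /= addr0 eqxx expr0; apply/allP => R /s_irr'[[R1 _] _].
  by rewrite dvdp1 (gtn_eqF R1).
case: ltnP => // mN; rewrite /sieved big_pred0 // => h; apply/negP => /allP H.
have sh : size ('X^(m.+1) + val h) = m.+2 by rewrite size_Xn_add ?size_npoly.
have [|Q [Qi Qm Qh]] := @exists_monic_irreducible_factor p ('X^(m.+1) + val h); first by rewrite sh.
have h0 : 'X^(m.+1) + val h != 0 by rewrite -size_poly_eq0 sh.
have Qs : Q \in s.
  apply/s_irr; split => //; have := dvdp_leq h0 Qh; rewrite sh => sQ.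
  by rewrite -ltnS (leq_ltn_trans _ mN) // -ltnS prednK // lt0n size_poly_eq0 monic_neq0.
by move: (H _ Qs); rewrite Qh.
Qed.

Lemma exists_L_poly : exists L : {poly C}, [/\ L * (1 - 'X) = dirichlet_poly,
  L`_0 = 1 & forall N s, uniq s ->
  monic_irreducibles_upto N s ->
  'X^(N.+1) %| L * ((1 - 'X) * \prod_(Q <- s) (1 - psi Q *: 'X^((size Q).-1))) - 1].
Proof.
have /factor_theorem[q qE] : root dirichlet_poly 1 by apply/eqP/dirichlet_poly_1.
have LE : (- q) * (1 - 'X) = dirichlet_poly by rewrite mulNr -mulrN opprB qE.
exists (- q); split => // [|N s us hs]; last by rewrite mulrA LE; apply: dirichlet_euler.
by have := dirichlet_poly_0; rewrite -LE mulrBr mulr1 coefB coefMX subr0.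
Qed.

End DirichletL.

Lemma size_prod_linear (F : fieldType) (s : seq F) : (forall x, x \in s -> x != 0) ->
  size (\prod_(x <- s) (1 - x *: 'X)) = (size s).+1.
Proof.
elim: s => [|x s IH] s0; first by rewrite big_nil size_poly1.
have x0 : x != 0 by apply: s0; rewrite mem_head.
have sx : size (1 - x *: 'X) = 2.
  by rewrite addrC size_polyDl size_polyN size_scale // size_polyX // size_poly1.
have IHs : size (\prod_(x <- s) (1 - x *: 'X)) = (size s).+1.
  by apply: IH => y ys; apply: s0; rewrite inE ys orbT.
by rewrite big_cons size_mul ?sx ?IHs // -size_poly_eq0 ?sx ?IHs.
Qed.

(** * The character omega^(p^n - 1) and the degree of g *)

Section CharacterPower.
Variables (p : nat) (p_pr : prime p) (a : 'F_p) (a_neq0 : a != 0).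
Local Notation A := {poly 'F_p}.
Local Notation P := (Pa a).
Variables (Q : closedFieldType) (v : Q -> \bar rat).
Hypothesis hv : is_valuation_over_p p v.
Variables (iota : {rmorphism algC -> Q}) (kappa : fieldType) (red : Q -> kappa).
Hypothesis hred : is_residue_map (vring v) red.
Variable j : {rmorphism {poly %/ P} -> kappa}.
Variable omega : A -> algC.
Hypothesis omega0 : forall f, P %| f -> omega f = 0.
Hypothesis omega_root : forall f, ~~ (P %| f) -> omega f ^+ (p ^ (size P).-1 - 1) = 1.
Hypothesis red_omega : forall f, red (iota (omega f)) = j (in_qpoly P f).
Hypothesis omegaM : forall f g, omega (f * g) = omega f * omega g.
Hypothesis omega_mod : forall f g, P %| f - g -> omega f = omega g.
Hypothesis omega1 : omega 1 = 1.
Variable n : nat.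
Hypothesis n_gt0 : (0 < n)%N.
Hypothesis n_le : (n <= p - 1)%N.

Let N := (p ^ n - 1)%N.
Let Pi := Pa_irreducible p_pr a_neq0.
Let Pm := Pa_monic p_pr a.
Let hO := padic_valuation_ring hv.
Let P1 : (1 < size P)%N. Proof. by case: Pi. Qed.
Let np : (n < p)%N.
Proof. by rewrite -(subnK (prime_gt0 p_pr)) addn1 ltnS. Qed.

Definition omega_pow (f : A) : algC := omega f ^+ N.
Local Notation psi := omega_pow.

Lemma exponent_gt0 : (0 < N)%N.
Proof. by rewrite subn_gt0 -(prednK n_gt0) exp_prime_gt1. Qed.

Lemma omegaX f m : omega (f ^+ m) = omega f ^+ m.
Proof. by elim: m => [|m IH]; rewrite ?expr0 // !exprS omegaM IH. Qed.

Lemma exponentS : N.+1 = (p ^ n)%N.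
Proof. by rewrite /N subn1 prednK // expn_gt0 prime_gt0. Qed.

Lemma omega_pow1 : psi 1 = 1.
Proof. by rewrite /psi omega1 expr1n. Qed.

Lemma omega_powM f g : psi (f * g) = psi f * psi g.
Proof. by rewrite /psi omegaM exprMn. Qed.

Lemma omega_pow_mod f g : P %| f - g -> psi f = psi g.
Proof. by move=> fg; rewrite /psi (omega_mod fg). Qed.

Lemma omega_pow0 f : P %| f -> psi f = 0.
Proof. by move=> Pf; rewrite /psi omega0 // expr0n (gtn_eqF exponent_gt0). Qed.

Lemma omega_pow_const c : c != 0 -> psi c%:P = 1.
Proof.
move=> c0; rewrite /psi -omegaX -rmorphXn /=.
suff -> : c ^+ N = 1 by rewrite polyC1.
by apply: (mulfI c0); rewrite -exprS exponentS Fp_exppn // mulr1.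
Qed.

Lemma Pa_ndvd_X : ~~ (P %| 'X).
Proof.
apply/negP => /dvdp_leq; rewrite -size_poly_eq0 size_polyX => /(_ isT).
by rewrite size_Pa // ltnNge prime_gt1.
Qed.

(** The value 1 would mean T^(p^n) = T modulo P_a, whereas T^(p^n) = T + n a and n a is nonzero for
    0 < n < p. So T witnesses that the character is nontrivial. *)
Lemma omega_powX : psi 'X != 1.
Proof.
apply/negP => /eqP; rewrite /psi -omegaX -omega1 => /(congr1 (fun z => red (iota z))).
rewrite !red_omega => /eqP; rewrite -subr_eq0 -rmorphB -(rmorphB (in_qpoly P)).
rewrite j_eq0 // => /(dvdp_mull 'X); rewrite mulrBr mulr1 -exprS exponentS => H1.
have := Pa_frobenius p_pr a n; rewrite -(dvdp_subr _ H1) opprB addrC subrK => H2.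
have na : n%:R * a != 0 :> 'F_p.
  by rewrite mulf_neq0 // -(dvdn_pcharf (pchar_Fp p_pr)) gtnNdvd.
move: H2; rewrite -[_%:P]mulr1 mul_polyC dvdpZr // dvdp1.
by rewrite (gtn_eqF P1).
Qed.

Lemma omega_integral f : vring v (iota (omega f)).
Proof.
have [Pf|Pf] := boolP (P %| f); first by rewrite omega0 // rmorph0; apply: (vring0 hO).
by apply: (root_of_unity_integral hv iota (card_units_gt0 p_pr Pi)); apply: omega_root.
Qed.

Lemma omega_pow_integral f : vring v (iota (psi f)).
Proof. by rewrite /psi rmorphXn; apply: (vringX hO); apply: omega_integral. Qed.

Lemma red_char_sum m : red (iota (monic_char_sum psi m)) = j (in_qpoly P (power_sum p m N)).
Proof.
rewrite /monic_char_sum rmorph_sum (red_sum hO hred) => [|h]; last exact: omega_pow_integral.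
rewrite /power_sum (sum_monic (fun f => f ^+ N)) !rmorph_sum /=; apply: eq_bigr => h _.
rewrite /psi rmorphXn (redX hO hred); last exact: omega_integral.
by rewrite red_omega -!rmorphXn.
Qed.

Lemma redp_dirichlet_poly :
  integral_coefs (vring v) (map_poly iota (dirichlet_poly P psi)) /\
  redp red (map_poly iota (dirichlet_poly P psi)) = (1 - 'X) ^+ n.
Proof.
have sP : (size P).-1 = p by rewrite size_Pa.
split=> [i|].
  rewrite coef_map /= coef_poly; case: ltnP => _; last by rewrite rmorph0; apply: (vring0 hO).
  by rewrite rmorph_sum; apply: (vring_sum hO) => h *; apply: omega_pow_integral.
rewrite -(binomial_1subX _ np) big_mkord -(poly_def p (fun i => (-1) ^+ i *+ 'C(n, i))).
apply/polyP => i; rewrite (coef_redp hO hred) coef_map /= !coef_poly sP.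
case: ltnP => ip; last by rewrite rmorph0 (red0 hO hred).
by rewrite red_char_sum power_sum_in_qpoly // rmorphMn rmorphXn rmorphN rmorph1.
Qed.

Lemma cong1_part_degree (L : {poly algC}) :
  L * (1 - 'X) = dirichlet_poly P psi -> L`_0 = 1 ->
  exists2 g, is_cong1_part v (map_poly iota L) g & (size g).-1 = (n - 1)%N.
Proof.
move=> LD L0; have [OD rD] := redp_dirichlet_poly.
have LD' : map_poly iota L * (1 - 'X) = map_poly iota (dirichlet_poly P psi).
  by rewrite -LD rmorphM rmorphB rmorph1 /= map_polyX.
set L' := map_poly iota L in LD' *.
have O1X : integral_coefs (vring v) (1 - 'X).
  by rewrite -[X in _ - X]scale1r; apply: (integral_linear hO); apply: (vring1 hO).
have r1X : redp red (1 - 'X) = 1 - 'X.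
  rewrite -[X in _ - X]scale1r (redp_linear hO hred) ?(red1 hred) ?scale1r //.
  exact: (vring1 hO).
(* Dividing by 1 - X makes the coefficients of L partial sums of those of the Dirichlet polynomial,
   hence integral. *)
have OL : integral_coefs (vring v) L'.
  elim=> [|i IH]; first by rewrite coef_map /= L0 (rmorph1 iota); apply: (vring1 hO).
  have -> : L'`_i.+1 = (map_poly iota (dirichlet_poly P psi))`_i.+1 + L'`_i.
    by rewrite -LD' mulrBr mulr1 coefB coefMX /= subrK.
  exact: (vringD hO).
have rL : redp red L' = (1 - 'X) ^+ (n - 1).
  have X0 : 1 - 'X != 0 :> {poly kappa}.
    by rewrite -size_poly_eq0 -opprB size_polyN -polyC1 size_XsubC.
  apply: (mulIf X0); rewrite -exprSr subn1 prednK // -rD -LD' (redpM hO hred) //.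
  by rewrite r1X.
have L'0 : L'`_0 = 1 by rewrite coef_map /= L0 (rmorph1 iota).
have [rs rsE] := closed_field_poly_normal L'.
have [al [LE al0 sal]] := reciprocal_roots hO hred OL L'0 rsE rL.
exists (\prod_(x <- al | (0 < v (x - 1)%R)%E) (1 - x *: 'X)); first by exists al.
rewrite -big_filter size_prod_linear; last first.
  by move=> x; rewrite mem_filter => /andP[_ /al0[]].
rewrite -pred_Sn -sal; congr size; apply: eq_in_filter => x /al0[_ Ox].
have O1 := vring1 hO.
apply/idP/eqP => [v1|rx].
  have /(red_eq0 hred (vringB hO Ox O1)) := (padic_max_ideal hv (x - 1)).2 v1.
  by rewrite (redB hred) // (red1 hred) => /eqP; rewrite subr_eq0 => /eqP.
apply/(padic_max_ideal hv)/(red_eq0 hred); first exact: (vringB hO).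
by rewrite (redB hred) // rx (red1 hred) subrr.
Qed.

End CharacterPower.

(** * Euler factors of the Artin L-function *)

Section ArtinPlaces.
Variables (p : nat) (p_pr : prime p).
Local Notation A := {poly 'F_p}.
Local Notation k := (ratfun p).
Local Notation tf := (frac_embed A).
Variable K : splittingFieldType k.
Variable phi : {rmorphism A -> K}.
Hypothesis phiE : forall a, phi a = (tf a)%:A.
Local Notation cact := (cact phi).
Variable (P : A).
Hypotheses (Pi : irreducible_poly P) (Pm : P \is monic).
Hypothesis hK : splittingFieldFor 1%VS (map_poly phi (carlitz P)) {:K}.
Hypothesis d_gt1 : (1 < (size P).-1)%N.
Variables (rs : seq K).
Hypothesis rsP : map_poly phi (carlitz P) = \prod_(r <- rs) ('X - r%:P).
Hypothesis rsK : <<1 & rs>>%VS = {:K}%VS.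
Variable (lam : K).
Hypotheses (lam_rs : lam \in rs) (lam0 : lam != 0).
Variables (psi : A -> algC) (chi : gal_of {:K} -> algC).
Hypothesis psi1 : psi 1 = 1.
Hypothesis psiM : forall f g, psi (f * g) = psi f * psi g.
Hypothesis psi_const : forall c, c != 0 -> psi c%:P = 1.
Variable c0 : A.
Hypothesis c0_P : ~~ (P %| c0).
Hypothesis c0_psi : psi c0 != 1.
Hypothesis chiE : forall (s : gal_of {:K}) b, ~~ (P %| b) -> s lam = cact b lam -> chi s = psi b.

Let tf_inj : injective tf := @frac_embed_inj _.
Let tf_frac : forall x, exists a b, b != 0 /\ x = tf a / tf b.
Proof. exact: fracP. Qed.

Local Notation S := [set s in 'Gal({:K} / 1)%g | chi s == 1]%SET.
Local Notation F := (fixedField_aspace S).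
Local Notation E := (subvs_of F).

Lemma mem_gal_base (s : gal_of {:K}) : s \in 'Gal({:K} / 1)%g.
Proof. by rewrite gal_kHom ?sub1v // k1AHom. Qed.

Lemma mem_char_ker (s : gal_of {:K}) : (s \in S) = (chi s == 1).
Proof. by rewrite inE mem_gal_base. Qed.

Lemma chi1 : chi 1%g = 1.
Proof.
rewrite (chiE (irr_ndvd1 Pi)) //; by rewrite gal_id cact1.
Qed.

Lemma chiM (s t : gal_of {:K}) : chi (s * t)%g = chi s * chi t.
Proof.
have [b [Pb sb _]] := gal_acts_exists p_pr phiE Pi Pm rsP lam_rs lam0 s.
have [c [Pc tc _]] := gal_acts_exists p_pr phiE Pi Pm rsP lam_rs lam0 t.
rewrite (chiE Pb sb) (chiE Pc tc) -psiM; apply: chiE.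
  by rewrite (irr_dvdM Pi) negb_or Pb.
by rewrite galM ?memvf // sb (gal_cact p_pr phiE) tc -(cactM p_pr).
Qed.

Lemma char_ker_group : group_set S.
Proof.
apply/group_setP; split; first by rewrite mem_char_ker chi1.
by move=> s t; rewrite !mem_char_ker chiM => /eqP-> /eqP->; rewrite mulr1.
Qed.

Lemma char_ker_proper : (#|S| < #|{: gal_of {:K}}|)%N.
Proof.
have [s sc] := gal_acts_surj p_pr tf_inj tf_frac phiE Pi Pm hK rsP rsK lam_rs lam0 c0_P.
rewrite -cardsT; apply: proper_card; rewrite properT; apply/eqP => ST.
have : s \in S by rewrite ST inE.
by rewrite mem_char_ker (chiE c0_P sc) (negPf c0_psi).
Qed.

Lemma char_ker_constants (s : gal_of {:K}) (c : 'F_p) :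
  c != 0 -> s lam = phi c%:P * lam -> s \in S.
Proof.
move=> c_neq0 sc; rewrite mem_char_ker (chiE (b := c%:P)) ?psi_const //.
  have [P1 _] := Pi; apply/negP => /dvdp_leq; rewrite polyC_eq0 c_neq0 size_polyC c_neq0.
  by move=> /(_ isT); rewrite leqNgt P1.
by rewrite cactC.
Qed.

(** Agreement on F puts s t^-1 in Gal(K / F), which is [S] itself because [S] is a group. So chi
    only depends on restrictions to F, as the choice of a lift in [char_place] requires. *)
Lemma chi_eq (s t : gal_of {:K}) : (forall x, x \in F -> s x = t x) -> chi s = chi t.
Proof.
move=> st; have : (s * t^-1)%g \in S.
  rewrite -[S]/(gval (Group char_ker_group)) -gal_fixedField gal_kHom ?subvf //.
  apply/kAHomP => x xF; rewrite galM ?memvf // st //.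
  by rewrite -galM ?memvf // mulgV gal_id.
by rewrite mem_char_ker => /eqP E1; rewrite -[s](mulgKV t) chiM E1 mul1r.
Qed.

(** The three clauses, asked at every place above [v], have separate roles: the first gives
    unramifiedness, the second, at one place above [v], shows that a lift of Frobenius exists, and
    the third that whichever lift [xget] picks agrees with sigma on F. *)
Lemma char_place_unramified (v : set k) t (sigma : gal_of {:K}) e :
  is_place v -> place_degree v = e -> max_ideal v t ->
  (forall w : set E, valuation_ring w -> (forall x, v x <-> w x%:A) ->
    [/\ (forall y, max_ideal w y -> exists2 z, w z & y = t *: z),
        (forall x, w x -> max_ideal w (vsproj F (sigma (vsval x)) - x ^+ (p ^ e))) &
        forall s : gal_of {:K},
        (forall x, w x -> max_ideal w (vsproj F (s (vsval x)) - x ^+ (p ^ e))) ->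
        forall x, x \in F -> s x = sigma x]) ->
  char_place chi v = chi sigma.
Proof.
move=> [hv [u vu]] ve mt H; rewrite /char_place /lifts_frobenius /char_field.
have -> : `[< unramified_in E v >].
  apply/asboolP => w [hw _] wv y my; have [H1 _ _] := H w hw wv.
  by have [z wz ->] := H1 y my; exists t, z.
case: xgetP => [s _ [_ [w [[hw _] wv]]]|/(_ sigma) []].
  rewrite ve => Hs; have [_ _ H3] := H w hw wv.
  by apply: chi_eq; apply: H3.
split; first exact: mem_gal_base.
have [w hw wv'] := place_extension (in_alg E) hv.
have wv : forall x, v x <-> w x%:A := wv'.
exists w; rewrite ve; split; [split => //| |].
- by exists u%:A; move/wv.
- exact: wv.
- by case: (H w hw wv) => _ H2 _; exact: H2.
Qed.

Lemma place_degree_vinf : place_degree (vinf tf) = 1%N.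
Proof.
apply: (place_degreeE p_pr); first exact: vinf_valuation.
exact: residue_dim_vinf.
Qed.

Lemma place_degree_vfin (Q : A) : irreducible_poly Q -> place_degree (vfin tf Q) = (size Q).-1.
Proof.
move=> Qi; apply: (place_degreeE p_pr); first exact: (vfin_valuation tf_inj tf_frac Qi).
exact: (residue_dim_vfin tf_inj tf_frac Qi).
Qed.

Lemma char_place_vinf : char_place chi (vinf tf) = 1.
Proof.
rewrite -chi1; apply: (char_place_unramified (t := (tf 'X)^-1) (e := 1)).
- exact: (vinf_place p_pr tf_inj tf_frac).
- exact: place_degree_vinf.
- apply/(vinf_maxP p_pr tf_inj tf_frac); exists 1; last by rewrite mulr1.
  by case: (vinf_valuation tf_inj tf_frac).
move=> w hw wv.
have [sE [sE1 _] [H1 H2 H3]] := frobenius_at_infinite (S := S) p_pr tf_inj tf_frac phiE Pi Pm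
  hK
  rsP rsK lam_rs lam0 d_gt1 char_ker_constants hw wv.
by split=> // x wx; rewrite -sE1; apply: H2.
Qed.

Lemma char_place_conductor : char_place chi (vfin tf P) = 0.
Proof.
rewrite /char_place /char_field; case: asboolP => // unr.
have [w [hw wv [y my Hy]]] := ramified_at_conductor (S := S) p_pr tf_inj tf_frac phiE Pi Pm rsP rsK
  lam_rs lam0 char_ker_group char_ker_proper.
have [t [z [mt wz yE]]] : exists t z, [/\ max_ideal (vfin tf P) t, w z & y = t *: z].
  apply: (unr w) => //; split => //; exists (tf P)^-1%:A.
  by move/wv; apply: (vfin_ninv tf_inj tf_frac Pi).
by case: (Hy t z mt wz).
Qed.

Lemma char_place_vfin (Q : A) : irreducible_poly Q -> Q \is monic -> ~~ (P %| Q) ->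
  char_place chi (vfin tf Q) = psi Q.
Proof.
move=> Qi Qm PQ.
have [sigma sQ] := gal_acts_surj p_pr tf_inj tf_frac phiE Pi Pm hK rsP rsK lam_rs lam0 PQ.
rewrite -(chiE PQ sQ); apply: (char_place_unramified (t := tf Q) (e := (size Q).-1)).
- exact: (vfin_place tf_inj tf_frac Qi).
- exact: place_degree_vfin.
- exact/(vfin_max_poly tf_inj tf_frac Qi)/dvdpp.
move=> w hw wv.
have [sE [sE1 _] [H1 H2 H3]] := frobenius_at_finite (S := S) p_pr tf_inj tf_frac phiE Pi Pm
  rsP rsK lam_rs lam0 Qi Qm sQ hw wv.
by split=> // x wx; rewrite -sE1; apply: H2.
Qed.

Lemma vfin_neq_vinf (Q : A) : irreducible_poly Q -> vfin tf Q <> vinf tf.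
Proof.
move=> Qi E; apply: (vinf_ninv p_pr tf_inj); rewrite invrK -E; exact: vfin_poly.
Qed.

Lemma vfin_monic_inj (Q R : A) : irreducible_poly Q -> Q \is monic ->
  irreducible_poly R -> R \is monic -> vfin tf Q = vfin tf R -> Q = R.
Proof.
move=> Qi Qm Ri Rm E; apply/esym/(irreducible_dvd_monic Qi Qm Ri Rm).
have : max_ideal (vfin tf R) (tf Q) by rewrite -E; apply/(vfin_max_poly tf_inj tf_frac Qi)/dvdpp.
by move/(vfin_max_poly tf_inj tf_frac Ri).
Qed.

Lemma places_of_degree_le N (s : seq A) : (0 < N)%N ->
  monic_irreducibles_upto N s ->
  [set v : set k | is_place v /\ (place_degree v <= N)%N] =
  [set` vinf tf :: [seq vfin tf Q | Q <- s]].
Proof.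
move=> N0 hs; apply/seteqP; split => v /=.
  move=> [[hv nv] vN]; rewrite inE.
  case: (place_classification p_pr tf_inj tf_frac hv nv) => [->|[Q [Qi Qm vQ]]].
    by rewrite eqxx.
  apply/orP; right; apply/mapP; exists Q => //; apply/hs; split => //.
  by rewrite -(place_degree_vfin Qi) -vQ.
rewrite inE => /orP[/eqP->|/mapP[Q /hs[Qi Qm QN] ->]].
  by rewrite place_degree_vinf; split => //; apply: (vinf_place p_pr tf_inj tf_frac).
by rewrite (place_degree_vfin Qi); split => //; apply: (vfin_place tf_inj tf_frac Qi).
Qed.

Lemma places_of_degree_0 : [set v : set k | is_place v /\ (place_degree v <= 0)%N] = set0.
Proof.
apply/seteqP; split => v //= -[[hv nv]].
case: (place_classification p_pr tf_inj tf_frac hv nv) => [->|[Q [Qi Qm ->]]].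
  by rewrite place_degree_vinf.
by rewrite (place_degree_vfin Qi); case: Qi; case: (size Q) => [|[]].
Qed.

Lemma uniq_places (s : seq A) : uniq s -> (forall Q, Q \in s -> irreducible_poly Q /\ Q \is
  monic) ->
  uniq (vinf tf :: [seq vfin tf Q | Q <- s]).
Proof.
move=> us s_irr; rewrite cons_uniq; apply/andP; split.
  by apply/negP => /mapP[Q /s_irr[Qi _] /esym]; apply: vfin_neq_vinf.
rewrite map_inj_in_uniq // => Q R /s_irr[Qi Qm] /s_irr[Ri Rm]; exact: vfin_monic_inj.
Qed.

Hypothesis psi0 : forall f, P %| f -> psi f = 0.

(** For N > 0 the place at infinity, of degree 1, is counted and contributes 1 - X. The factor at P
    is 1 on both sides, by ramification on the left and by psi(P) = 0 on the right. *)
Lemma euler_denE N (s : seq A) : (0 < N)%N -> uniq s ->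
  monic_irreducibles_upto N s ->
  euler_den chi N = (1 - 'X) * \prod_(Q <- s) (1 - psi Q *: 'X^((size Q).-1)).
Proof.
move=> N0 us hs; rewrite /euler_den (places_of_degree_le N0 hs) -fsbig_seq; last first.
  by apply: uniq_places => // Q /hs[].
rewrite big_cons big_map char_place_vinf place_degree_vinf scale1r expr1; congr (_ * _).
apply: eq_big_seq => Q /hs[Qi Qm _]; rewrite (place_degree_vfin Qi).
have [PQ|PQ] := boolP (P %| Q); last by rewrite char_place_vfin.
by rewrite psi0 // -(irreducible_dvd_monic Qi Qm Pi Pm PQ) char_place_conductor.
Qed.

Lemma artin_L_dirichlet (L : {poly algC}) : L`_0 = 1 ->
  (forall N s, uniq s ->
  monic_irreducibles_upto N s ->
  'X^(N.+1) %| L * ((1 - 'X) * \prod_(Q <- s) (1 - psi Q *: 'X^((size Q).-1))) - 1) ->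
  is_artin_L chi L.
Proof.
(* No place has degree 0, so for N = 0 the Euler product is empty and the claim is that L has
   constant term 1. *)
move=> L0 HL [|N].
  rewrite /euler_den places_of_degree_0 fsbig_set0 mulr1; apply: dvdp_XnP => -[|//] _.
  by rewrite coefB coef1 L0 subrr.
have [s [us hs]] := exists_irreducibles p N.+1.
rewrite (euler_denE _ us hs) //; exact: HL.
Qed.

End ArtinPlaces.

(** * Values of the Teichmueller character on automorphisms *)

Section TeichmullerValue.
Variables (p : nat) (p_pr : prime p).
Local Notation A := {poly 'F_p}.
Variable K : splittingFieldType (ratfun p).
Variable phi : {rmorphism A -> K}.
Hypothesis phiE : forall a, phi a = (frac_embed A a)%:A.
Local Notation cact := (cact phi).
Variable (P : A).
Hypotheses (Pi : irreducible_poly P) (Pm : P \is monic).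
Variables (rs : seq K).
Hypothesis rsP : map_poly phi (carlitz P) = \prod_(r <- rs) ('X - r%:P).
Variable (lam : K).
Hypotheses (lam_rs : lam \in rs) (lam0 : lam != 0).
Variables (Q : closedFieldType) (v : Q -> \bar rat).
Hypothesis hv : is_valuation_over_p p v.
Variables (iota : {rmorphism algC -> Q}) (kappa : fieldType) (red : Q -> kappa).
Hypothesis hred : is_residue_map (vring v) red.
Variable j : {rmorphism {poly %/ P} -> kappa}.
Variable omega : A -> algC.
Hypothesis omega_root : forall f, ~~ (P %| f) -> omega f ^+ (p ^ (size P).-1 - 1) = 1.
Hypothesis red_omega : forall f, red (iota (omega f)) = j (in_qpoly P f).
Hypothesis omega_mod : forall f g, P %| f - g -> omega f = omega g.

Lemma carlitzKE b l : (carlitzK K b).[l] = cact b l.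
Proof.
rewrite -(horner_carlitz p_pr); congr (_.[_]); apply: eq_map_poly => c.
by rewrite phiE.
Qed.

(** If b and c both describe s, then C_(b - c) kills [lam] and P divides b - c. Hence the root of
    unity selected by [xget] is unique, and [omega b] is one. *)
Lemma teichmullerE (s : gal_of {:K}) b : ~~ (P %| b) -> s lam = cact b lam ->
  teichmuller iota red j s = omega b.
Proof.
move=> Pb sb; have coP c : coprimep c P = ~~ (P %| c).
  by rewrite coprimep_sym irreducible_poly_coprime.
rewrite /teichmuller; case: xgetP => [z _ [zM [c [cP sc rz]]]|/(_ (omega b)) []].
  have Pc : ~~ (P %| c) by rewrite -coP.
  have : s lam = cact c lam.
    rewrite sc ?carlitzKE // rootE carlitzKE -(mem_torsion p_pr rsP) //.
  rewrite sb => bc; have : cact (b - c) lam = 0 by rewrite cactDl cactNl bc subrr.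
  move/(torsion_dvd p_pr Pi rsP lam_rs lam0) => Pbc.
  rewrite (omega_mod Pbc).
  apply: (teichmuller_unique hv (iota := iota) hred (card_units_gt0 p_pr Pi) (card_units_neq0
    p_pr Pi j)) => //.
    exact: omega_root.
  by rewrite red_omega.
split; first exact: omega_root.
exists b; split => //; first by rewrite coP.
move=> l; rewrite rootE carlitzKE -(mem_torsion p_pr rsP) // => lr.
rewrite carlitzKE; exact: (acts_all p_pr phiE Pi Pm rsP lam_rs lam0 sb lr).
Qed.

End TeichmullerValue.

Theorem theorem1 (p : nat) (p_pr : prime p) (a : 'F_p) (a_neq0 : a != 0) :
  [/\ irreducible_poly (Pa a),
      size (Pa a) = p.+1,
      (forall n, (n <= p - 1)%N ->
         map_poly (in_qpoly (Pa a))
           (\sum_(0 <= m < p) power_sum p m (p ^ n - 1) *: 'X^m)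
         = (1 - 'X) ^+ n :> {poly {poly %/ Pa a}}
         /\ forall m, (m <= p - 1)%N ->
              Pa a %| power_sum p m (p ^ n - 1) - (-1) ^+ m *+ 'C(n, m)) &
      (forall (K : splittingFieldType (ratfun p))
              (Qpbar : closedFieldType) (v : Qpbar -> \bar rat)
              (iota : {rmorphism algC -> Qpbar})
              (kappa : fieldType) (red : Qpbar -> kappa)
              (j : {rmorphism {poly %/ Pa a} -> kappa}),
         cyclotomic_function_field K (Pa a) ->
         is_padic_closure p v ->
         is_residue_map (vring v) red ->
         forall n, (1 <= n <= p - 1)%N ->
           exists (L : {poly algC}) (g : {poly Qpbar}),
             [/\ is_artin_L
                   (fun s : gal_of {:K} =>
                      teichmuller iota red j s ^+ (p ^ n - 1)) L,
                 is_cong1_part v (map_poly iota L) g &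
                 (size g).-1 = (n - 1)%N])].
Proof.
split.
- exact: Pa_irreducible.
- exact: size_Pa.
- move=> n np; split; first exact: power_sum_generating.
  move=> m mp; apply: power_sum_dvd => //.
  by rewrite -(subnK (prime_gt0 p_pr)) addn1 ltnS.
move=> K Qpbar v iota kappa red j hK [hv _ _] hred n /andP[n_gt0 n_le].
have Pi := Pa_irreducible p_pr a_neq0; have Pm := Pa_monic p_pr a.
have [om [om0 om_root om_red omM [om_mod om1]]] := exists_omega p_pr Pi Pm hv iota hred j.
pose psi := omega_pow om n.
have psi1 : psi 1 = 1 := omega_pow1 om1 n.
have psiM : forall f g, psi (f * g) = psi f * psi g := omega_powM omM n.
have psi_mod : forall f g, Pa a %| f - g -> psi f = psi g.
  by move=> f g; apply: (omega_pow_mod om_mod).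
have psi0 : forall f, Pa a %| f -> psi f = 0.
  by move=> f; apply: (omega_pow0 p_pr om0 n_gt0).
have psi_const : forall c, c != 0 -> psi c%:P = 1.
  by move=> c; apply: (omega_pow_const p_pr omM om1).
have X_P : ~~ (Pa a %| 'X) := Pa_ndvd_X p_pr a.
have X_psi : psi 'X != 1.
  exact: (omega_powX p_pr a_neq0 om_red omM om1 n_gt0 n_le).
have [L [LD L0 HL]] := exists_L_poly p_pr Pi Pm psi1 psiM psi_mod psi0 psi_const X_P X_psi.
have [g Lg sg] := cong1_part_degree p_pr a_neq0 hv hred om0 om_root om_red n_gt0 n_le LD L0.
exists L, g; split => //.
(* [L] and [g] were obtained from the character on A alone; K enters only now, to identify [L] with
   the Artin L-function. *)
pose phi : {rmorphism {poly 'F_p} -> K} := (in_alg K \o frac_embed _)%FUN.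
have phiE b : phi b = (frac_embed {poly 'F_p} b)%:A by [].
have hK' : splittingFieldFor 1%VS (map_poly phi (carlitz (Pa a))) {:K} := hK.
move: phi phiE hK' => phi phiE hK'.
have [rs [rsP rsK]] := cyclotomic_roots p_pr Pm hK'.
have phi_inj : injective phi := phi_inj (tf := frac_embed {poly 'F_p}) (@frac_embed_inj _) phiE.
have [lam lam_rs lam0] := exists_torsion p_pr phi_inj Pi Pm rsP.
have chiE (s : gal_of {:K}) b : ~~ (Pa a %| b) -> s lam = cact phi b lam ->
    teichmuller iota red j s ^+ (p ^ n - 1) = psi b.
  move=> Pb sb; congr (_ ^+ _).
  exact: (teichmullerE p_pr phiE Pi Pm rsP lam_rs lam0 hv hred om_root om_red om_mod Pb sb).
have d_gt1 : (1 < (size (Pa a)).-1)%N by rewrite size_Pa // prime_gt1.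
exact: (artin_L_dirichlet p_pr phiE Pi Pm hK' d_gt1 rsP rsK lam_rs lam0 psi1 psiM psi_const
  X_P X_psi chiE psi0 L0 HL).
Qed.
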